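(* For each odd prime $p$, the groups $$\mathscr G_{HC_2^{(1)}}(p)=\langle a,b,c\mid a^p,b^p,c^p,[a,b,a],[a,b,b],[b,c,b],[b,c,c],[a,c,a],[a,c,c,a],[a,c,c,c]\rangle,$$ $$\mathscr G_{HB_2^{(2)}}(p)=\langle a,b,c\mid a^p,b^p,c^p,[a,b,a],[a,b,b],[c,b,c],[c,b,b,c],[c,b,b,b],[c,a,c],[c,a,a,c],[c,a,a,a]\rangle,$$ and $$\widetilde{\mathscr G}_{HBC_2^{(3)}}(p)=\langle t,a,b\mid t^3,a^p,tat^{-1}b^{-1},[a,b,a],[a,b,b,a],[a,b,b,b]\rangle$$ are infinite hyperbolic. Moreover, for all primes $p\ge 7$ the groups $\mathscr G_{HC_2^{(1)}}(p)$ and $\mathscr G_{HB_2^{(2)}}(p)$ have Kazhdan's property (T), and for all primes $p\ge 11$ the group $\widetilde{\mathscr G}_{HBC_2^{(3)}}(p)$ has Kazhdan's property (T).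
   Context: Commutators: $[x,y]=x^{-1}y^{-1}xy$, and $[x_1,\dots,x_n]=[[\dots[[x_1,x_2],x_3],\dots],x_n]$. ''Hyperbolic'' means Gromov-hyperbolic. *)

(* Defs.v *)
From HB Require Import structures.
From mathcomp Require Import all_boot all_order all_algebra.
From mathcomp Require Import generic_quotient sesquilinear.
From mathcomp Require Import all_classical all_reals all_analysis.
From mathcomp Require Import complex.

Set Implicit Arguments.
Unset Strict Implicit.
Unset Printing Implicit Defensive.

Import Order.TTheory GRing.Theory Num.Theory numFieldNormedType.Exports.

Local Open Scope classical_set_scope.
Local Open Scope quotient_scope.
Local Open Scope group_scope.

Section FreeGroup.
Variable X : choiceType.

(* The letter (x, true) stands for x and (x, false) for its formal inverse. *)
Let word := seq (X * bool).
Implicit Types u v w : word.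

Inductive free_eq : word -> word -> Prop :=
| free_eq_refl w : free_eq w w
| free_eq_sym u v : free_eq u v -> free_eq v u
| free_eq_trans v u w : free_eq u v -> free_eq v w -> free_eq u w
| free_eq_cancel u v x b :
    free_eq (u ++ (x, b) :: (x, ~~ b) :: v) (u ++ v).

Lemma free_eq_cat u u' v v' :
  free_eq u u' -> free_eq v v' -> free_eq (u ++ v) (u' ++ v').
Proof.
move=> uu' vv'; apply: (@free_eq_trans (u' ++ v)).
  elim: uu' => [w|{}u w _|w {}u t _ + _|{}u w x b].
  - exact: free_eq_refl.
  - exact: free_eq_sym.
  - exact: free_eq_trans.
  - by rewrite -!catA; exact: free_eq_cancel.
elim: vv' => [w|s w _|w s t _ + _|s w x b].
- exact: free_eq_refl.
- exact: free_eq_sym.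
- exact: free_eq_trans.
- by rewrite !catA; exact: free_eq_cancel.
Qed.

Definition word_inv w : word := rev [seq (l.1, ~~ l.2) | l <- w].

Lemma free_eq_inv u v : free_eq u v -> free_eq (word_inv u) (word_inv v).
Proof.
elim=> [w|s w _|w s t _ + _|s w x b].
- exact: free_eq_refl.
- exact: free_eq_sym.
- exact: free_eq_trans.
- rewrite /word_inv !map_cat !rev_cat /= !rev_cons -!cats1 -!catA /= negbK.
  exact: free_eq_cancel.
Qed.

Lemma word_invK : involutive word_inv.
Proof.
move=> w; rewrite /word_inv map_rev revK -map_comp -[RHS]map_id.
by apply: eq_map => -[x b] /=; rewrite negbK.
Qed.

Lemma free_eq_mulV w : free_eq (w ++ word_inv w) [::].
Proof.
elim: w => [|[x b] w IHw]; first exact: free_eq_refl.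
rewrite /word_inv /= rev_cons -cats1 catA.
apply: (@free_eq_trans ([:: (x, b)] ++ [::] ++ [:: (x, ~~ b)])).
  rewrite -cat_cons -(cat1s (x, b)) -catA.
  apply: free_eq_cat; first exact: free_eq_refl.
  by apply: free_eq_cat => //; exact: free_eq_refl.
exact: (free_eq_cancel [::] [::]).
Qed.

Let free_eqb u v := `[< free_eq u v >].

Lemma free_eqb_refl : reflexive free_eqb.
Proof. by move=> u; apply/asboolP; exact: free_eq_refl. Qed.

Lemma free_eqb_sym : symmetric free_eqb.
Proof. by move=> u v; apply/asboolP/asboolP => /free_eq_sym. Qed.

Lemma free_eqb_trans : transitive free_eqb.
Proof.
by move=> v u w /asboolP uv /asboolP vw; apply/asboolP/(free_eq_trans uv).
Qed.

Canonical free_equiv :=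
  EquivRel free_eqb free_eqb_refl free_eqb_sym free_eqb_trans.

Definition free_group := {eq_quot free_equiv}.
HB.instance Definition _ := Choice.on free_group.

Definition free_class u : free_group := \pi u.

Lemma free_classP u v : free_class u = free_class v <-> free_eq u v.
Proof.
split=> [/eqP|uv]; first by rewrite /free_class eqmodE => /asboolP.
by apply/eqP; rewrite /free_class eqmodE; apply/asboolP.
Qed.

Lemma free_repr u : free_eq (repr (free_class u)) u.
Proof. by apply/free_classP; rewrite /free_class reprK. Qed.

Lemma free_ind (P : free_group -> Prop) :
  (forall u, P (free_class u)) -> forall x, P x.
Proof. by move=> Pu x; rewrite -[x]reprK; exact: Pu. Qed.

Definition free_mul (x y : free_group) := free_class (repr x ++ repr y).
Definition free_inv (x : free_group) := free_class (word_inv (repr x)).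

Lemma free_mulE u v :
  free_mul (free_class u) (free_class v) = free_class (u ++ v).
Proof. by apply/free_classP/free_eq_cat; exact: free_repr. Qed.

Lemma free_invE u : free_inv (free_class u) = free_class (word_inv u).
Proof. exact/free_classP/free_eq_inv/free_repr. Qed.

Lemma free_mulA : associative free_mul.
Proof.
elim/free_ind=> u; elim/free_ind=> v; elim/free_ind=> w.
by rewrite !free_mulE catA.
Qed.

Lemma free_mul1 : left_id (free_class [::]) free_mul.
Proof. by elim/free_ind=> u; rewrite free_mulE. Qed.

Lemma free_mulr1 : right_id (free_class [::]) free_mul.
Proof. by elim/free_ind=> u; rewrite free_mulE cats0. Qed.

Lemma free_mulV : right_inverse (free_class [::]) free_inv free_mul.
Proof.
elim/free_ind=> u; rewrite free_invE free_mulE.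
exact/free_classP/free_eq_mulV.
Qed.

Lemma free_mulVl : left_inverse (free_class [::]) free_inv free_mul.
Proof.
elim/free_ind=> u; rewrite free_invE free_mulE.
by apply/free_classP; rewrite -{2}[u]word_invK; exact: free_eq_mulV.
Qed.

HB.instance Definition _ := isGroup.Build free_group
  free_mulA free_mul1 free_mulr1 free_mulVl free_mulV.

Definition free_gen (x : X) : free_group := free_class [:: (x, true)].

End FreeGroup.

Section QuotientGroup.
Variables (G : groupType) (A : set G).

Definition normal_subgroup (N : set G) : Prop :=
  [/\ N 1, forall x y, N x -> N y -> N (x * y),
      forall x, N x -> N x^-1 & forall x y, N x -> N (x ^ y)].

Definition normal_closure : set G := smallest normal_subgroup A.

Lemma normal_closureP : normal_subgroup normal_closure.
Proof.
split.
- by move=> N [[]].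
- by move=> x y Nx Ny N NA; case: (NA) => -[_ + _ _] _; apply; [exact: Nx|exact: Ny].
- by move=> x Nx N NA; case: (NA) => -[_ _ + _] _; apply; exact: Nx.
- by move=> x y Nx N NA; case: (NA) => -[_ _ _ +] _; apply; exact: Nx.
Qed.

Let coset_eqb (x y : G) := `[< normal_closure (x^-1 * y) >].

Lemma coset_eqb_refl : reflexive coset_eqb.
Proof.
by move=> x; apply/asboolP; rewrite mulVg; case: normal_closureP.
Qed.

Lemma coset_eqb_sym : symmetric coset_eqb.
Proof.
move=> x y; case: normal_closureP => _ _ NV _.
by apply/asboolP/asboolP => /NV; rewrite invgM invgK.
Qed.

Lemma coset_eqb_trans : transitive coset_eqb.
Proof.
move=> y x z /asboolP xy /asboolP yz; apply/asboolP.
case: normal_closureP => _ NM _ _.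
by have := NM _ _ xy yz; rewrite -mulgA mulVKg.
Qed.

Canonical coset_equiv :=
  EquivRel coset_eqb coset_eqb_refl coset_eqb_sym coset_eqb_trans.

Definition quotient_group := {eq_quot coset_equiv}.
HB.instance Definition _ := Choice.on quotient_group.

Definition quot_class (x : G) : quotient_group := \pi x.

Lemma quot_classP x y :
  quot_class x = quot_class y <-> normal_closure (x^-1 * y).
Proof.
split=> [/eqP|uv]; first by rewrite /quot_class eqmodE => /asboolP.
by apply/eqP; rewrite /quot_class eqmodE; apply/asboolP.
Qed.

Lemma quot_repr x : normal_closure ((repr (quot_class x))^-1 * x).
Proof. by apply/quot_classP; rewrite /quot_class reprK. Qed.

Lemma quot_ind (P : quotient_group -> Prop) :
  (forall x, P (quot_class x)) -> forall x, P x.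
Proof. by move=> Pu x; rewrite -[x]reprK; exact: Pu. Qed.

Definition quot_mul (x y : quotient_group) := quot_class (repr x * repr y).
Definition quot_inv (x : quotient_group) := quot_class (repr x)^-1.

Lemma quot_mulE x y :
  quot_mul (quot_class x) (quot_class y) = quot_class (x * y).
Proof.
apply/quot_classP; case: normal_closureP => _ NM _ NJ.
have -> : (repr (quot_class x) * repr (quot_class y))^-1 * (x * y) =
  ((repr (quot_class x))^-1 * x) ^ repr (quot_class y) *
  ((repr (quot_class y))^-1 * y).
  by rewrite /conjg invgM -!mulgA mulVKg.
by apply: NM; [apply: NJ|]; exact: quot_repr.
Qed.

Lemma quot_invE x : quot_inv (quot_class x) = quot_class x^-1.
Proof.
apply/quot_classP; case: normal_closureP => _ NM NV NJ.
have -> : (repr (quot_class x))^-1^-1 * x^-1 =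
  (((repr (quot_class x))^-1 * x)^-1) ^ x^-1.
  by rewrite /conjg invgM !invgK mulgA mulVKg.
by apply: NJ; apply: NV; exact: quot_repr.
Qed.

Lemma quot_mulA : associative quot_mul.
Proof.
elim/quot_ind=> x; elim/quot_ind=> y; elim/quot_ind=> z.
by rewrite !quot_mulE mulgA.
Qed.

Lemma quot_mul1 : left_id (quot_class 1) quot_mul.
Proof. by elim/quot_ind=> x; rewrite quot_mulE mul1g. Qed.

Lemma quot_mulr1 : right_id (quot_class 1) quot_mul.
Proof. by elim/quot_ind=> x; rewrite quot_mulE mulg1. Qed.

Lemma quot_mulVl : left_inverse (quot_class 1) quot_inv quot_mul.
Proof. by elim/quot_ind=> x; rewrite quot_invE quot_mulE mulVg. Qed.

Lemma quot_mulV : right_inverse (quot_class 1) quot_inv quot_mul.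
Proof. by elim/quot_ind=> x; rewrite quot_invE quot_mulE mulgV. Qed.

HB.instance Definition _ := isGroup.Build quotient_group
  quot_mulA quot_mul1 quot_mulr1 quot_mulVl quot_mulV.

End QuotientGroup.

Definition presented_group (X : choiceType) (rels : seq (free_group X)) :
  groupType := quotient_group [set` rels].

Section WordMetric.
Variables (G : groupType) (S : seq G).

Definition word_of_length (g : G) (n : nat) : Prop :=
  exists w : seq G, [/\ size w = n,
    {subset w <= S ++ [seq s^-1 | s <- S]} & \prod_(s <- w) s = g].

Definition generates : Prop :=
  forall g, exists n, `[< word_of_length g n >].

Definition word_norm (genS : generates) (g : G) : nat := ex_minn (genS g).

Definition word_dist (R : realType) (genS : generates) (x y : G) : R :=
  ((word_norm genS (x^-1 * y))%:R)%R.

End WordMetric.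

Definition gromov_product (R : realType) (T : Type) (d : T -> T -> R)
    (x y o : T) : R :=
  ((d x o + d y o - d x y) / 2)%R.

Definition gromov_hyperbolic (R : realType) (T : Type) (d : T -> T -> R) :=
  exists2 delta : R, (0 <= delta)%R & forall x y z o : T,
    (Num.min (gromov_product d x y o) (gromov_product d y z o) - delta
      <= gromov_product d x z o)%R.

(* The four-point condition is imposed on the vertex set of the Cayley graph,
   which is at finite Hausdorff distance from its geometric realization. *)
Definition hyperbolic_group (R : realType) (G : groupType) : Prop :=
  exists (S : seq G) (genS : generates S),
    gromov_hyperbolic (@word_dist G S R genS).

Definition infinite_group (G : groupType) : Prop := infinite_set [set: G].

Section PropertyT.
Variables (R : realType) (G : groupType).
Local Notation C := R[i].

(* A complete normed space whose norm comes from an inner product, i.e. a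
   complex Hilbert space. *)
Definition hilbert_product (H : completeNormedModType C)
    (form : {dot H for @Num.conj C}%R) : Prop :=
  forall xi : H, (`|xi| ^+ 2 = form xi xi)%R.

(* Each pi g is invertible, with inverse pi g^-1, so isometries are unitary. *)
Definition unitary_representation (H : completeNormedModType C)
    (form : {dot H for @Num.conj C}%R) (pi : G -> {linear H -> H}) : Prop :=
  [/\ forall xi, pi 1 xi = xi,
      forall g h xi, pi (g * h) xi = pi g (pi h xi) &
      forall g xi eta, form (pi g xi) (pi g eta) = form xi eta].

(* For a discrete group, compact subsets are the finite ones and every
   representation is strongly continuous. *)
Definition property_T : Prop :=
  exists (Q : set G) (eps : R), [/\ finite_set Q, (0 < eps)%R &
    forall (H : completeNormedModType C) (form : {dot H for @Num.conj C}%R)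
        (pi : G -> {linear H -> H}),
      hilbert_product form -> unitary_representation form pi ->
      (exists2 xi : H, xi != 0%R &
        forall g, Q g -> (`|pi g xi - xi| < eps%:C%C * `|xi|)%R) ->
      exists2 eta : H, eta != 0%R & forall g, pi g eta = eta].

End PropertyT.

Definition HC2_group (p : nat) : groupType :=
  let a := free_gen (inord 0 : 'I_3) in
  let b := free_gen (inord 1 : 'I_3) in
  let c := free_gen (inord 2 : 'I_3) in
  presented_group [:: a ^+ p; b ^+ p; c ^+ p;
    [~ a, b, a]; [~ a, b, b]; [~ b, c, b]; [~ b, c, c];
    [~ a, c, a]; [~ a, c, c, a]; [~ a, c, c, c]].

Definition HB2_group (p : nat) : groupType :=
  let a := free_gen (inord 0 : 'I_3) in
  let b := free_gen (inord 1 : 'I_3) in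
  let c := free_gen (inord 2 : 'I_3) in
  presented_group [:: a ^+ p; b ^+ p; c ^+ p;
    [~ a, b, a]; [~ a, b, b];
    [~ c, b, c]; [~ c, b, b, c]; [~ c, b, b, b];
    [~ c, a, c]; [~ c, a, a, c]; [~ c, a, a, a]].

Definition HBC2_ext_group (p : nat) : groupType :=
  let t := free_gen (inord 0 : 'I_3) in
  let a := free_gen (inord 1 : 'I_3) in
  let b := free_gen (inord 2 : 'I_3) in
  presented_group [:: t ^+ 3; a ^+ p; t * a * t^-1 * b^-1;
    [~ a, b, a]; [~ a, b, b, a]; [~ a, b, b, b]].

(* Main.v *)
(* Write [A2 x y] for [x,y,x] = [x,y,y] = 1 and [B2 x y] for [x,y,x] =
   [x,y,y,x] = [x,y,y,y] = 1. The first two groups, and the normal subgroup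
   of index 3 generated by the conjugates of [a] in the third one, are
   triangle groups: three generators of order p such that any two of them
   satisfy [A2] or [B2], and hence generate a finite group of order p^3 or
   p^4.

   Infinite: the elementary matrices 1 + X e_12, 1 + X e_23, 1 + X e_31 over
   F_p[X] satisfy all the relations, and the powers of their product have
   entries of growing degree.

   Hyperbolic: the group acts on a complex of triangles (chambers), in which
   the link of a vertex is the coset graph of the two generators of its
   stabiliser. Links have girth at least 6, and at least 8 for the relation
   [B2]. These two facts give normal forms for the vertices, a level
   function, and a projection from each level to the previous one which
   shortens every walk of length 5 to length at most 3. The highest level at
   which the ancestors of two vertices are still close then plays the role
   of their Gromov product.

   Property (T): let P_i be the projection onto the vectors fixed by the
   i-th generator and L = sum (1 - P_i). A computation in the finite vertex
   groups bounds the cosine of the angle between two fixed spaces by 1/sqrt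
   p for [A2] and by sqrt (2/p) for [B2], whence |L x|^2 >= lam <L x, x> for
   the stated p. Iterating x - L x / 3 from an almost invariant vector
   therefore converges geometrically to a nearby invariant vector. *)

Require Import Defs.
From HB Require Import structures.
From mathcomp Require Import all_boot all_order all_algebra sesquilinear.
From mathcomp Require Import all_classical all_reals all_analysis complex.
From mathcomp Require Import zify ring lra.

Set Implicit Arguments.
Unset Strict Implicit.
Unset Printing Implicit Defensive.

Import Order.TTheory GRing.Theory Num.Theory numFieldNormedType.Exports.

(** * A coarse hyperbolicity criterion *)

(** Nothing is known in advance about the presented groups, not even that their generators are
    nontrivial. Lower bounds come from homomorphisms: killing a generator, elementary matrices and
    an affine unipotent action show that edge and vertex groups meet as expected and that links have
    no short cycles. The complex is built abstractly, as a set of normal forms on which the vertex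
    groups act compatibly. The presentation turns this into an action of the whole group, and
    evaluating a normal form recovers the group element; neither simple connectivity nor a
    local-to-global curvature theorem is invoked.

    Three links of girth 6 alone would allow flat planes, as in a Euclidean building of type A2, so
    a vertex type with girth 8 has to be met often enough along a walk inside a level. Moreover a
    walk shrinks only while it is long, and lower neighbours are defined only up to one step. Hence
    the hyperbolicity criterion is stated for a relation [close] that is transitive only up to a
    shift of the level. *)

Section Coarse.
Variables (T : Type) (n : T -> nat) (d : T -> T -> nat).
(** [close m x y] stands for a Gromov product of at least [m], up to a bounded error; in the
    application, the ancestors at level [m] are a bounded walk apart. *)
Variables (close : nat -> T -> T -> Prop) (c : nat).
Hypothesis d_refl : forall x, d x x = 0.
Hypothesis d_sym : forall x y, d x y = d y x.
Hypothesis d_norm : forall x y, n x <= n y + d x y /\ n y <= n x + d x y.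
Hypothesis d_norms : forall x y, d x y <= n x + n y.
Hypothesis geodesic : forall x y, exists z : nat -> T,
  [/\ z 0 = x, z (d x y) = y & forall i, i < d x y -> d (z i) (z i.+1) <= 1].
Hypothesis close_le : forall k m x y, k <= m -> close m x y -> close k x y.
Hypothesis close_sym : forall m x y, close m x y -> close m y x.
Hypothesis close_trans : forall m x y z,
  close m x y -> close m y z -> close (m - c) x z.
Hypothesis close_step : forall x y, d x y <= 1 -> close (n x - c) x y.

Lemma close_refl x : close (n x - c) x x.
Proof. by apply: close_step; rewrite d_refl. Qed.

(* Along a sequence that climbs at unit speed the loss [c] of every use of
   transitivity is compensated, up to a bounded error, every [c] steps. *)
Lemma close_climb (z : nat -> T) t L :
  (forall i, i <= L -> t + i <= n (z i)) ->
  (forall i, i < L -> d (z i) (z i.+1) <= 1) ->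
  forall i j, i <= j -> j <= L -> close (t + i - 2 * (c.+1 + c.+1 * c.+1)) (z i) (z j).
Proof.
move=> nz dz.
(* Chaining single steps loses [c] at each of them, which is acceptable only over a bounded
   stretch. *)
have short k i : i + k <= L -> close (t + i - (c + c * k)) (z i) (z (i + k)).
  elim: k => [|k IH] ik.
    rewrite addn0; apply: close_le (close_refl (z i)).
    by have := nz i; lia.
  have ck := IH (ltac:(lia)).
  have s : d (z (i + k)) (z (i + k).+1) <= 1 by apply: dz; lia.
  have nk := nz (i + k) (ltac:(lia)).
  have c1 : close (t + i - (c + c * k)) (z (i + k)) (z (i + k).+1).
    by apply: close_le (close_step s); lia.
  by rewrite addnS; apply: close_le (close_trans ck c1); rewrite mulnS; lia.
suff H M i j : j - i <= M -> i <= j -> j <= L ->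
    close (t + i - 2 * (c.+1 + c.+1 * c.+1)) (z i) (z j).
  by move=> i j; exact: (H (j - i)).
elim: M i j => [|M IH] i j ijM ij jL.
  have e : j = i + 0 by lia.
  by rewrite e; apply: close_le (short 0 i _); lia.
case: (leqP (j - i) c.+1) => [jc|jc].
  have e : j = i + (j - i) by lia.
  rewrite e; apply: close_le (short (j - i) i _); last by lia.
  have : c * (j - i) <= c.+1 * c.+1 by apply: leq_mul => //.
  by lia.
(* Over [c.+1] steps the guaranteed level rises by [c.+1], which pays for the [c] lost when the
   rest, treated by induction, is attached. *)
have c1 := short c.+1 i (ltac:(lia)).
have c2 := IH (i + c.+1) j (ltac:(lia)) (ltac:(lia)) jL.
set K := 2 * _ in c2 *.
have KE : c + c * c.+1 + c <= K by rewrite /K; lia.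
have c1' : close (t + i + c.+1 - K) (z i) (z (i + c.+1)).
  by apply: close_le c1; rewrite /K; lia.
have c2' : close (t + i + c.+1 - K) (z (i + c.+1)) (z j).
  by apply: close_le c2; lia.
by apply: close_le (close_trans c1' c2'); lia.
Qed.

(** A geodesic of length [L] stays above [n x - i] and above [n y - (L - i)]. The two lines cross at
    height [t], half of [n x + n y - L]; both halves climb away from the crossing point [i0], and
    [close_climb] applies to each. *)
Lemma close_gromov : exists C, forall m x y,
  m.*2 + d x y + C <= n x + n y -> close m x y.
Proof.
pose K := 2 * (c.+1 + c.+1 * c.+1).
exists (2 * (K + c) + 2) => m x y mxy.
have [z [z0 zL dz]] := geodesic x y; set L := d x y in zL dz mxy.
have up i : i <= L -> n x <= n (z i) + i.
  elim: i => [|i IH] iL; first by rewrite z0 addn0.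
  have := IH (ltnW iL); have := dz i iL; have [] := d_norm (z i) (z i.+1); lia.
have dn i : i <= L -> n y <= n (z (L - i)) + i.
  elim: i => [|i IH] iL; first by rewrite subn0 zL addn0.
  have e : L - i = (L - i.+1).+1 by lia.
  have := IH (ltnW iL); have := dz (L - i.+1) (ltac:(lia)).
  by rewrite e; have [] := d_norm (z (L - i.+1)) (z (L - i.+1).+1); lia.
have [tri1 tri2] := d_norm x y; have tri3 := d_norms x y.
rewrite -/L in tri1 tri2 tri3.
pose t := (n x + n y - L)./2; pose i0 := n x - t.
have tE : t.*2 <= n x + n y - L <= t.*2.+1.
  by have := odd_double_half (n x + n y - L); rewrite -/t; case: odd => /=; lia.
have i0L : i0 <= L by rewrite /i0; lia.
have tx : t <= n x by lia.
have right i : i <= L - i0 -> t + i <= n (z (i0 + i)).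
  move=> iL; have := dn (L - (i0 + i)) (leq_subr _ _).
  by rewrite subKn; rewrite /i0 in iL *; lia.
have left i : i <= i0 -> t + i <= n (z (i0 - i)).
  by move=> iL; have := up (i0 - i) (ltac:(lia)); rewrite /i0 in iL *; lia.
have cr : close (t + 0 - K) (z (i0 + 0)) (z (i0 + (L - i0))).
  apply: (close_climb (z := fun i => z (i0 + i)) right) => // i iL.
  by rewrite addnS; apply: dz; lia.
have cl : close (t + 0 - K) (z (i0 - 0)) (z (i0 - i0)).
  apply: (close_climb (z := fun i => z (i0 - i)) left) => // i iL.
  rewrite (_ : i0 - i = (i0 - i.+1).+1); last by lia.
  by rewrite d_sym; apply: dz; lia.
rewrite addn0 subnn z0 subn0 in cl; rewrite !addn0 subnKC // zL in cr.
by apply: close_le (close_trans (close_sym cl) cr); lia.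
Qed.

Hypothesis close_far : forall m x y, close m x y -> d x y + m.*2 <= n x + n y + c.

Lemma coarse_hyperbolic : exists C, forall k x y z,
  k + d x z <= n x + n z -> k + d z y <= n z + n y ->
  k + d x y <= n x + n y + C.
Proof.
have [C HC] := close_gromov; exists (C + 4 * c + 4) => k x y z kxz kzy.
have kE := odd_double_half k.
pose m := (k - C)./2; have mE := odd_double_half (k - C); rewrite -/m in mE.
case: (leqP k C) => kC; first by have := d_norms x y; lia.
have cxz : close m x z by apply: HC; lia.
have czy : close m z y by apply: HC; lia.
have := close_far (close_trans cxz czy); lia.
Qed.

End Coarse.

Local Open Scope classical_set_scope.
Local Open Scope group_scope.

(** * Group presentations *)

Section Bijections.
Variable T : Type.

(** Target of the homomorphisms built below, for possibly infinite [T]. The inverse is carried as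
    data and is determined by the function ([symgrpP]). *)
Record symgrp := Symgrp { sym_fun :> T -> T; sym_inv : T -> T;
  sym_funK : cancel sym_fun sym_inv; sym_invK : cancel sym_inv sym_fun }.

Lemma symgrpP (f g : symgrp) : f =1 g -> f = g.
Proof.
case: f g => [f f' fK f'K] [g g' gK g'K] /= /funext e; subst g.
have e : f' = g' by apply: funext => x; rewrite -[LHS](gK (f' x)) f'K.
by subst g'; congr Symgrp; exact: Prop_irrelevance.
Qed.

HB.instance Definition _ := gen_eqMixin symgrp.
HB.instance Definition _ := gen_choiceMixin symgrp.

(* Bijections are composed from left to right: they act on the right. *)
Definition sym_mul (f g : symgrp) : symgrp := Symgrp
  (can_comp (sym_funK g) (sym_funK f)) (can_comp (sym_invK f) (sym_invK g)).
Definition sym_one : symgrp := @Symgrp id id (frefl _) (frefl _).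
Definition sym_opp (f : symgrp) : symgrp := Symgrp (sym_invK f) (sym_funK f).

Lemma sym_mulA : associative sym_mul.
Proof. by move=> f g h; exact: symgrpP. Qed.
Lemma sym_mul1 : left_id sym_one sym_mul.
Proof. by move=> f; exact: symgrpP. Qed.
Lemma sym_mulr1 : right_id sym_one sym_mul.
Proof. by move=> f; exact: symgrpP. Qed.
Lemma sym_mulV : left_inverse sym_one sym_opp sym_mul.
Proof. by move=> f; apply: symgrpP => x /=; rewrite sym_invK. Qed.
Lemma sym_mulVr : right_inverse sym_one sym_opp sym_mul.
Proof. by move=> f; apply: symgrpP => x /=; rewrite sym_funK. Qed.

HB.instance Definition _ := isGroup.Build symgrp
  sym_mulA sym_mul1 sym_mulr1 sym_mulV sym_mulVr.

Lemma symgrpM (f g : symgrp) x : (f * g) x = g (f x).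
Proof. by []. Qed.

Lemma symgrp1 x : (1 : symgrp) x = x.
Proof. by []. Qed.

End Bijections.

Section PresentedHom.
Variables (X : choiceType) (H : groupType) (f : X -> H).

Definition letter_val (l : X * bool) : H := if l.2 then f l.1 else (f l.1)^-1.
Definition word_val (w : seq (X * bool)) : H := \prod_(l <- w) letter_val l.

Lemma word_val_eq u v : free_eq u v -> word_val u = word_val v.
Proof.
elim=> [//|{}u {}v _ ->//|{}v {}u w _ -> _ ->//|{}u {}v x b].
rewrite /word_val !big_cat !big_cons; congr (_ * _).
by case: b; rewrite /letter_val /= ?mulVKg ?mulKg.
Qed.

Definition free_lift (x : free_group X) : H := word_val (repr x).

Lemma free_liftE u : free_lift (free_class u) = word_val u.
Proof. exact/word_val_eq/free_repr. Qed.

Lemma free_lift_morphism : (free_lift 1 = 1) * {morph free_lift : x y / x * y}.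
Proof.
split; first by rewrite [1]/(free_class [::]) free_liftE /word_val big_nil.
elim/free_ind=> u; elim/free_ind=> v.
have -> : free_class u * free_class v = free_class (u ++ v) by exact: free_mulE.
by rewrite !free_liftE /word_val big_cat.
Qed.

HB.instance Definition _ := isUMagmaMorphism.Build _ _ free_lift free_lift_morphism.

Lemma free_lift_gen x : free_lift (free_gen x) = f x.
Proof. by rewrite free_liftE /word_val big_seq1. Qed.

Variable rels : seq (free_group X).
Hypothesis frels : forall r, r \in rels -> free_lift r = 1.

(* The hypothesis is an argument so that the lift can carry a canonical
   structure of morphism. *)
Definition presented_lift (x : presented_group rels) : H :=
  let _ := frels in free_lift (repr x).

Lemma free_lift_closure x : normal_closure [set` rels] x -> free_lift x = 1.
Proof.
move=> nx; apply: (nx [set y | free_lift y = 1]); split; last by move=> r /frels.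
split=> [|x' y e1 e2|x' e|x' y e] /=.
- exact: gmulf1.
- by rewrite gmulfM /= e1 e2 mulg1.
- by rewrite gmulfV /= e invg1.
- by rewrite gmulfJ /= e conj1g.
Qed.

Lemma presented_liftE x : presented_lift (quot_class _ x) = free_lift x.
Proof.
have := free_lift_closure (quot_repr (A := [set` rels]) x).
by rewrite gmulfM gmulfV /= => /mulg1_eq <-; rewrite invgK.
Qed.

Lemma presented_lift_morphism : (presented_lift 1 = 1) * {morph presented_lift : x y / x * y}.
Proof.
split; first by rewrite [1]/(quot_class _ 1) presented_liftE gmulf1.
elim/quot_ind=> x; elim/quot_ind=> y.
have -> : quot_class [set` rels] x * quot_class _ y = quot_class _ (x * y)
  by exact: quot_mulE.
by rewrite !presented_liftE gmulfM.
Qed.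

HB.instance Definition _ :=
  isUMagmaMorphism.Build _ _ presented_lift presented_lift_morphism.

End PresentedHom.

Section Presented.
Variables (X : choiceType) (rels : seq (free_group X)).

Definition pclass (x : free_group X) : presented_group rels := quot_class _ x.

Lemma pclass_morphism : (pclass 1 = 1) * {morph pclass : x y / x * y}.
Proof. by split=> // x y; symmetry; exact: quot_mulE. Qed.

HB.instance Definition _ := isUMagmaMorphism.Build _ _ pclass pclass_morphism.

Definition pgen x := pclass (free_gen x).

Lemma pclass_rel r : r \in rels -> pclass r = 1.
Proof.
move=> rr; symmetry; apply/quot_classP; rewrite invg1 mul1g.
by move=> N [_]; apply.
Qed.

(** Relators are tested on every morphism [F] with the prescribed values at the generators, so they
    can be evaluated by rewriting with the morphism laws instead of through words. *)
Lemma presented_hom (H : groupType) (f : X -> H) :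
  (forall F : UMagmaMorphism.type (free_group X) H,
    (forall x, F (free_gen x) = f x) -> forall r, r \in rels -> F r = 1) ->
  exists phi : UMagmaMorphism.type (presented_group rels) H,
    forall x, phi (pgen x) = f x.
Proof.
move=> Hf; have frels := Hf (free_lift f) (free_lift_gen f).
exists (presented_lift frels) => x.
by rewrite /= presented_liftE free_lift_gen.
Qed.

Lemma presented_ind (D : presented_group rels -> Prop) : D 1 ->
  (forall x y, D x -> D (x * pgen y)) -> (forall x y, D x -> D (x * (pgen y)^-1)) ->
  forall x, D x.
Proof.
move=> D1 Dg DV; elim/quot_ind=> x; elim/free_ind: x => w.
elim/last_ind: w => [|w [x b] IH]; first exact: D1.
have -> : quot_class [set` rels] (free_class (rcons w (x, b))) =
    pclass (free_class w) * (if b then pgen x else (pgen x)^-1).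
  rewrite -cats1; have -> : free_class (w ++ [:: (x, b)]) =
      free_class w * free_class [:: (x, b)] by rewrite [RHS]free_mulE.
  rewrite -/(pclass _) gmulfM; congr (_ * _); case: b => //.
  by rewrite /pgen -gmulfV; congr pclass; rewrite [RHS]free_invE.
by case: b; [exact: Dg|exact: DV].
Qed.

End Presented.

(** * Pairs of elements satisfying A2 or B2 *)

Section Relations.
Variable G : groupType.
Implicit Types x y z : G.

Definition A2 x y := [~ x, y, x] = 1 /\ [~ x, y, y] = 1.
Definition B2 x y := [/\ [~ x, y, x] = 1, [~ x, y, y, x] = 1 & [~ x, y, y, y] = 1].
Definition vertex_rel (b : bool) x y := if b then B2 x y else A2 x y.

Lemma A2_B2 x y : A2 x y -> B2 x y.
Proof. by move=> [e1 e2]; split=> //; rewrite e2 comm1g. Qed.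

Lemma A2_vertex_rel b x y : A2 x y -> vertex_rel b x y.
Proof. by case: b => //; exact: A2_B2. Qed.

Lemma vertex_rel_B2 b x y : vertex_rel b x y -> B2 x y.
Proof. by case: b => //; exact: A2_B2. Qed.

Lemma A2_1l y : A2 1 y.
Proof. by rewrite /A2 !comm1g. Qed.

Lemma A2_1r x : A2 x 1.
Proof. by rewrite /A2 commg1 !comm1g. Qed.

Lemma commg_eq x y z : x * y = y * x * z -> [~ x, y] = z.
Proof. by move=> e; apply: (mulgI (y * x)); rewrite -commgC e. Qed.

Lemma A2_intro x y z : x * y = y * x * z -> commute z x -> commute z y -> A2 x y.
Proof. by move=> /commg_eq ez zx zy; split; rewrite ez; apply/eqP/commgP. Qed.

Lemma A2_sym x y : A2 x y -> A2 y x.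
Proof.
move=> [/eqP/commgP e1 /eqP/commgP e2].
apply: (A2_intro (z := [~ x, y]^-1)).
- by rewrite (commgC x y) mulgK.
- exact/commute_sym/commuteV/commute_sym.
- exact/commute_sym/commuteV/commute_sym.
Qed.

Section B2Facts.
Variables (p : nat) (x y : G).
Hypotheses (xp : x ^+ p = 1) (yp : y ^+ p = 1) (Bxy : B2 x y).
Let d := [~ x, y].
Let e := [~ x, y, y].

Lemma B2_dx : commute d x. Proof. by case: Bxy => /eqP/commgP. Qed.
Lemma B2_ex : commute e x. Proof. by case: Bxy => _ /eqP/commgP. Qed.
Lemma B2_ey : commute e y. Proof. by case: Bxy => _ _ /eqP/commgP. Qed.
Lemma B2_ed : commute e d.
Proof.
rewrite /d commgEl; apply: commuteM; first exact/commuteV/B2_ex.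
rewrite conjgE; apply: commuteM; first exact/commuteV/B2_ey.
by apply: commuteM; [exact: B2_ex|exact: B2_ey].
Qed.

(** [x ^ y = x * d], and [x] commutes with [d]: compare p-th powers. *)
Lemma B2_dp : d ^+ p = 1.
Proof.
have : (x ^ y) ^+ p = x ^+ p * d ^+ p.
  rewrite -expgMn; last exact/commute_sym/B2_dx.
  by rewrite /d commgEl mulVKg.
by rewrite -conjXg xp conj1g mul1g => <-.
Qed.

Lemma B2_ep : e ^+ p = 1.
Proof.
have : (d ^ y) ^+ p = d ^+ p * e ^+ p.
  rewrite -expgMn; last exact/commute_sym/B2_ed.
  by rewrite /e commgEl mulVKg.
by rewrite -conjXg B2_dp conj1g mul1g => <-.
Qed.

(** Moving [y] to the left past [x ^+ l] and [d ^+ m] creates only [d ^+ l] and [e ^+ m], so these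
    products are stable under right multiplication by [x] and [y]: a normal form with at most p^4
    values. *)
Definition B2_elt k l m n := y ^+ k * x ^+ l * d ^+ m * e ^+ n.

Lemma B2_elt_x k l m n : B2_elt k l m n * x = B2_elt k l.+1 m n.
Proof.
rewrite /B2_elt -!mulgA -(commuteX n (commute_sym B2_ex)).
rewrite (mulgA (d ^+ m) x) -(commuteX m (commute_sym B2_dx)).
by rewrite expgSr -!mulgA.
Qed.

Lemma xXy l : x ^+ l * y = y * (x ^+ l * d ^+ l).
Proof.
rewrite -expgMn; last exact/commute_sym/B2_dx.
have -> : x * d = x ^ y by rewrite /d commgEl mulVKg.
by rewrite -conjXg -conjgC.
Qed.

Lemma dXy m : d ^+ m * y = y * (d ^+ m * e ^+ m).
Proof.
rewrite -expgMn; last exact/commute_sym/B2_ed.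
have -> : d * e = d ^ y by rewrite /e commgEl mulVKg.
by rewrite -conjXg -conjgC.
Qed.

Lemma B2_elt_y k l m n : B2_elt k l m n * y = B2_elt k.+1 l (l + m) (m + n).
Proof.
rewrite /B2_elt -!mulgA -(commuteX n (commute_sym B2_ey)) (mulgA (d ^+ m) y) dXy.
by rewrite -!mulgA (mulgA (x ^+ l) y) xXy expgSr !expgnDr !mulgA.
Qed.

Lemma expg_modp z n : z ^+ p = 1 -> z ^+ (n %% p) = z ^+ n.
Proof.
by move=> zp; rewrite {2}(divn_eq n p) expgnDr mulnC expgnA zp expg1n mul1g.
Qed.

Lemma B2_finite (D : set G) : (0 < p)%N ->
  (forall z, D z -> exists k l m n, z = B2_elt k l m n) -> finite_set D.
Proof.
move=> p0 HD; pose f (t : 'I_p * 'I_p * 'I_p * 'I_p) :=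
  B2_elt t.1.1.1 t.1.1.2 t.1.2 t.2.
apply: (@sub_finite_set _ _ (f @` setT)); last first.
  by apply: finite_image; exact: finite_finset.
move=> z /HD [k [l [m [n ->]]]].
pose o i : 'I_p := Ordinal (ltn_pmod i p0).
exists (o k, o l, o m, o n) => //.
by rewrite /f /B2_elt /= !expg_modp // ?B2_dp ?B2_ep.
Qed.

End B2Facts.
End Relations.

(** * Word norms and the four-point condition *)

Section WordNorm.
Variables (G : groupType) (S : seq G) (genS : generates S).
Local Notation norm := (word_norm genS).
Local Notation dist x y := (norm (x^-1 * y)).

Lemma word_norm_word g : word_of_length S g (norm g).
Proof. by rewrite /word_norm; case: ex_minnP => m /asboolP. Qed.

Lemma word_norm_le g m : word_of_length S g m -> norm g <= m.
Proof. by move=> w; rewrite /word_norm; case: ex_minnP => k _; apply; apply/asboolP. Qed.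

Lemma word_norm1 : norm 1 = 0.
Proof.
by apply/eqP; rewrite -leqn0; apply: word_norm_le; exists [::]; rewrite big_nil.
Qed.

Lemma word_of_length_cat g h k m : word_of_length S g k ->
  word_of_length S h m -> word_of_length S (g * h) (k + m).
Proof.
move=> [u [<- Su <-]] [v [<- Sv <-]]; exists (u ++ v).
rewrite size_cat big_cat; split=> // x; rewrite mem_cat.
by case/orP; [exact: Su|exact: Sv].
Qed.

Lemma word_normM g h : norm (g * h) <= norm g + norm h.
Proof.
by apply: word_norm_le; apply: word_of_length_cat; exact: word_norm_word.
Qed.

Lemma word_of_length_inv g k : word_of_length S g k -> word_of_length S g^-1 k.
Proof.
move=> [w [<- + <-]]; elim: w {k g} => [|x w IH] Sw.
  by exists [::]; rewrite !big_nil invg1.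
rewrite big_cons invgM /= -addn1; apply: word_of_length_cat.
  by apply: IH => y yw; apply: Sw; rewrite inE yw orbT.
exists [:: x^-1]; rewrite big_seq1; split=> // y; rewrite inE => /eqP ->.
have := Sw x; rewrite inE eqxx => /(_ isT); rewrite !mem_cat => /orP[xS|].
  by apply/orP; right; apply: map_f.
by move=> /mapP[s sS ->]; rewrite invgK sS.
Qed.

Lemma word_normV g : norm g^-1 = norm g.
Proof.
have H h : norm h^-1 <= norm h.
  by apply: word_norm_le; apply: word_of_length_inv; exact: word_norm_word.
by apply/eqP; rewrite eqn_leq H -{1}[g]invgK H.
Qed.

Lemma word_dist_sym (x y : G) : dist x y = dist y x.
Proof. by rewrite -word_normV invgM invgK. Qed.

Lemma word_geodesic (x y : G) : exists z : nat -> G,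
  [/\ z 0%N = x, z (dist x y) = y &
      forall i, i < dist x y -> dist (z i) (z i.+1) <= 1].
Proof.
have [w [sw Sw pw]] := word_norm_word (x^-1 * y).
exists (fun i => x * \prod_(s <- take i w) s); split.
- by rewrite take0 big_nil mulg1.
- by rewrite -sw take_size pw mulVKg.
- rewrite -sw => i iw; rewrite (take_nth 1 iw) -cats1 big_cat big_seq1 invgM.
  rewrite -mulgA mulKg mulKg; apply: word_norm_le; exists [:: nth 1 w i].
  rewrite big_seq1; split=> // s; rewrite inE => /eqP ->.
  by apply: Sw; exact: mem_nth.
Qed.

(** Left translation moves the base point to 1, and [k] becomes the smaller of two doubled Gromov
    products; hence the half in [C / 2]. *)
Lemma gromov_hyperbolic_norm (R : realType) :
  (exists C, forall (k : nat) x y z,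
    k + dist x z <= norm x + norm z -> k + dist z y <= norm z + norm y ->
    k + dist x y <= norm x + norm y + C) ->
  gromov_hyperbolic (@word_dist G S R genS).
Proof.
move=> [C HC]; exists (C%:R / 2)%R; first by rewrite divr_ge0.
move=> x y z o; rewrite /gromov_product /word_dist.
have tr (u v : G) : u^-1 * v = (o^-1 * u)^-1 * (o^-1 * v).
  by rewrite invgM invgK -mulgA mulVKg.
rewrite (word_dist_sym x o) (word_dist_sym y o) (word_dist_sym z o).
rewrite (tr x y) (tr y z) (tr x z).
move: (o^-1 * x) (o^-1 * y) (o^-1 * z) => {tr o}x {}y {}z.
have t (u v : G) : dist u v <= norm u + norm v.
  by apply: leq_trans (word_normM _ _) _; rewrite word_normV.
pose k := minn (norm x + norm y - dist x y) (norm y + norm z - dist y z).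
have := HC k x z y _ _.
have txy := t x y; have tyz := t y z.
have h1 : k + dist x y <= norm x + norm y by rewrite /k; lia.
have h2 : k + dist y z <= norm y + norm z by rewrite /k; lia.
move=> /(_ h1 h2).
have kE : (k = norm x + norm y - dist x y \/ k = norm y + norm z - dist y z)%N.
  by rewrite /k; lia.
move: kE txy tyz h1 h2; clear; move: (k) (norm x) (norm y) (norm z) (dist x y) (dist y z) (dist x z).
move=> {}k nx ny nz dxy dyz dxz kE txy tyz h1 h2.
rewrite -(ler_nat R) !natrD => h3.
have : (Num.min ((nx%:R + ny%:R - dxy%:R) / 2) ((ny%:R + nz%:R - dyz%:R) / 2) <= k%:R / 2 :> R)%R.
  rewrite ge_min; case: kE => ->; apply/orP; [left|right]; rewrite natrB // natrD; lra.
by lra.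
Qed.

End WordNorm.

(** * The three vertex types *)

Inductive ty := T0 | T1 | T2.

Definition ty_eqb i j :=
  match i, j with T0, T0 | T1, T1 | T2, T2 => true | _, _ => false end.

Lemma ty_eqP : Equality.axiom ty_eqb.
Proof. by move=> [] []; constructor. Qed.

HB.instance Definition _ := hasDecEq.Build ty ty_eqP.
HB.instance Definition _ := gen_choiceMixin ty.

(** This is -(i + j) in Z/3; the default value at equal arguments makes [third i] an involution
    without side condition. *)
Definition third i j :=
  match i, j with
  | T0, T1 | T1, T0 => T2
  | T0, T2 | T2, T0 => T1
  | T1, T2 | T2, T1 => T0
  | _, _ => i
  end.

Lemma thirdC i j : third i j = third j i.
Proof. by case: i; case: j. Qed.

Lemma third_neq i j : i != j -> (third i j != i) && (third i j != j).
Proof. by case: i; case: j. Qed.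

Lemma thirdK i j : third i (third i j) = j.
Proof. by case: i; case: j. Qed.

Lemma thirdKr i j : third (third i j) i = j.
Proof. by rewrite thirdC thirdK. Qed.

Lemma thirdKl i j : third (third i j) j = i.
Proof. by rewrite (thirdC i) thirdKr. Qed.

Lemma third_cases i j k : i != j -> [|| k == i, k == j | k == third i j].
Proof. by case: i; case: j; case: k. Qed.

(** * The complex of a triangle of groups *)

(* [X i] is the stabiliser of a vertex of type [i] of the base chamber and [A i]
   the stabiliser of the opposite edge. *)
Section Geometry.
Variables (G : groupType) (A X : ty -> set G).
Hypothesis A1 : forall i, A i 1.
Hypothesis AM : forall i x y, A i x -> A i y -> A i (x * y).
Hypothesis AV : forall i x, A i x -> A i x^-1.
Hypothesis X1 : forall i, X i 1.
Hypothesis XM : forall i x y, X i x -> X i y -> X i (x * y).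
Hypothesis XV : forall i x, X i x -> X i x^-1.
Hypothesis AX : forall i j x, j != i -> A j x -> X i x.
(* Links have no cycle of length 2 ([AI]) or 4 ([A4]). *)
Hypothesis AI : forall i j x, i != j -> A i x -> A j x -> x = 1.
Hypothesis A4 : forall i j a a' b b', i != j ->
  A i a -> A i a' -> A j b -> A j b' -> a * b = b' * a' -> a = 1 \/ b = 1.
Hypothesis XI : forall i j x, i != j -> X i x -> X j x -> A (third i j) x.

(* Normal forms.  A chamber is a triple [(v, x, a)], where [v] is its base: if
   [a = 1] it contains [v], in position [x] in [X (tyv v)], and its other vertices
   are higher than [v]; if [a <> 1] it is a neighbour of [(v, x, 1)] across the
   edge opposite to [v], and [a] in [A (tyv v)] tells which one.  [ext u k y] is
   the other endpoint, of type [third (tyv u) k], of the edge fixed by [A k] in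
   the chamber [(u, y, 1)]; [flip u y a] is the vertex of the same type as [u] of
   the chamber [(u, y, a)] with [a <> 1]. *)
Inductive vert :=
  | vroot
  | ext of vert & ty & G
  | flip of vert & G & G.

Fixpoint tyv v :=
  match v with
  | vroot => T0
  | ext u k _ => third (tyv u) k
  | flip u _ _ => tyv u
  end.

Fixpoint lvl v :=
  match v with
  | vroot => 0
  | ext u _ _ => (lvl u).+1
  | flip u _ _ => (lvl u).+2
  end.

Definition isflip v := if v is flip _ _ _ then true else false.

(* [nonD v x] says that [v] is not the base of the chamber at position [x] around
   it. *)
Definition okp v k :=
  match v with
  | vroot => false
  | ext _ k0 _ => k == k0
  | flip u _ _ => k != tyv u
  end.

Definition nonD v x := exists k a b,
  [/\ okp v k, A k a, A (third (tyv v) k) b & x = a * b].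

Definition chamber := (vert * G * G)%type.

(** The choice is made from the coset of [A k] as a set, so it is the same for all its elements
    ([rep_eq]). *)
Definition rep k y : G := xget 1 [set z | exists2 a, A k a & z = y * a].

(** If a chamber of the panel is based lower than [u], the vertex sought is the apex of that
    chamber, which sits at position 1 around it; hence the position [b^-1]. The argument [chu] is
    always [ch u]: [ch] on [flip u y a] needs the tops of [u], and passing [ch u] keeps the
    recursion structural. *)
Definition top_of (chu : G -> chamber) u y k : vert * G :=
  if `[< exists b, A k b /\ nonD u (y * b) >] then
    let b := xget 1 [set b | A k b /\ nonD u (y * b)] in
    (flip (chu (y * b)).1.1 (chu (y * b)).1.2 (chu (y * b)).2, b^-1)
  else (ext u k (rep k y), (rep k y)^-1 * y).

(* [ch v x] is the chamber at position [x] around [v], and [loc w i] gives the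
   vertex of type [i] of [w] with the position of [w] around it. *)
Fixpoint ch v : G -> chamber :=
  match v with
  | vroot => fun x => (vroot, x, 1)
  | ext u k y => fun x =>
    if `[< nonD (ext u k y) x >] then
      let t := xget (1, 1)
        [set t : G * G | [/\ A k t.1, A (tyv u) t.2 & x = t.1 * t.2]] in
      (u, y * t.1, t.2)
    else (ext u k y, x, 1)
  | flip u y a => fun x =>
    if `[< nonD (flip u y a) x >] then
      if x == 1 then (u, y, a) else
      let t := xget (T0, 1, 1) [set t : ty * G * G |
        [/\ t.1.1 != tyv u, A t.1.1 t.1.2, t.1.2 <> 1,
            A (third (tyv u) t.1.1) t.2 & x = t.1.2 * t.2]] in
      let q := top_of (ch u) u y t.1.1 in
      (q.1, q.2 * a * t.1.2, t.2)
    else (flip u y a, x, 1)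
  end.

Definition top u := top_of (ch u) u.

Definition loc (w : chamber) i : vert * G :=
  let: (v, x, a) := w in
  if i == tyv v then if a == 1 then (v, x) else (flip v x a, 1)
  else ((top v x (third (tyv v) i)).1, (top v x (third (tyv v) i)).2 * a).

Fixpoint valid v : Prop :=
  match v with
  | vroot => True
  | ext u k y => [/\ valid u, k != tyv u, X (tyv u) y, rep k y = y &
      forall b, A k b -> ~ nonD u (y * b)]
  | flip u y a => [/\ valid u, X (tyv u) y, ~ nonD u y, A (tyv u) a & a <> 1]
  end.

Definition valid3 (w : chamber) :=
  [/\ valid w.1.1, X (tyv w.1.1) w.1.2, ~ nonD w.1.1 w.1.2 & A (tyv w.1.1) w.2].

Lemma okp_neq v k : valid v -> okp v k -> k != tyv v.
Proof.
case: v => //= u k0 y [_ + _ _ _] /eqP ->.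
by move=> /third_neq /andP[]; rewrite thirdC eq_sym.
Qed.

Lemma uniq_dec i j a b a' b' : i != j -> A i a -> A i a' -> A j b -> A j b' ->
  a * b = a' * b' -> a = a' /\ b = b'.
Proof.
move=> ij Aa Aa' Ab Ab' e.
have e' : a'^-1 * a = b' * b^-1.
  by apply: (mulIg b); apply: (mulgI a'); rewrite mulgVK -mulgA mulVKg.
have e1 : a'^-1 * a = 1.
  by apply: (AI ij); [apply: AM => //; apply: AV|rewrite e'; apply: AM => //; apply: AV].
split; first by apply: (mulgI a'^-1); rewrite e1 mulVg.
by apply: (mulIg b^-1); rewrite -e' e1 mulgV.
Qed.

Lemma rep_ex k y : exists2 a, A k a & rep k y = y * a.
Proof.
rewrite /rep; case: xgetP => [z -> //|/(_ y)[]].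
by exists 1; rewrite ?mulg1.
Qed.

Lemma rep_eq k y a : A k a -> rep k (y * a) = rep k y.
Proof.
move=> Aa; rewrite /rep; congr xget; apply/seteqP; split=> z /= [b Ab ->].
  by exists (a * b); [exact: AM|rewrite mulgA].
by exists (a^-1 * b); [apply: AM => //; exact: AV|rewrite mulgA mulgK].
Qed.

Lemma nonD_dec v k a b x : okp v k -> A k a -> A (third (tyv v) k) b ->
  x = a * b -> nonD v x.
Proof. by move=> *; exists k, a, b. Qed.

Lemma nonD_flipl u y a k b : k != tyv u -> A k b -> nonD (flip u y a) b.
Proof. by move=> ku Ab; apply: (@nonD_dec _ k b 1); rewrite ?mulg1. Qed.

(** Were [c] trivial, or [a] trivial at a flip, the factor [b] could be absorbed and [y] itself
    would decompose. *)
Lemma nonD_panel v k y b : valid v -> ~ nonD v y -> k != tyv v -> A k b ->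
  nonD v (y * b) -> okp v k /\ exists a c,
    [/\ A k a, A (third (tyv v) k) c, c <> 1, (isflip v -> a <> 1) & y * b = a * c].
Proof.
move=> vv Dy kv Ab [k' [a [c [ok' Aa Ac e]]]].
have ey : y = a * c * b^-1 by rewrite -e mulgK.
have k'v := okp_neq vv ok'.
have /or3P[/eqP E|/eqP E|/eqP E] : [|| k == tyv v, k == k' | k == third (tyv v) k'].
- by apply: third_cases; rewrite eq_sym.
- by rewrite E eqxx in kv.
- subst k'; split=> //; exists a, c; split=> //.
    by move=> c1; apply: Dy; apply: (@nonD_dec _ k (a * b^-1) 1) => //;
      [apply: AM => //; exact: AV|rewrite ey c1 !mulg1].
  case: v {k'v} vv Dy kv ok' Ac e => //= u y0 a0 vv Dy kv ok' Ac e _ a1.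
  apply: Dy; apply: (@nonD_dec _ (third (tyv u) k) c b^-1) => //=.
  + by case/andP: (third_neq kv); rewrite thirdC.
  + by rewrite thirdK; exact: AV.
  + by rewrite ey a1 mul1g.
- case: Dy; apply: (@nonD_dec _ k' a (c * b^-1)) => //.
  + by apply: AM => //; rewrite -E; exact: AV.
  + by rewrite ey mulgA.
Qed.

(** Two lower chambers in one panel would close a 4-cycle in the link of [v], against [A4]. This
    makes the choice of [b] in [top_of] forced. *)
Lemma nonD_panel_uniq v k y b b' : valid v -> ~ nonD v y -> k != tyv v ->
  A k b -> A k b' -> nonD v (y * b) -> nonD v (y * b') -> b = b'.
Proof.
move=> vv Dy kv Ab Ab' n n'.
have [_ [a [c [Aa Ac c1 _ e]]]] := nonD_panel vv Dy kv Ab n.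
have [_ [a' [c' [Aa' Ac' c1' _ e']]]] := nonD_panel vv Dy kv Ab' n'.
have kt : k != third (tyv v) k.
  by rewrite eq_sym; case/andP: (third_neq kv); rewrite thirdC.
have ea : y^-1 * (a * c) = b by rewrite -e mulKg.
have ea' : y^-1 * (a' * c') = b' by rewrite -e' mulKg.
have E : (a^-1 * a') * c' = c * (b^-1 * b').
  rewrite -[b']ea' -ea invgM invgM invgK; rewrite !mulgA.
  by rewrite mulgV mul1g mulgK.
have Aaa : A k (a^-1 * a') by apply: AM => //; exact: AV.
have Abb : A k (b^-1 * b') by apply: AM => //; exact: AV.
have [a1|//] := A4 kt Aaa Abb Ac' Ac E.
 have aa : a = a' by apply: (mulgI a^-1); rewrite mulVg a1.
have E2 : c^-1 * c' = b^-1 * b' by rewrite aa mulVg mul1g in E; rewrite E mulKg.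
have : b^-1 * b' = 1.
  by apply: (AI kt) => //; rewrite -E2; apply: AM => //; exact: AV.
by move=> E3; apply: (mulgI b^-1); rewrite E3 mulVg.
Qed.

Lemma top_ext u y k : (forall b, A k b -> ~ nonD u (y * b)) ->
  top u y k = (ext u k (rep k y), (rep k y)^-1 * y).
Proof.
by move=> H; rewrite /top /top_of; case: asboolP => // -[b [/H]].
Qed.

Lemma top_flip u y k b : valid u -> ~ nonD u y -> k != tyv u -> A k b ->
  nonD u (y * b) ->
  top u y k = (flip (ch u (y * b)).1.1 (ch u (y * b)).1.2 (ch u (y * b)).2, b^-1).
Proof.
move=> vu Dy ku Ab n; rewrite /top /top_of; case: asboolP => [|[]]; last by exists b.
case: xgetP => [b' -> [Ab' n'] _|/(_ b)[]//].
by rewrite (nonD_panel_uniq vu Dy ku Ab Ab' n n').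
Qed.

Lemma ch_D v x : ~ nonD v x -> ch v x = (v, x, 1).
Proof. by case: v => //= *; case: asboolP. Qed.

Lemma ch_ext u k y a b : valid (ext u k y) -> A k a -> A (tyv u) b ->
  ch (ext u k y) (a * b) = (u, y * a, b).
Proof.
move=> /= [_ ku _ _ _] Aa Ab; case: asboolP => [_|[]]; last first.
  by apply: (@nonD_dec _ k a b) => //=; rewrite thirdKl.
case: xgetP => [[a' b'] -> /= [Aa' Ab' e]|/(_ (a, b))[]//].
by have [<- <-] := uniq_dec ku Aa Aa' Ab Ab' e.
Qed.

Lemma ty_other i : exists k : ty, k != i.
Proof. by case: i; [exists T1|exists T0|exists T0]. Qed.

Lemma ch_flip1 u y a : ch (flip u y a) 1 = (u, y, a).
Proof.
rewrite /= eqxx; case: asboolP => // -[].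
by have [k kt] := ty_other (tyv u); apply: (nonD_flipl _ _ kt).
Qed.

(** The girth hypotheses make the decomposition [a * b], including the panel [k], unique once
    [a <> 1]. *)
Lemma ch_flip u y a0 k a b : k != tyv u -> A k a -> a <> 1 ->
  A (third (tyv u) k) b ->
  ch (flip u y a0) (a * b) = ((top u y k).1, (top u y k).2 * a0 * a, b).
Proof.
move=> ku Aa a1 Ab; rewrite /=; case: asboolP => [_|[]]; last first.
  by apply: (@nonD_dec _ k a b).
have /andP[tu tk] := third_neq ku; rewrite thirdC in tu tk.
case: eqP => [e|_].
  case: a1; have eab : a = b^-1 by apply: (mulIg b); rewrite e mulVg.
  by apply: (@AI k (third (tyv u) k)); rewrite 1?eq_sym // eab; exact: AV.
rewrite (@xget_unique _ _ _ (k, a, b)) // => -[[k' a'] b'] /= [ku' Aa' a1' Ab' e].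
have kk' : k' = k.
  have /or3P[/eqP E|/eqP E|/eqP E] : [|| k' == tyv u, k' == k | k' == third (tyv u) k].
  - by apply: third_cases; rewrite eq_sym.
  - by rewrite E eqxx in ku'.
  - by [].
  - subst k'; rewrite thirdK in Ab'.
    have e2 : a * b = a' * b' by [].
    have kt : k != third (tyv u) k by rewrite eq_sym.
    have [//|b1] := A4 kt Aa Ab' Ab Aa' e2.
    have [] : a' = 1 /\ b' = a; last by move=> /a1'.
    apply: (uniq_dec (i := third (tyv u) k) (j := k)) => //.
    by rewrite -e b1 mulg1 mul1g.
subst k'.
have [-> ->] // : a = a' /\ b = b'.
by apply: (uniq_dec (i := k) (j := third (tyv u) k)) => //; rewrite eq_sym.
Qed.

Arguments ch : simpl never.

Definition chU_prop v := forall k a c, okp v k -> A k a ->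
  A (third (tyv v) k) c -> c <> 1 -> (isflip v -> a <> 1) ->
  [/\ (ch v (a * c)).2 = c, tyv (ch v (a * c)).1.1 = third (tyv v) k &
      (lvl (ch v (a * c)).1.1).+1 = lvl v].

(** The property of [u] is a premise because the lemma serves in the induction that proves this
    property for the flips over [u]; [topT_of] and [ev_top_of] have the same form. *)
Lemma top_ty_of u y k : valid u -> chU_prop u -> ~ nonD u y -> k != tyv u ->
  tyv (top u y k).1 = third (tyv u) k /\ lvl (top u y k).1 = (lvl u).+1.
Proof.
move=> vu Uu Dy ku; case: (pselect (exists b, A k b /\ nonD u (y * b))).
  move=> [b [Ab n]]; rewrite (top_flip vu Dy ku Ab n) /=.
  have [ok [a [c [Aa Ac c1 fl e]]]] := nonD_panel vu Dy ku Ab n.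
  by rewrite e; have [_ -> ->] := Uu _ _ _ ok Aa Ac c1 fl.
by move=> H; rewrite top_ext //= => b Ab n; apply: H; exists b.
Qed.

Lemma chU v : valid v -> chU_prop v.
Proof.
elim: v => [|u IH k0 y|u IH y a0] vv k a c //= ok Aa Ac c1 fl.
  move/eqP: ok => ok; subst k0; rewrite thirdKl in Ac *.
  by rewrite ch_ext.
have [vu Xy Dy Aa0 a01] := vv; rewrite (ch_flip _ _ ok Aa (fl isT) Ac) /=.
by have [-> ->] := top_ty_of vu (IH vu) Dy ok.
Qed.

Lemma top_ty u y k : valid u -> ~ nonD u y -> k != tyv u ->
  tyv (top u y k).1 = third (tyv u) k.
Proof. by move=> vu Dy ku; case: (top_ty_of vu (chU vu) Dy ku). Qed.

Lemma top_lvl u y k : valid u -> ~ nonD u y -> k != tyv u ->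
  lvl (top u y k).1 = (lvl u).+1.
Proof. by move=> vu Dy ku; case: (top_ty_of vu (chU vu) Dy ku). Qed.

Definition ch_prop v := forall x, X (tyv v) x ->
  valid3 (ch v x) /\ loc (ch v x) (tyv v) = (v, x).

(** The last clause makes the complex grow upwards: after leaving the base [u] through [a0], a turn
    through [a] around the upper vertex reaches a chamber based at that upper vertex, since
    otherwise its link would contain a 4-cycle. *)
Lemma topT_of u y k : valid u -> ch_prop u -> X (tyv u) y -> ~ nonD u y ->
  k != tyv u ->
  [/\ valid (top u y k).1, A k (top u y k).2, okp (top u y k).1 k,
      forall a0, A (tyv u) a0 ->
        ch (top u y k).1 ((top u y k).2 * a0) = (u, y, a0) &
      forall a0 a, A (tyv u) a0 -> A k a -> a0 <> 1 -> a <> 1 ->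
        ~ nonD (top u y k).1 ((top u y k).2 * a0 * a)].
Proof.
move=> vu Pu Xy Dy ku; have ty_q := top_ty vu Dy ku.
have /andP[tu tk] := third_neq ku; rewrite thirdC in tu tk.
case: (pselect (exists b, A k b /\ nonD u (y * b))) => [[b [Ab n]]|H].
  have [ok [a [c [Aa Ac c1 fl e]]]] := nonD_panel vu Dy ku Ab n.
  have [e2 tyr _] := chU vu ok Aa Ac c1 fl.
  have Xyb : X (tyv u) (y * b) by apply: XM => //; apply: AX Ab.
  have [[/=]] := Pu _ Xyb.
  rewrite (top_flip vu Dy ku Ab n) /= in ty_q *.
  rewrite -e in e2 tyr.
  move: e2 tyr; case: (ch u (y * b)) => -[r z] c' /= -> tyr vr Xz Dz Ac'.
  rewrite tyr (eq_sym (tyv u)) (negbTE tk).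
  rewrite (thirdKr (tyv u) k) => -[eu ey].
  have b1 : b^-1 <> 1.
    move=> b1; apply: Dy; move: n; rewrite -[b]invgK b1 invg1 mulg1 //.
  rewrite tyr in Xz Ac'; split => /=; [by split; rewrite ?tyr|exact: AV|by rewrite ?tyr eq_sym| |].
  - move=> a0 Aa0; rewrite (@ch_flip _ _ _ k) //; last 3 first.
    + by rewrite tyr eq_sym.
    + exact: AV.
    + by rewrite tyr thirdKl.
    by rewrite eu ey mulgK.
  - move=> a0 a' Aa0 Aa' a01 a1' [k' [x1 [x2 [/= ok' Ax1 Ax2 ex]]]].
    rewrite tyr in ok' Ax2.
    have : k' = k \/ k' = tyv u.
      move: ok' ku; clear; case: (tyv u); case: k; case: k' => //=; by auto.
    case=> ek; subst k'.
      rewrite thirdKl in Ax2.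
      have Ab1 : A k (b * x1) by apply: AM.
      have E : a0 * a' = (b * x1) * x2 by rewrite -mulgA -ex !mulgA mulgV mul1g.
      by case: (A4 _ Aa0 Ax2 Aa' Ab1 E); rewrite 1?eq_sym.
    rewrite thirdKr in Ax2.
    have Ab1 : A k (x2 * a'^-1) by apply: AM => //; exact: AV.
    have E : b^-1 * a0 = x1 * (x2 * a'^-1) by rewrite mulgA -ex mulgK.
    by case: (A4 ku (AV Ab) Ab1 Aa0 Ax1 E).
have H' b : A k b -> ~ nonD u (y * b) by move=> Ab n; apply: H; exists b.
rewrite (top_ext H') /= in ty_q *.
have [b Ab eb] := rep_ex k y.
have Apos : A k ((rep k y)^-1 * y).
  by rewrite eb invgM mulgVK; exact: AV.
have vq : valid (ext u k (rep k y)).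
  split=> //.
  - by rewrite eb; apply: XM => //; exact: AX Ab.
  - by rewrite {1}eb rep_eq.
  - by move=> b' Ab'; rewrite eb -mulgA; apply: H'; exact: AM.
split=> //=.
- by move=> a0 Aa0; rewrite ch_ext // mulVKg.
- move=> a0 a' Aa0 Aa' a01 a1' [k' [x1 [x2 [/= /eqP ok' Ax1 Ax2 ex]]]].
  subst k'; rewrite thirdKl in Ax2.
  set pos := _ * y in Apos ex.
  have Ab1 : A k (pos^-1 * x1) by apply: AM => //; exact: AV.
  have E : a0 * a' = (pos^-1 * x1) * x2 by rewrite -mulgA -ex -mulgA mulKg.
  by case: (A4 _ Aa0 Ax2 Aa' Ab1 E); rewrite 1?eq_sym.
Qed.

(** With [locP], this says that [ch] and [loc] are mutually inverse. For a flip, position 1 is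
    treated apart, and the two factors of the position exchange roles when the first one is
    trivial. *)
Lemma ch_props v : valid v -> ch_prop v.
Proof.
elim: v => [|u IH k y|u IH y a0] vv x Xx.
- have D0 : ~ nonD vroot x by move=> [k [a [b []]]].
  by rewrite (ch_D D0); split; [split|rewrite /= eqxx].
- have [vu ku Xy ry Dy] := vv.
  have /andP[tu tk] := third_neq ku; rewrite thirdC in tu tk.
  case: (pselect (nonD (ext u k y) x)) => [[k' [a [b [/= /eqP E Aa Ab ex]]]]|Dx].
    subst k' x; rewrite thirdKl in Ab.
    rewrite ch_ext //; split.
      by split=> //=; [apply: XM => //; exact: AX Aa|exact: Dy].
    rewrite /= (negbTE tk) thirdK top_ext ?rep_eq ?ry ?mulgA ?mulVg ?mul1g //.
    by move=> b' Ab'; rewrite -mulgA; apply: Dy; exact: AM.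
  by rewrite (ch_D Dx); split; [split|rewrite /= eqxx eqxx].
- have [vu Xy Dy Aa0 a01] := vv.
  case: (pselect (nonD (flip u y a0) x)) => [n|Dx]; last first.
    by rewrite (ch_D Dx); split; [split|rewrite /= eqxx eqxx].
  have [->|[k [a [b [ku Aa a1 Ab ->]]]]] : x = 1 \/ exists k a b,
    [/\ k != tyv u, A k a, a <> 1, A (third (tyv u) k) b & x = a * b].
    have [k [a [b [/= ok Aa Ab ex]]]] := n.
    have /andP[tk tu] := third_neq ok.
    case: (eqVneq a 1) => [a1|/eqP a1]; last by right; exists k, a, b.
    case: (eqVneq b 1) => [b1|/eqP b1]; first by left; rewrite ex a1 b1 mulg1.
    right; exists (third (tyv u) k), b, 1; split=> //.
    + by rewrite thirdC.
    + by rewrite ex a1 mulg1 mul1g.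
    rewrite ch_flip1; split; first by split.
    by rewrite /= eqxx; case: eqP => // /a01.
  have /andP[tu tk] := third_neq ku; rewrite thirdC in tu tk.
  rewrite (ch_flip _ _ ku Aa a1 Ab); have tq := top_ty vu Dy ku.
  have [vq Apos okq chq Dq] := topT_of vu (IH vu) Xy Dy ku.
  split.
    split=> //=; rewrite ?tq //; last exact: Dq.
    apply: XM; first apply: XM.
    + by apply: AX Apos; rewrite eq_sym.
    + by apply: AX Aa0; rewrite eq_sym.
    + by apply: AX Aa; rewrite eq_sym.
  have n2 : nonD (top u y k).1 ((top u y k).2 * a0 * a * a^-1).
    by rewrite mulgK; apply: (nonD_dec okq Apos (b := a0)); rewrite // tq thirdKl.
  rewrite /= tq (eq_sym (tyv u)) (negbTE tk) thirdKr.
  rewrite (top_flip vq _ _ (AV Aa) n2) ?mulgK ?invgK ?chq //=; first exact: Dq.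
  by rewrite tq eq_sym.
Qed.

Lemma chP v x : valid v -> X (tyv v) x -> valid3 (ch v x).
Proof. by move=> vv /(ch_props vv)[]. Qed.

Lemma loc_ch v x : valid v -> X (tyv v) x -> loc (ch v x) (tyv v) = (v, x).
Proof. by move=> vv /(ch_props vv)[]. Qed.

Lemma topT u y k : valid u -> X (tyv u) y -> ~ nonD u y -> k != tyv u ->
  [/\ valid (top u y k).1, A k (top u y k).2, okp (top u y k).1 k,
      forall a0, A (tyv u) a0 ->
        ch (top u y k).1 ((top u y k).2 * a0) = (u, y, a0) &
      forall a0 a, A (tyv u) a0 -> A k a -> a0 <> 1 -> a <> 1 ->
        ~ nonD (top u y k).1 ((top u y k).2 * a0 * a)].
Proof. by move=> vu; apply: topT_of => //; exact: ch_props. Qed.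

Lemma third_neqr i j : i != j -> third i j != i.
Proof. by case/third_neq/andP. Qed.

Lemma locP w i : valid3 w -> [/\ valid (loc w i).1, tyv (loc w i).1 = i,
  X i (loc w i).2 & ch (loc w i).1 (loc w i).2 = w].
Proof.
case: w => -[v x] a [/= vv Xx Dx Aa].
case: (eqVneq i (tyv v)) => [->|iv].
  case: eqP => [->|a1] /=; first by rewrite ch_D.
  by rewrite ch_flip1; split.
have ki : third (tyv v) i != tyv v by apply: third_neqr; rewrite eq_sym.
have [vq Aq _ cq _] := topT vv Xx Dx ki.
have tq := top_ty vv Dx ki; rewrite thirdK in tq.
split=> //=; last exact: cq.
apply: XM; first by apply: AX Aq; rewrite thirdC; apply: third_neqr.
by apply: AX Aa; rewrite eq_sym.
Qed.

(** * The action of the vertex groups on chambers *)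

Definition act i w x := ch (loc w i).1 ((loc w i).2 * x).

Lemma actP i w x : valid3 w -> X i x ->
  valid3 (act i w x) /\ loc (act i w x) i = ((loc w i).1, (loc w i).2 * x).
Proof.
move=> vw Xx; have [vq tq Xq _] := locP i vw.
have Xqx : X (tyv (loc w i).1) ((loc w i).2 * x) by rewrite tq; exact: XM.
split; first exact: chP.
by have := loc_ch vq Xqx; rewrite tq.
Qed.

Lemma act1 i w : valid3 w -> act i w 1 = w.
Proof. by move=> /(locP i)[_ _ _]; rewrite /act mulg1. Qed.

Lemma actM i w x y : valid3 w -> X i x -> X i y ->
  act i (act i w x) y = act i w (x * y).
Proof.
by move=> vw Xx Xy; rewrite {1}/act; have [_ ->] := actP vw Xx; rewrite -mulgA.
Qed.

Lemma act_top i v x c a : valid3 (v, x, c) -> i != tyv v -> A (tyv v) a ->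
  act i (v, x, c) a = (v, x, c * a).
Proof.
move=> [/= vv Xx Dx Ac] iv Aa; rewrite /act /= (negbTE iv) /=.
have ki : third (tyv v) i != tyv v by apply: third_neqr; rewrite eq_sym.
have [_ _ _ cq _] := topT vv Xx Dx ki.
by rewrite -mulgA cq //; exact: AM.
Qed.

(** The panel is seen both from [v] and from its upper vertex, and a turn inside it must give the
    same chamber from both. The cases are whether the given chamber is based at [v], and which
    chamber of the panel, if any, is based lower. *)
Lemma act_side k v x c a : valid3 (v, x, c) -> k != tyv v -> A k a ->
  act (third (tyv v) k) (v, x, c) a = act (tyv v) (v, x, c) a.
Proof.
move=> [/= vv Xx Dx Ac] kv Aa; rewrite /act /=.
have tv : third (tyv v) k != tyv v by apply: third_neqr; rewrite eq_sym.
rewrite eqxx (negbTE tv) thirdK /=.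
have [vq Aq okq cq Dq] := topT vv Xx Dx kv; have tq := top_ty vv Dx kv.
case: (eqVneq a 1) => [->|/eqP a1].
  rewrite mulg1 cq //; case: eqP => [->|c1] /=; rewrite mulg1 ?ch_flip1 //.
  by rewrite ch_D.
case: eqP => [->|c1] /=; last first.
  rewrite mul1g -[X in ch (flip _ _ _) X]mulg1 (ch_flip _ _ kv Aa a1) //.
  by rewrite ch_D //; exact: Dq.
rewrite mulg1; case: (pselect (exists b, A k b /\ nonD v (x * b))) => [[b [Ab n]]|H].
  have e := top_flip vv Dx kv Ab n.
  rewrite e /= in cq vq okq *.
  case: (eqVneq b a) => [->|ba].
    by rewrite mulVg ch_flip1; case: (ch v _) => -[].
  have na : ~ nonD v (x * a).
    by move=> na; case/eqP: ba; apply: (nonD_panel_uniq vv Dx kv Ab Aa n na).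
  have Xxa : X (tyv v) (x * a) by apply: XM => //; apply: AX Aa.
  have [_ _ _ cqa _] := topT vv Xxa na kv.
  have Ab' : A k (a^-1 * b) by apply: AM => //; exact: AV.
  have eb : x * a * (a^-1 * b) = x * b by rewrite mulgA mulgK.
  rewrite (top_flip vv na kv Ab') ?eb //= in cqa.
  by have := cqa 1 (A1 _); rewrite mulg1 invgM invgK (ch_D na).
have H' b : A k b -> ~ nonD v (x * b) by move=> Ab n; apply: H; exists b.
have na : ~ nonD v (x * a) by exact: H'.
have Xxa : X (tyv v) (x * a) by apply: XM => //; apply: AX Aa.
have [_ _ _ cqa _] := topT vv Xxa na kv.
have := cqa 1 (A1 _); rewrite mulg1 !top_ext //=.
  by rewrite rep_eq // mulgA (ch_D na).
by move=> b Ab; rewrite -mulgA; apply: H'; exact: AM.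
Qed.

(** Each relation of a triangle group involves at most two generators, hence takes place in one
    vertex group; agreement on the common edge groups is therefore what glues the three actions into
    one. *)
Lemma act_compat i j w a : valid3 w -> i != j -> A (third i j) a ->
  act i w a = act j w a.
Proof.
case: w => -[v x] c vw ij Aa.
case: (eqVneq (third i j) (tyv v)) => [e|kv].
  have /andP[ti tj] := third_neq ij.
  by rewrite e in Aa ti tj; rewrite !act_top // eq_sym.
have /or3P[/eqP E|/eqP E|/eqP E] := third_cases (tyv v) ij.
- by rewrite -E in Aa kv *; have := act_side vw kv Aa; rewrite thirdK.
- rewrite -E thirdC in Aa kv *.
  by have := act_side vw kv Aa; rewrite thirdK => ->.
- by rewrite E eqxx in kv.
Qed.

(** [fr v * x] is the group element of the chamber at position [x] around [v], whichever vertex of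
    the chamber is used ([ev_ch], [ev_loc]). *)
Fixpoint fr v : G :=
  match v with
  | vroot => 1
  | ext u _ y => fr u * y
  | flip u y a => fr u * y * a
  end.

Definition ev (w : chamber) := fr w.1.1 * w.1.2 * w.2.

Lemma ev_top_of u y k : valid u -> (forall x, X (tyv u) x -> ev (ch u x) = fr u * x) ->
  X (tyv u) y -> ~ nonD u y -> k != tyv u ->
  fr (top u y k).1 * (top u y k).2 = fr u * y.
Proof.
move=> vu IH Xy Dy ku; case: (pselect (exists b, A k b /\ nonD u (y * b))).
  move=> [b [Ab n]]; rewrite (top_flip vu Dy ku Ab n) /=.
  have Xyb : X (tyv u) (y * b) by apply: XM => //; exact: AX Ab.
  by have := IH _ Xyb; rewrite /ev => ->; rewrite mulgA mulgK.
move=> H; rewrite top_ext /=; first by rewrite mulgA mulgK.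
by move=> b Ab n; apply: H; exists b.
Qed.

Lemma ev_ch v x : valid v -> X (tyv v) x -> ev (ch v x) = fr v * x.
Proof.
elim: v x => [|u IH k y|u IH y a0] x vv Xx.
- by rewrite /ev /= mulg1.
- case: (pselect (nonD (ext u k y) x)) => [[k' [a [b [/= /eqP E Aa Ab ->]]]]|Dx].
    subst k'; rewrite thirdKl in Ab.
    by rewrite ch_ext // /ev /= !mulgA.
  by rewrite ch_D // /ev /= mulg1.
- have [vu Xy Dy Aa0 a01] := vv.
  case: (pselect (nonD (flip u y a0) x)) => [n|Dx]; last first.
    by rewrite (ch_D Dx) /ev /= mulg1.
  have key k a b : k != tyv u -> A k a -> a <> 1 -> A (third (tyv u) k) b ->
      ev (ch (flip u y a0) (a * b)) = fr (flip u y a0) * (a * b).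
    move=> ku Aa a1 Ab; rewrite (ch_flip _ _ ku Aa a1 Ab) /ev /= !mulgA.
    by rewrite (ev_top_of vu) // => z Xz; exact: IH.
  have [k [a [b [/= ok Aa Ab ex]]]] := n.
  have /andP[tk tu] := third_neq ok.
  case: (eqVneq a 1) => [a1|/eqP a1]; last by rewrite ex; exact: (key k).
  case: (eqVneq b 1) => [b1|/eqP b1].
    by rewrite ex a1 b1 mulg1 ch_flip1 /ev /= mulg1.
  rewrite ex a1 mul1g -[b]mulg1; apply: (key (third (tyv u) k)) => //.
  by rewrite thirdC.
Qed.

Lemma ev_loc w i : valid3 w -> ev w = fr (loc w i).1 * (loc w i).2.
Proof. by move=> /(locP i)[vq tq Xq {1}<-]; rewrite ev_ch // tq. Qed.

Lemma ev_act i w x : valid3 w -> X i x -> ev (act i w x) = ev w * x.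
Proof.
move=> vw Xx; have [va la] := actP vw Xx.
by rewrite (ev_loc i va) la (ev_loc i vw) mulgA.
Qed.

(** * Incidence and levels *)

Definition inc v w := (loc w (tyv v)).1 = v.

Lemma inc_valid v w : valid3 w -> inc v w -> valid v.
Proof. by move=> /(locP (tyv v))[+ _ _ _] e; rewrite e. Qed.

Lemma inc_loc i w : valid3 w -> inc (loc w i).1 w.
Proof. by rewrite /inc => /(locP i)[_ -> _ _]. Qed.

Lemma inc_eq w v v' : inc v w -> inc v' w -> tyv v = tyv v' -> v = v'.
Proof. by move=> e e' t; rewrite /inc t in e; rewrite -e' -e. Qed.

Lemma valid3_base v x a : valid3 (v, x, a) -> valid3 (v, x, 1).
Proof. by move=> [? ? ? ?]; split. Qed.

(* The three vertices need not be distinct. *)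
Definition tri u v w := exists2 c, valid3 c & [/\ inc u c, inc v c & inc w c].

Definition adj v w := tyv v != tyv w /\ exists2 c, valid3 c & inc v c /\ inc w c.

Lemma adj_sym v w : adj v w -> adj w v.
Proof. by move=> [tvw [c vc [ic jc]]]; split; [rewrite eq_sym|exists c]. Qed.

Lemma tri_adj u v w : tri u v w -> tyv u != tyv v -> adj u v.
Proof. by move=> [c vc [? ? ?]] ?; split=> //; exists c. Qed.

Lemma inc_cases v u x a : valid3 (u, x, a) -> inc v (u, x, a) ->
  [\/ v = u /\ a = 1, v = flip u x a /\ a <> 1 |
      exists k, [/\ k != tyv u, tyv v = third (tyv u) k & v = (top u x k).1]].
Proof.
move=> vc; rewrite /inc /=; case: eqVneq => [_|tv].
  by case: eqP => a1 /= e; [constructor 1|constructor 2]; rewrite e.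
move=> e; constructor 3; exists (third (tyv u) (tyv v)); split=> //.
- by apply: third_neqr; rewrite eq_sym.
- by rewrite thirdK.
Qed.

Lemma inc_base u x : inc u (u, x, 1).
Proof. by rewrite /inc /= eqxx eqxx. Qed.

Lemma inc_apex u x a : a <> 1 -> inc (flip u x a) (u, x, a).
Proof. by move=> a1; rewrite /inc /= eqxx; case: eqP. Qed.

Lemma inc_top u x a k : valid3 (u, x, a) -> k != tyv u ->
  inc (top u x k).1 (u, x, a).
Proof.
move=> [/= vu Xx Dx _] ku; rewrite /inc /= top_ty //.
by rewrite (negbTE (third_neqr _)) 1?eq_sym // thirdK.
Qed.

(** In a chamber [(u, x, a)] the two upper vertices have level [lvl u + 1] and the third one [lvl u]
    or [lvl u + 2]. Equal levels thus single out the two upper vertices, and [u] lies below both. *)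
Lemma same_level_base v w : adj v w -> lvl v = lvl w -> exists u,
  [/\ tri u v w, (lvl u).+1 = lvl v, tyv u != tyv v & tyv u != tyv w].
Proof.
move=> [tvw [[[u x] a] vc [iv iw]]] lvw; have [/= vu Xx Dx Aa] := vc.
have [[ev ea]|[ev a1]|[k [ku tv ev]]] := inc_cases vc iv;
have [[ew ea']|[ew a1']|[l [lu tw ew]]] := inc_cases vc iw;
  try (by move: tvw; rewrite ev ew eqxx); try (by case: a1); try (by case: a1').
- by move: lvw; rewrite ev ew top_lvl //; lia.
- by move: lvw; rewrite ev ew top_lvl //=; lia.
- by move: lvw; rewrite ev ew top_lvl //; lia.
- by move: lvw; rewrite ev ew top_lvl //=; lia.
have vc1 := valid3_base vc.
exists u; split.
- exists (u, x, 1) => //; split; first exact: inc_base.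
  + by rewrite ev; exact: inc_top.
  + by rewrite ew; exact: inc_top.
- by rewrite ev top_lvl.
- by rewrite tv eq_sym; apply: third_neqr; rewrite eq_sym.
- by rewrite tw eq_sym; apply: third_neqr; rewrite eq_sym.
Qed.

Definition below u v := adj u v /\ (lvl u).+1 = lvl v.

Lemma below_cases u v : below u v -> exists w x a, valid3 (w, x, a) /\
  exists2 k, k != tyv w &
  u = w /\ v = (top w x k).1 \/ [/\ a <> 1, v = flip w x a & u = (top w x k).1].
Proof.
move=> [[tuv [[[w x] a] vc [iu iv]]] l]; have [/= vw Xx Dx Aa] := vc.
exists w, x, a; split=> //.
have [[eu ea]|[eu a1]|[k [kw tu eu]]] := inc_cases vc iu;
have [[ev ea']|[ev a1']|[m [mw tv ev]]] := inc_cases vc iv;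
  try (by move: tuv; rewrite eu ev eqxx); try (by case: a1); try (by case: a1').
- by exists m => //; left.
- by move: l; rewrite eu ev top_lvl //=; lia.
- by move: l; rewrite eu ev top_lvl //=; lia.
- by exists k => //; right.
- by move: l; rewrite eu ev !top_lvl //=; lia.
Qed.

Lemma below_ext u v k y : below u (ext v k y) -> u = v.
Proof.
move=> /below_cases[w [x [a [[/= vw Xx Dx Aa] [m mw [[-> e]|[_ //]]]]]]].
case: (pselect (exists b, A m b /\ nonD w (x * b))) => [[b [Ab n]]|H].
  by move: e; rewrite (top_flip vw Dx mw Ab n).
by move: e; rewrite top_ext => [[->]|b Ab n] //; apply: H; exists b.
Qed.

Lemma below_flip u v y a : below u (flip v y a) ->
  valid3 (v, y, a) /\ exists2 k, k != tyv v & u = (top v y k).1.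
Proof.
move=> /below_cases[w [x [c [[/= vw Xx Dx Aa] [m mw [[-> e]|[c1 [-> -> ->]]]]]]]];
  last by move=> ?; split=> //; exists m.
have [b [Ab n]] : exists b, A m b /\ nonD w (x * b).
  apply: contrapT => H; move: e; rewrite top_ext // => b Ab n.
  by apply: H; exists b.
move: e; rewrite (top_flip vw Dx mw Ab n) /=.
have Xxb : X (tyv w) (x * b) by apply: XM => //; exact: AX Ab.
have [va la] := ch_props vw Xxb.
have [ok [a' [c' [Aa' Ac' c1' fl e']]]] := nonD_panel vw Dx mw Ab n.
have [_ tyr _] := chU vw ok Aa' Ac' c1' fl; rewrite -e' in tyr.
move: va la tyr; case: (ch w (x * b)) => -[r z] d /= va + tyr [-> -> ->].
rewrite tyr eq_sym (negbTE (third_neqr _)) 1?eq_sym // thirdKr => -[ew _].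
split=> //; exists m; last by rewrite ew.
by case: (tyv w) (m) mw => -[].
Qed.

(** An [ext] has only its base below it, a [flip] only the two upper vertices of its chamber. *)
Lemma below_simplex u u' v : below u v -> below u' v ->
  u = u' \/ tyv u != tyv u' /\ tri u u' v.
Proof.
case: v => [[_ //]|v k y|v y a] bu bu'.
  by left; rewrite (below_ext bu) (below_ext bu').
have [vc [k kv eu]] := below_flip bu; have [_ [m mv eu']] := below_flip bu'.
have [/= vv Xy Dy Aa] := vc.
have [e|km] := eqVneq k m; [by left; rewrite eu eu' e|right].
have a1 : a <> 1 by case: bu => -[_ [c vc' [_ /(inc_valid vc')[]]]].
split; first by rewrite eu eu' !top_ty //; apply: contraNneq km; move: kv mv;
  clear; case: (tyv v); case: k; case: m.
exists (v, y, a) => //; split.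
- by rewrite eu; exact: inc_top.
- by rewrite eu'; exact: inc_top.
- exact: inc_apex.
Qed.

Lemma has_below v : valid v -> 0 < lvl v -> exists u, below u v.
Proof.
case: v => [//|u k y|u y a] vv _.
  have [vu ku Xy ry Dy] := vv.
  have Dy' : ~ nonD u y by rewrite -[y]mulg1; exact: Dy.
  have vc : valid3 (u, y, 1) by split.
  exists u; split=> //; split; first by rewrite /= eq_sym; apply: third_neqr; rewrite eq_sym.
  exists (u, y, 1) => //; split; first exact: inc_base.
  by have := inc_top vc ku; rewrite top_ext //= ry.
have [vu Xy Dy Aa a1] := vv; have vc : valid3 (u, y, a) by split.
have [k ku] := ty_other (tyv u).
exists (top u y k).1; split; last by rewrite top_lvl.
split; first by rewrite top_ty //=; apply: third_neqr; rewrite eq_sym.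
by exists (u, y, a) => //; split; [exact: inc_top|exact: inc_apex].
Qed.

(** The element [(ev w)^-1 * ev w'] can be computed around either shared vertex, so it lies in both
    vertex groups, and [XI] applies. *)
Lemma share2 i j w w' : valid3 w -> valid3 w' -> i != j ->
  (loc w i).1 = (loc w' i).1 -> (loc w j).1 = (loc w' j).1 ->
  exists2 a, A (third i j) a & w' = act i w a.
Proof.
move=> vw vw' ij ei ej.
have [vi ti Xi ci] := locP i vw; have [vi' ti' Xi' ci'] := locP i vw'.
have [vj tj Xj cj] := locP j vw; have [vj' tj' Xj' cj'] := locP j vw'.
exists ((loc w i).2^-1 * (loc w' i).2); last by rewrite /act mulVKg ei ci'.
apply: XI => //; first by apply: XM => //; exact: XV.
suff -> : (loc w i).2^-1 * (loc w' i).2 = (loc w j).2^-1 * (loc w' j).2.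
  by apply: XM => //; exact: XV.
have : (ev w)^-1 * ev w' = (ev w)^-1 * ev w' by [].
rewrite {1}(ev_loc i vw) {1}(ev_loc i vw') (ev_loc j vw) (ev_loc j vw') ei ej.
by rewrite !invgM -!mulgA !mulKg.
Qed.

Variable s : ty.
(* The links of vertices of the special type [s] have no 6-cycle. *)
Hypothesis A6 : forall i j a1 a2 a3 b1 b2 b3, i != s -> j != s -> i != j ->
  [/\ A i a1, A i a2 & A i a3] -> [/\ A j b1, A j b2 & A j b3] ->
  [/\ a1 <> 1, a2 <> 1 & a3 <> 1] -> [/\ b1 <> 1, b2 <> 1 & b3 <> 1] ->
  a1 * b1 * a2 * b2 * a3 * b3 <> 1.

Definition step i j w w' := [/\ valid3 w, valid3 w', w <> w',
  (loc w i).1 = (loc w' i).1 & (loc w j).1 = (loc w' j).1].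

Lemma step_act i j w w' : i != j -> step i j w w' ->
  exists a, [/\ A (third i j) a, a <> 1 & w' = act i w a].
Proof.
move=> ij [vw vw' ww' ei ej]; have [a Aa e] := share2 vw vw' ij ei ej.
by exists a; split=> // a1; apply: ww'; rewrite e a1 act1.
Qed.

(** Turning around a vertex of type [s] multiplies by six nontrivial elements, alternately from two
    edge groups; [ev] turns the return to [w1] into a relation excluded by [A6]. *)
Lemma no_hexagon i j w1 w2 w3 w4 w5 w6 : i != s -> j != s -> i != j ->
  step s i w1 w2 -> step s j w2 w3 -> step s i w3 w4 ->
  step s j w4 w5 -> step s i w5 w6 -> step s j w6 w1 -> False.
Proof.
move=> is_ js ij.
have ti : third s i = j by move: is_ js ij; clear; case: s; case: i; case: j.
have tj : third s j = i by rewrite -ti thirdK.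
have si : s != i by rewrite eq_sym.
have sj : s != j by rewrite eq_sym.
move=> s1 /(step_act sj)[b1]; rewrite tj => -[Ab1 nb1 e2].
move=> /(step_act si)[a2]; rewrite ti => -[Aa2 na2 e3].
move=> /(step_act sj)[b2]; rewrite tj => -[Ab2 nb2 e4].
move=> /(step_act si)[a3]; rewrite ti => -[Aa3 na3 e5].
move=> /(step_act sj)[b3]; rewrite tj => -[Ab3 nb3 e6].
have [vw1 _ _ _ _] := s1.
have [a1] := step_act si s1; rewrite ti => -[Aa1 na1 e1].
have Xj a : A j a -> X s a by exact: AX.
have Xi a : A i a -> X s a by exact: AX.
have acts x y : X s x -> X s y -> act s (act s w1 x) y = act s w1 (x * y).
  by move=> *; rewrite actM.
move: e6; rewrite e5 e4 e3 e2 e1 !acts; try by auto 7.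
move=> /(congr1 ev); rewrite ev_act //; last by auto 7.
move=> /(congr1 (fun g => (ev w1)^-1 * g)); rewrite mulVg mulKg => /esym.
have ji : j != i by rewrite eq_sym.
by apply: (A6 js is_ ji); split.
Qed.

(* Together with the lower neighbours of the edges [u0 u1] and [u1 u2], the
   vertices would form a hexagon in the link of [u1]. *)
Lemma special_turn v0 v1 v2 v3 u0 u1 u2 :
  lvl v0 = lvl v1 -> lvl v1 = lvl v2 -> lvl v2 = lvl v3 ->
  tri u0 v0 v1 -> tri u1 v1 v2 -> tri u2 v2 v3 ->
  (lvl u0).+1 = lvl v0 -> (lvl u1).+1 = lvl v1 -> (lvl u2).+1 = lvl v2 ->
  tyv u0 != tyv v1 -> tyv u1 != tyv v1 -> tyv u1 != tyv v2 -> tyv u2 != tyv v2 ->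
  tyv v1 != tyv v2 ->
  u0 <> u1 -> u1 <> u2 -> tyv u1 = s -> False.
Proof.
move=> l01 l12 l23 [w0 vw0 [i00 i01 i02]] [w1 vw1 [i10 i11 i12]].
move=> [w2 vw2 [i20 i21 i22]] k0 k1 k2 t01 t11 t12 t22 tv d01 d12 ts.
have b01 : below u0 v1 by split; [split=> //; exists w0|rewrite -l01].
have b11 : below u1 v1 by split=> //; split=> //; exists w1.
have b12 : below u1 v2 by split; [split=> //; exists w1|rewrite -l12].
have b22 : below u2 v2 by split=> //; split=> //; exists w2.
have [//|[t_a [wa vwa [a0 a1 a2]]]] := below_simplex b01 b11.
have [//|[t_b [wb vwb [c0 c1 c2]]]] := below_simplex b12 b22.
have adj01 : adj u0 u1 by split=> //; exists wa.
have adj12 : adj u1 u2 by split=> //; exists wb.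
have [|x0 [[wc vwc [d0 d1 d2]] lx0 tx0 tx0']] := same_level_base adj01.
  by apply: succn_inj; rewrite k0 k1.
have [|x1 [[wd vwd [e0 e1 e2]] lx1 tx1 tx1']] := same_level_base adj12.
  by apply: succn_inj; rewrite k1 k2.
have bx0 : below x0 u1.
  by split; [split=> //; exists wc|apply: succn_inj; rewrite lx0 k0 k1].
have bx1 : below x1 u1 by split=> //; split=> //; exists wd.
have ij : tyv v1 != tyv v2 by [].
have is_ : tyv v1 != s by rewrite -ts eq_sym.
have js : tyv v2 != s by rewrite -ts eq_sym.
have tu0 : tyv u0 = tyv v2.
  by move: t01 t_a ij is_ js; rewrite ts; clear;
    case: s; case: (tyv u0); case: (tyv v1); case: (tyv v2).
have tu2 : tyv u2 = tyv v1.
  by move: t22 t_b ij is_ js; rewrite ts; clear;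
    case: s; case: (tyv u2); case: (tyv v1); case: (tyv v2).
have tx0e : tyv x0 = tyv v1.
  by move: tx0 tx0' ij is_ js; rewrite ts tu0; clear;
    case: s; case: (tyv x0); case: (tyv v1); case: (tyv v2).
have tx1e : tyv x1 = tyv v2.
  by move: tx1 tx1' ij is_ js; rewrite ts tu2; clear;
    case: s; case: (tyv x1); case: (tyv v1); case: (tyv v2).
(* [x0] and [x1] have different types, so they are not equal. *)
have [e|[_ [we vwe [f0 f1 f2]]]] := below_simplex bx0 bx1.
  by move: ij; rewrite -tx0e -tx1e e eqxx.
have st k w w' p q q' r : valid3 w -> valid3 w' -> inc u1 w -> inc u1 w' ->
    inc p w -> inc p w' -> tyv p = k -> inc q w -> inc q' w' -> tyv q = tyv q' ->
    lvl q != lvl q' -> r = s -> step r k w w'.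
  move=> vw vw' iu iu' ip ip' tp iq iq' tq lq ->; split=> //.
  - by move=> e; case/eqP: lq; congr lvl; apply: (inc_eq iq) => //; rewrite e.
  - by rewrite -ts iu iu'.
  - by rewrite -tp ip ip'.
have lts : [/\ [&& lvl u0 != lvl v2, lvl v1 != lvl u2 & lvl v2 != lvl x1],
    lvl u2 != lvl x0, lvl x1 != lvl u0 & lvl x0 != lvl v1].
  by move: l01 l12 l23 k0 k1 k2 lx0 lx1; clear; move=> *; split; lia.
have [/and3P[n1 n2 n3] n4 n5 n6] := lts.
(* The hexagon in the link of [u1] is [u0], [v1], [v2], [u2], [x1], [x0]. Consecutive chambers share
   one of these vertices and differ because their remaining vertices have different levels. *)
apply: (@no_hexagon (tyv v1) (tyv v2) wa w1 wb wd we wc) => //.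
- by apply: (st _ _ _ v1 u0 v2).
- by apply: (st _ _ _ v2 v1 u2).
- by apply: (st _ _ _ u2 v2 x1); rewrite // tx1e.
- by apply: (st _ _ _ x1 u2 x0); rewrite // tx0e.
- by apply: (st _ _ _ x0 x1 u0); rewrite // tx1e.
- by apply: (st _ _ _ u0 x0 v1).
Qed.

(** * Walks inside a level and their descent *)

Definition sadj v w := adj v w /\ lvl v = lvl w.

(** As [walk0] holds for every [k], the index only bounds the length. *)
Inductive walk : nat -> vert -> vert -> Prop :=
  | walk0 k v : walk k v v
  | walkS k v w x : sadj v w -> walk k w x -> walk k.+1 v x.

Lemma sadj_sym v w : sadj v w -> sadj w v.
Proof. by move=> [a l]; split; [exact: adj_sym|]. Qed.

Lemma sadj_valid v w : sadj v w -> valid v /\ valid w.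
Proof.
by move=> [[_ [c vc [iv iw]]] _]; split; [exact: inc_valid iv|exact: inc_valid iw].
Qed.

Lemma walk1 v w : sadj v w -> walk 1 v w.
Proof. by move=> vw; apply: walkS vw _; exact: walk0. Qed.

Lemma walk_cat k l v w x : walk k v w -> walk l w x -> walk (k + l) v x.
Proof.
move=> vw; elim: vw x l => {k v w} [k v|k v w y vw _ IH] x l wx.
  elim: wx k => {l v x} [l v|l v w x vw _ IH] k; first exact: walk0.
  by rewrite addnS; apply: walkS vw _; exact: IH.
by rewrite addSn; apply: walkS vw _; exact: IH.
Qed.

Lemma walk_le k l v w : k <= l -> walk k v w -> walk l v w.
Proof. by move=> kl vw; rewrite -(subnKC kl); apply: walk_cat vw _; exact: walk0. Qed.

Lemma walk_sym k v w : walk k v w -> walk k w v.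
Proof.
elim=> {k v w} [k v|k v w x vw _ IH]; first exact: walk0.
by rewrite -addn1; apply: walk_cat IH _; apply: walk1; exact: sadj_sym.
Qed.

Lemma walk_inv k v w : walk k.+1 v w -> v = w \/ exists2 x, sadj v x & walk k x w.
Proof. by move=> vw; inversion vw; [left|right; exists w0]. Qed.

Lemma walk_split k l v w : walk (k + l) v w -> exists2 x, walk k v x & walk l x w.
Proof.
elim: k v => [|k IH] v; first by rewrite add0n => vw; exists v => //; exact: walk0.
rewrite addSn => /walk_inv[->|[x vx /IH[y xy yw]]].
  by exists w; exact: walk0.
by exists y => //; apply: walkS vx xy.
Qed.

Lemma walk0_eq v w : walk 0 v w -> v = w.
Proof. by move=> vw; inversion vw. Qed.

Lemma walk_valid k v w : walk k v w -> valid v -> valid w.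
Proof. by elim=> {k v w} // k v w x /sadj_valid[_ vw] _ IH _; exact: IH. Qed.

Lemma walk_lvl k v w : walk k v w -> lvl v = lvl w.
Proof. by elim=> {k v w} // k v w x [_ ->]. Qed.

Lemma below_walk u u' v : below u v -> below u' v -> walk 1 u u'.
Proof.
move=> bu bu'; have [->|[t uu']] := below_simplex bu bu'; first exact: walk0.
apply: walk1; split; first exact: tri_adj uu' t.
by apply: succn_inj; case: bu bu' => _ -> [_ ->].
Qed.

Definition descends k v w :=
  exists u u', [/\ below u v, below u' w & walk k u u'].

Lemma descends_cat k l v w x : descends k v w -> descends l w x ->
  descends (k + l).+1 v x.
Proof.
move=> [u1 [u2 [b1 b2 w12]]] [u3 [u4 [b3 b4 w34]]].
exists u1, u4; split=> //; rewrite -addnS.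
apply: walk_cat w12 _; rewrite -add1n; exact: walk_cat (below_walk b2 b3) w34.
Qed.

Lemma descends_any k v w u u' : descends k v w -> below u v -> below u' w ->
  walk k.+2 u u'.
Proof.
move=> [u1 [u2 [b1 b2 w12]]] bu bu'; rewrite (_ : k.+2 = 1 + (k + 1)); last by rewrite addn1.
apply: walk_cat (below_walk bu b1) _; exact: walk_cat w12 (below_walk b2 bu').
Qed.

Lemma descends_le k l v w : k <= l -> descends k v w -> descends l v w.
Proof.
by move=> kl [u [u' [? ? vw]]]; exists u, u'; split=> //; exact: walk_le vw.
Qed.

Lemma descends_refl v : valid v -> 0 < lvl v -> descends 0 v v.
Proof.
by move=> vv lv; have [u b] := has_below vv lv; exists u, u; split=> //; exact: walk0.
Qed.

Lemma sadj_base v w : sadj v w -> exists u, [/\ tri u v w, (lvl u).+1 = lvl v,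
  tyv u != tyv v, tyv u != tyv w & below u v /\ below u w].
Proof.
move=> [vw lvw]; have [u [t l t1 t2]] := same_level_base vw lvw.
exists u; split=> //; case: t => c vc [iu iv iw].
by split; [split=> //; split=> //; exists c|split; [split=> //; exists c|rewrite -lvw]].
Qed.

Lemma descends_step v w : sadj v w -> descends 0 v w.
Proof. by move=> /sadj_base[u [_ _ _ _ [? ?]]]; exists u, u; split=> //; exact: walk0. Qed.

(** Each of the [k] edges has a vertex below both its ends, and consecutive ones among these are at
    most one step apart. *)
Lemma descends_walk k v w : valid v -> 0 < lvl v -> walk k v w ->
  descends k.-1 v w.
Proof.
move=> vv lv vw; elim: vw vv lv => {k v w} [k v|k v w x vw wx IH] vv lv.
  by apply: descends_le (descends_refl vv lv).
have [_ vw'] := sadj_valid vw; have lw : 0 < lvl w by case: (vw) => _ <-.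
have Q1 := descends_step vw; case: k wx IH => [/walk0_eq <- //|k] wx IH.
by have := descends_cat Q1 (IH vw' lw).
Qed.

(** If successive [u]'s are distinct, then [u1], [u2], [v2] have three different types, and so do
    [u2], [u3], [v3]. As [v2] and [v3] differ in type, one of [u1], [u2], [u3] has type [s], which
    [special_turn] excludes. So two successive [u]'s coincide and one of the four steps is saved. *)
Lemma five_turns v0 v1 v2 v3 v4 v5 : sadj v0 v1 -> sadj v1 v2 -> sadj v2 v3 ->
  sadj v3 v4 -> sadj v4 v5 -> descends 3 v0 v5.
Proof.
move=> s0 s1 s2 s3 s4.
have [u0 [a0 b0 c0 d0 [e0 f0]]] := sadj_base s0.
have [u1 [a1 b1 c1 d1 [e1 f1]]] := sadj_base s1.
have [u2 [a2 b2 c2 d2 [e2 f2]]] := sadj_base s2.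
have [u3 [a3 b3 c3 d3 [e3 f3]]] := sadj_base s3.
have [u4 [a4 b4 c4 d4 [e4 f4]]] := sadj_base s4.
have w01 := below_walk f0 e1. have w12 := below_walk f1 e2.
have w23 := below_walk f2 e3. have w34 := below_walk f3 e4.
exists u0, u4; split=> //.
have [E|n01] := pselect (u0 = u1).
  by rewrite E; apply: (walk_cat w12); apply: (walk_cat w23).
have [E|n12] := pselect (u1 = u2).
  by apply: (walk_cat w01); rewrite E; apply: (walk_cat w23).
have [E|n23] := pselect (u2 = u3).
  by apply: (walk_cat w01); apply: (walk_cat w12); rewrite E.
have [E|n34] := pselect (u3 = u4).
  by rewrite -E; apply: (walk_cat w01); apply: (walk_cat w12).
exfalso; have [[t0 _] l0] := s0; have [[t1 _] l1] := s1; have [[t2 _] l2] := s2.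
have [[t3 _] l3] := s3; have [[t4 _] l4] := s4.
have [//|[x12 _]] := below_simplex f1 e2; have [//|[x23 _]] := below_simplex f2 e3.
have [E|n1] := eqVneq (tyv u1) s.
  exact: (special_turn l0 l1 l2 a0 a1 a2).
have [E|n2] := eqVneq (tyv u2) s.
  exact: (special_turn l1 l2 l3 a1 a2 a3).
apply: (special_turn l2 l3 l4 a2 a3 a4) => //.
move: n1 n2 c1 d1 c2 d2 c3 d3 t1 t2 t3 x12 x23; clear.
by case: s; case: (tyv u1) => //; case: (tyv u2) => //; case: (tyv v2) => //;
  case: (tyv v3) => //; case: (tyv u3).
Qed.

Lemma descends5 v w : valid v -> 0 < lvl v -> walk 5 v w -> descends 3 v w.
Proof.
move=> vv lv.
have Q k x : k <= 4 -> walk k v x -> descends 3 v x.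
  by move=> k4 /(walk_le k4); exact: descends_walk.
move=> /walk_inv[<-|[v1 s0]]; first by apply: (Q 0) => //; exact: walk0.
move=> /walk_inv[<-|[v2 s1]].
  by apply: (Q 1%N) => //; apply: (walkS s0); exact: walk0.
move=> /walk_inv[<-|[v3 s2]].
  by apply: (Q 2) => //; apply: (walkS s0); apply: (walkS s1); exact: walk0.
move=> /walk_inv[<-|[v4 s3]].
  apply: (Q 3) => //; apply: (walkS s0); apply: (walkS s1); apply: (walkS s2).
  exact: walk0.
move=> /walk_inv[<-|[v5 s4 /walk0_eq <-]].
  apply: (Q 4) => //; apply: (walkS s0); apply: (walkS s1); apply: (walkS s2).
  by apply: (walkS s3); exact: walk0.
exact: five_turns s0 s1 s2 s3 s4.
Qed.

(** A walk of length [k] descends to length [k - 1], each block of five steps saves one more, and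
    prescribed lower end points cost two. Two blocks are needed for a net gain, hence the bound
    10. *)
Lemma walk_contract k v w u u' : valid v -> 10 <= k -> walk k v w ->
  below u v -> below u' w -> walk k.-1 u u'.
Proof.
move=> vv k10 vw bu bu'; have lv : 0 < lvl v by case: bu => _ <-.
have: walk (5 + (5 + (k - 10))) v w by apply: walk_le vw; lia.
move=> /walk_split[x vx /walk_split[y xy yw]].
have vx' := walk_valid vx vv; have vy' := walk_valid xy vx'.
have lx : 0 < lvl x by rewrite -(walk_lvl vx).
have ly : 0 < lvl y by rewrite -(walk_lvl xy).
have Q1 := descends_cat (descends5 vv lv vx) (descends5 vx' lx xy).
case: (posnP (k - 10)) => [e|kp].
  rewrite e in yw; rewrite (walk0_eq yw) in Q1.
  by apply: walk_le (descends_any Q1 bu bu'); lia.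
have Q2 := descends_cat Q1 (descends_walk vy' ly yw).
by apply: walk_le (descends_any Q2 bu bu'); lia.
Qed.

(** * Ancestors *)

Definition par v :=
  if pselect (exists u, below u v) is left h then projT1 (cid h) else v.

Lemma par_below v : valid v -> 0 < lvl v -> below (par v) v.
Proof.
move=> vv lv; rewrite /par; case: pselect => [h|[]]; last exact: has_below.
exact: projT2 (cid h).
Qed.

Lemma below_valid u v : below u v -> valid u.
Proof. by move=> [[_ [c vc [iu _]]] _]; exact: inc_valid iu. Qed.

Definition anc n v := iter (lvl v - n) par v.

Lemma anc_spec n v : valid v -> n <= lvl v -> valid (anc n v) /\ lvl (anc n v) = n.
Proof.
move=> vv nl; rewrite /anc.
suff H k : k <= lvl v -> valid (iter k par v) /\ lvl (iter k par v) = lvl v - k.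
  by have [|? ->] := H (lvl v - n); [exact: leq_subr|rewrite subKn].
elim: k => [|k IH] kl /=; first by rewrite subn0.
have [vk lk] := IH (ltnW kl).
have b : below (par (iter k par v)) (iter k par v).
  by apply: par_below => //; rewrite lk subn_gt0.
split; first exact: below_valid b.
by case: b => _; rewrite lk; lia.
Qed.

Lemma anc_below n v : valid v -> n < lvl v -> below (anc n v) (anc n.+1 v).
Proof.
move=> vv nl; have [va la] := anc_spec vv nl.
rewrite {1}/anc (_ : lvl v - n = (lvl v - n.+1).+1); last by lia.
by rewrite iterS; apply: par_below => //; rewrite la.
Qed.

(** 9 is the largest length that [walk_contract] does not shorten. *)
Definition close n v w :=
  [/\ n <= lvl v, n <= lvl w & walk 9 (anc n v) (anc n w)].

Lemma walk_anc n k m v w : valid v -> valid w -> m + n <= lvl v ->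
  m + n <= lvl w -> walk (9 + k) (anc (m + n) v) (anc (m + n) w) ->
  walk (9 + (k - m)) (anc n v) (anc n w).
Proof.
move=> vv vw; elim: m k => [|m IH] k lv lw; first by rewrite subn0.
move=> wk; have [va _] := anc_spec vv lv.
(* The maximum covers [k = 0]: a walk of length 9 is read as one of length at most 10 and projects
   to length 9 again. *)
have := walk_contract va _ (walk_le (_ : _ <= maxn (9 + k) 10) wk)
  (anc_below vv lv) (anc_below vw lw).
move=> /(_ _)/(_ _) H; rewrite subnS -subn1 subnAC.
apply: IH; try by lia.
by apply: walk_le (H _ _); lia.
Qed.

Lemma close_le m n v w : valid v -> valid w -> m <= n -> close n v w -> close m v w.
Proof.
move=> vv vw mn [lv lw wk]; split; try by lia.
apply: (@walk_anc m 0 (n - m)) => //; rewrite ?subnK //; exact: wk.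
Qed.

Lemma close_sym n v w : close n v w -> close n w v.
Proof. by move=> [? ? ?]; split=> //; exact: walk_sym. Qed.

Lemma lvl0 v : valid v -> lvl v = 0 -> v = vroot.
Proof. by case: v. Qed.

Lemma close0 v w : valid v -> valid w -> close 0 v w.
Proof.
move=> vv vw; split=> //.
have [va la] := anc_spec vv (leq0n _); have [vb lb] := anc_spec vw (leq0n _).
by rewrite (lvl0 va la) (lvl0 vb lb); exact: walk0.
Qed.

(** Concatenation gives length 18, which is contracted to 9 by descending nine levels. *)
Lemma close_trans n u v w : valid u -> valid v -> valid w ->
  close n u v -> close n v w -> close (n - 9) u w.
Proof.
move=> vu vv vw [lu lv uv] [_ lw vw'].
case: (leqP n 9) => [n9|n9]; first by rewrite (eqP n9); exact: close0.
have e : n = 9 + (n - 9) by lia.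
split; try by lia.
apply: (@walk_anc _ 9 9); rewrite -?e //; exact: (walk_cat uv vw').
Qed.

Lemma adj_lvl v w : adj v w -> lvl v <= (lvl w).+1.
Proof.
move=> [tvw [[[u x] a] vc [iv iw]]]; have [/= vu Xx Dx Aa] := vc.
have [[ev ea]|[ev a1]|[k [ku tv ev]]] := inc_cases vc iv;
have [[ew ea']|[ew a1']|[l [lu tw ew]]] := inc_cases vc iw;
  by rewrite ev ew ?top_lvl //=; try lia; case: a1.
Qed.

Lemma close_below v w : below v w -> close (lvl v) v w.
Proof.
move=> b; have vw : valid w by case: b => -[_ [c vc [_ iw]]] _; exact: inc_valid iw.
have [_ l] := b; have lw : 0 < lvl w by rewrite -l.
split=> //; first by rewrite -l.
rewrite /anc subnn -l subSnn /=; apply: (@walk_le 1) => //.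
exact: below_walk b (par_below vw lw).
Qed.

Lemma close_adj v w : adj v w -> close (minn (lvl v) (lvl w)) v w.
Proof.
move=> vw; have l1 := adj_lvl vw; have l2 := adj_lvl (adj_sym vw).
have [e|e|e] := ltngtP (lvl v) (lvl w).
- by apply: close_below; split=> //; lia.
- by apply: close_sym; apply: close_below; split; [exact: adj_sym|lia].
- split; rewrite ?e // /anc e subnn.
  by apply: (@walk_le 1) => //; exact: walk1.
Qed.

(** * Paths in the complex and word length *)

Inductive ypath : nat -> vert -> vert -> Prop :=
  | ypath0 k v : ypath k v v
  | ypathS k v w x : adj v w -> ypath k w x -> ypath k.+1 v x.

Lemma ypath_cat k l v w x : ypath k v w -> ypath l w x -> ypath (k + l) v x.
Proof.
move=> vw; elim: vw x l => {k v w} [k v|k v w y vw _ IH] x l wx.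
  elim: wx k => {l v x} [l v|l v w x vw _ IH] k; first exact: ypath0.
  by rewrite addnS; apply: ypathS vw _; exact: IH.
by rewrite addSn; apply: ypathS vw _; exact: IH.
Qed.

Lemma ypath_sym k v w : ypath k v w -> ypath k w v.
Proof.
elim=> {k v w} [k v|k v w x vw _ IH]; first exact: ypath0.
rewrite -addn1; apply: ypath_cat IH _; apply: ypathS (adj_sym vw) _; exact: ypath0.
Qed.

Lemma walk_ypath k v w : walk k v w -> ypath k v w.
Proof.
elim=> {k v w} [k v|k v w x [vw _] _ IH]; first exact: ypath0.
exact: ypathS vw IH.
Qed.

Lemma anc_ypath n v : valid v -> n <= lvl v -> ypath (lvl v - n) v (anc n v).
Proof.
move=> vv nl; have {nl} : n + (lvl v - n) = lvl v by rewrite subnKC.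
move: (lvl v - n) => k; elim: k n => [|k IH] n e.
  by rewrite /anc -e addn0 subnn; exact: ypath0.
have nl : n < lvl v by rewrite -e addnS ltnS leq_addr.
rewrite -(addn1 k); apply: (@ypath_cat _ _ _ (anc n.+1 v)).
  by apply: IH; rewrite addSnnS.
have [a _] := anc_below vv nl.
by apply: ypathS (adj_sym a) _; exact: ypath0.
Qed.

Lemma close_ypath n v w : valid v -> valid w -> close n v w ->
  ypath ((lvl v - n) + (9 + (lvl w - n))) v w.
Proof.
move=> vv vw [lv lw wk]; apply: ypath_cat (anc_ypath vv lv) _.
by apply: ypath_cat (walk_ypath wk) _; apply: ypath_sym; exact: anc_ypath.
Qed.

Definition Xword n g := exists w : seq G,
  [/\ size w = n, forall x, x \in w -> exists i, X i x & \prod_(x <- w) x = g].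

Lemma inc_Xword v c c' : valid3 c -> inc v c -> valid3 c' -> inc v c' ->
  exists i, X i ((ev c)^-1 * ev c').
Proof.
move=> vc ic vc' ic'; exists (tyv v).
have [_ _ Xc _] := locP (tyv v) vc; have [_ _ Xc' _] := locP (tyv v) vc'.
rewrite (ev_loc (tyv v) vc) (ev_loc (tyv v) vc') ic ic' invgM -mulgA mulKg.
by apply: XM => //; exact: XV.
Qed.

Lemma Xword1 i x : X i x -> Xword 1 x.
Proof.
move=> Xx; exists [:: x]; split=> //; last by rewrite big_seq1.
by move=> y; rewrite inE => /eqP ->; exists i.
Qed.

Lemma Xword_cat m n g h : Xword m g -> Xword n h -> Xword (m + n) (g * h).
Proof.
move=> [u [su Xu pu]] [w [sw Xw pw]]; exists (u ++ w); split.
- by rewrite size_cat su sw.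
- by move=> x; rewrite mem_cat => /orP[/Xu|/Xw].
- by rewrite big_cat pu pw.
Qed.

(** Two chambers at a common vertex differ by an element of a vertex group, so a path with [n] edges
    costs one letter for each of its [n.+1] vertices. *)
Lemma ypath_Xword n v w c c' : ypath n v w -> valid3 c -> inc v c ->
  valid3 c' -> inc w c' -> Xword n.+1 ((ev c)^-1 * ev c').
Proof.
move=> p; elim: p c => {n v w} [k v|k v w x [_ [e ve [iv iw]]] _ IH] c vc ic vc' ic'.
  have [i Xi] := inc_Xword vc ic vc' ic'; rewrite -add1n -[_ * _]mulg1.
  apply: Xword_cat (Xword1 Xi) _; exists (nseq k 1); split.
  - by rewrite size_nseq.
  - by move=> y /nseqP[-> _]; exists T0.
  - by rewrite big_nseq; clear; elim: k => //= k ->; rewrite mul1g.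
have [i Xi] := inc_Xword vc ic ve iv.
rewrite (_ : _ * _ = ((ev c)^-1 * ev e) * ((ev e)^-1 * ev c')).
  by rewrite -add1n; apply: Xword_cat (Xword1 Xi) _; exact: IH.
by rewrite -mulgA mulVKg.
Qed.

Variable kappa : G -> chamber.
Hypothesis kappa1 : kappa 1 = (vroot, 1, 1).
Hypothesis kappaV : forall g, valid3 (kappa g).
Hypothesis kappa_ev : forall g, ev (kappa g) = g.
Hypothesis kappaM : forall i g x, X i x -> kappa (g * x) = act i (kappa g) x.

Definition bv g := (loc (kappa g) T0).1.

Lemma bv_valid g : valid (bv g).
Proof. by have [] := locP T0 (kappaV g). Qed.

Lemma bv_inc g : inc (bv g) (kappa g).
Proof. exact: inc_loc. Qed.

Lemma kappa_share i g x : X i x -> exists v, [/\ tyv v = i, inc v (kappa g) &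
  inc v (kappa (g * x))].
Proof.
move=> Xx; exists (loc (kappa g) i).1.
have [_ t _ _] := locP i (kappaV g); split=> //; first exact: inc_loc.
by rewrite (kappaM g Xx) /inc t; have [_ ->] := actP (kappaV g) Xx.
Qed.

Lemma inc_adj v w c : valid3 c -> inc v c -> inc w c -> v = w \/ adj v w.
Proof.
move=> vc iv iw; case: (eqVneq (tyv v) (tyv w)) => [e|t].
  by left; exact: inc_eq iv iw e.
by right; split=> //; exists c.
Qed.

Lemma kappa_lvl n g v : Xword n g -> inc v (kappa g) -> lvl v <= n.+1.
Proof.
move=> [w [<- Xw <-]] {n g}; elim/last_ind: w Xw v => [|w x IH] Xw v.
  rewrite big_nil kappa1 => iv.
  have vr : valid3 (vroot, 1, 1) by rewrite -kappa1.
  by have [[->]|[_ []]|[k [k0 _ ->]]] := inc_cases vr iv => //; rewrite top_lvl //; case: vr.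
rewrite -cats1 big_cat big_seq1 /= => iv.
have [|i Xx] := Xw x; first by rewrite mem_rcons inE eqxx.
have [u [_ iu iu']] := kappa_share (\prod_(y <- w) y) Xx.
have lu : lvl u <= (size w).+1.
  by apply: IH iu => y yw; apply: Xw; rewrite mem_rcons inE yw orbT.
rewrite size_cat addn1.
by have [->|/adj_lvl] := inc_adj (kappaV _) iv iu' => //; lia.
Qed.

Lemma bv_Xword g : Xword (lvl (bv g)).+1 g.
Proof.
have vr : valid3 (vroot, 1, 1) by rewrite -kappa1.
have p := anc_ypath (bv_valid g) (leq0n _).
have [va la] := anc_spec (bv_valid g) (leq0n _).
rewrite (lvl0 va la) subn0 in p.
have := ypath_Xword (ypath_sym p) vr (inc_base _ _) (kappaV g) (bv_inc g).
by rewrite kappa_ev /ev /= !mulg1 invg1 mul1g.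
Qed.

Lemma close_Xword n g h : close n (bv g) (bv h) ->
  Xword ((lvl (bv g) - n) + (9 + (lvl (bv h) - n))).+1 (g^-1 * h).
Proof.
move=> /(close_ypath (bv_valid g) (bv_valid h)) p.
by have := ypath_Xword p (kappaV g) (bv_inc g) (kappaV h) (bv_inc h); rewrite !kappa_ev.
Qed.

(** The two chambers share a vertex [v]. Passing through it may lower the level by 2, and
    transitivity loses 9. *)
Lemma Xstep_close i g x : X i x -> close (lvl (bv g) - 11) (bv g) (bv (g * x)).
Proof.
move=> Xx; have [v [_ iv iv']] := kappa_share g Xx.
have vv := inc_valid (kappaV _) iv.
have cl u w : valid u -> valid w -> u = w \/ adj u w ->
    close (minn (lvl u) (lvl w)) u w.
  move=> vu vw [<-|a]; last exact: close_adj.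
  by rewrite minnn; split=> //; exact: walk0.
have a1 := inc_adj (kappaV g) (bv_inc g) iv.
have a2 := inc_adj (kappaV _) iv' (bv_inc (g * x)).
have l1 : lvl (bv g) <= (lvl v).+1 by case: a1 => [->|/adj_lvl].
have l2 : lvl v <= (lvl (bv (g * x))).+1 by case: a2 => [<-|/adj_lvl].
have c1 := cl _ _ (bv_valid g) vv a1.
have c2 := cl _ _ vv (bv_valid _) a2.
rewrite (_ : _ - 11 = (lvl (bv g) - 2) - 9); last by lia.
apply: (close_trans (bv_valid _) vv (bv_valid _)).
- by apply: close_le c1; [exact: bv_valid|exact: vv|lia].
- by apply: close_le c2; [exact: vv|exact: bv_valid|lia].
Qed.

Variables (S : seq G) (genS : generates S).
Hypothesis SX : forall x, x \in S <-> exists i, X i x.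

Lemma word_of_lengthE n g : word_of_length S g n <-> Xword n g.
Proof.
split=> -[w [sw Sw pw]]; exists w; split=> //.
  move=> x /Sw; rewrite mem_cat => /orP[/SX//|/mapP[y /SX[i Xy] ->]].
  by exists i; exact: XV.
by move=> x /Sw /SX xS; rewrite mem_cat xS.
Qed.

Lemma triangle_hyperbolic : exists C, forall (k : nat) x y z,
  k + word_norm genS (x^-1 * z) <= word_norm genS x + word_norm genS z ->
  k + word_norm genS (z^-1 * y) <= word_norm genS z + word_norm genS y ->
  k + word_norm genS (x^-1 * y) <= word_norm genS x + word_norm genS y + C.
Proof.
have nl g : word_norm genS g <= (lvl (bv g)).+1.
  by apply: word_norm_le; apply/word_of_lengthE; exact: bv_Xword.
have ln g : lvl (bv g) <= (word_norm genS g).+1.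
  apply: kappa_lvl (bv_inc g); apply/word_of_lengthE; exact: word_norm_word.
have vb := bv_valid.
(* The level and the word norm differ by at most 1. So 12 covers the 9 of [close_trans], the 11 of
   [Xstep_close] plus 1, and the 10 extra letters of [close_Xword] plus 2. *)
apply: (@coarse_hyperbolic G (word_norm genS) (fun x y => word_norm genS (x^-1 * y))
  (fun m g h => close m (bv g) (bv h)) 12).
- by move=> x; rewrite mulVg word_norm1.
- exact: word_dist_sym.
- move=> x y; split; last by have := word_normM genS x (x^-1 * y); rewrite mulVKg.
  by rewrite word_dist_sym; have := word_normM genS y (y^-1 * x); rewrite mulVKg.
- by move=> x y; have := word_normM genS x^-1 y; rewrite word_normV.
- exact: word_geodesic.
- by move=> k m x y km; exact: close_le.
- by move=> m x y; exact: close_sym.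
- move=> m x y z xy yz; apply: close_le (close_trans (vb x) (vb y) (vb z) xy yz) => //.
  by apply: leq_sub2l.
- move=> x y d1; have [i Xi] : exists i, X i (x^-1 * y).
    have /word_of_lengthE[w [sw Xw <-]] := word_norm_word genS (x^-1 * y).
    case: w sw Xw => [_ _|g [|h w]] /=; first by exists T0; rewrite big_nil.
      by move=> _ /(_ g); rewrite inE eqxx big_seq1; exact.
    by move=> sw; rewrite -sw in d1.
  have := Xstep_close x Xi; rewrite mulVKg; apply: close_le => //.
  by have := nl x; lia.
- move=> m x y cl; have [lx ly _] := cl.
  have /word_of_lengthE/(word_norm_le genS) := close_Xword cl.
  have := ln x; have := ln y; lia.
Qed.

End Geometry.

(** * Linear and unipotent actions *)

Section ElementaryAction.
Variable R : comNzRingType.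
Local Notation V := (ty -> R).
Local Open Scope ring_scope.

(** The test [i != j] makes this a bijection for all arguments. *)
Definition transv_fun (i j : ty) (c : R) (v : V) : V :=
  fun l => v l + (if (l == j) && (i != j) then c * v i else 0).

Lemma transv_funK i j c : cancel (transv_fun i j c) (transv_fun i j (- c)).
Proof.
move=> v; apply: funext => l; rewrite /transv_fun.
by case: i; case: j; case: l => /=; ring.
Qed.

Lemma transv_funVK i j c : cancel (transv_fun i j (- c)) (transv_fun i j c).
Proof.
move=> v; apply: funext => l; rewrite /transv_fun.
by case: i; case: j; case: l => /=; ring.
Qed.

(* The elementary matrix [1 + c e_ij] acting on row vectors. *)
Definition transv i j c : symgrp V := Symgrp (transv_funK i j c) (transv_funVK i j c).

Definition ty_next i := match i with T0 => T1 | T1 => T2 | T2 => T0 end.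

Lemma transvX i j c n : (transv i j c ^+ n)%g = transv i j (c *+ n).
Proof.
elim: n => [|n IH].
  rewrite expg0; apply: symgrpP => v; apply: funext => l.
  by rewrite symgrp1 /= /transv_fun mulr0n mul0r if_same addr0.
rewrite expgSr IH; apply: symgrpP => v; apply: funext => l.
rewrite symgrpM /= /transv_fun mulrS.
by case: {IH} i; case: j; case: l => /=; ring.
Qed.

Lemma transv_A2_next i c c' : A2 (transv i (ty_next i) c) (transv (ty_next i) (ty_next (ty_next i)) c').
Proof.
apply: (A2_intro (z := transv i (ty_next (ty_next i)) (c * c')));
  apply: symgrpP => v; apply: funext => l; rewrite !symgrpM /= /transv_fun;
  by case: i; case: l => /=; ring.
Qed.

Lemma transv_A2 i j c c' : i != j -> A2 (transv i (ty_next i) c) (transv j (ty_next j) c').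
Proof.
move=> ij; have [->|->] : j = ty_next i \/ i = ty_next j by case: i j ij => -[] //; auto.
  exact: transv_A2_next.
by apply: A2_sym; exact: transv_A2_next.
Qed.

Lemma transv_commute i j c c' : i != j ->
  commute (transv i (ty_next i) c) (transv j (ty_next j) c') -> c * c' = 0.
Proof.
suff H k d d' : commute (transv k (ty_next k) d) (transv (ty_next k) (ty_next (ty_next k)) d') ->
    d * d' = 0.
  move=> ij; have [->|->] : j = ty_next i \/ i = ty_next j by case: i j ij => -[] //; auto.
    exact: H.
  by move=> /commute_sym /H; rewrite mulrC.
move=> /(congr1 (fun f : symgrp V => f (fun l => (l == k)%:R) (ty_next (ty_next k)))).
rewrite !symgrpM /= /transv_fun; case: k => /=;
  rewrite ?(mulr0, mulr1, addr0, add0r) => e; rewrite mulrC //.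
Qed.

End ElementaryAction.

(** * An affine unipotent group satisfying B2 *)

Section UnipotentAction.
Variable F : comNzRingType.
Local Open Scope ring_scope.
Local Notation V := (F * F * F)%type.

(** Translations along the first axis, together with the unipotent Jordan block [shear_fun], give a
    concrete model of B2: the commutators are the translations along the other two axes. *)
Definition shift_fun (c : F) (v : V) : V := (v.1.1 + c, v.1.2, v.2).
Definition shear_fun (v : V) : V := (v.1.1, v.1.2 + v.1.1, v.2 + v.1.2).
Definition unshear_fun (v : V) : V := (v.1.1, v.1.2 - v.1.1, v.2 - v.1.2 + v.1.1).

Lemma shift_funK c : cancel (shift_fun c) (shift_fun (- c)).
Proof. by move=> [[x y] z]; rewrite /shift_fun /= addrK. Qed.
Lemma shift_funVK c : cancel (shift_fun (- c)) (shift_fun c).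
Proof. by move=> [[x y] z]; rewrite /shift_fun /= addrNK. Qed.
Lemma shear_funK : cancel shear_fun unshear_fun.
Proof. by move=> [[x y] z]; rewrite /shear_fun /unshear_fun /=; congr (_, _, _); ring. Qed.
Lemma shear_funVK : cancel unshear_fun shear_fun.
Proof. by move=> [[x y] z]; rewrite /shear_fun /unshear_fun /=; congr (_, _, _); ring. Qed.

Definition shift c : symgrp V := Symgrp (shift_funK c) (shift_funVK c).
Definition shear : symgrp V := Symgrp shear_funK shear_funVK.

Definition ytrans_fun (c : F) (v : V) : V := (v.1.1, v.1.2 + c, v.2).
Definition ztrans_fun (c : F) (v : V) : V := (v.1.1, v.1.2, v.2 + c).
Lemma ytrans_funK c : cancel (ytrans_fun c) (ytrans_fun (- c)).
Proof. by move=> [[x y] z]; rewrite /ytrans_fun /= addrK. Qed.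
Lemma ytrans_funVK c : cancel (ytrans_fun (- c)) (ytrans_fun c).
Proof. by move=> [[x y] z]; rewrite /ytrans_fun /= addrNK. Qed.
Lemma ztrans_funK c : cancel (ztrans_fun c) (ztrans_fun (- c)).
Proof. by move=> [[x y] z]; rewrite /ztrans_fun /= addrK. Qed.
Lemma ztrans_funVK c : cancel (ztrans_fun (- c)) (ztrans_fun c).
Proof. by move=> [[x y] z]; rewrite /ztrans_fun /= addrNK. Qed.
Definition ytrans c : symgrp V := Symgrp (ytrans_funK c) (ytrans_funVK c).
Definition ztrans c : symgrp V := Symgrp (ztrans_funK c) (ztrans_funVK c).

Lemma shift_shear_B2 : B2 (shift 1) shear.
Proof.
have e1 : [~ shift 1, shear] = ytrans 1.
  apply: commg_eq; apply: symgrpP => -[[x y] z]; rewrite !symgrpM /=.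
  by rewrite /shift_fun /shear_fun /ytrans_fun /=; congr (_, _, _); ring.
have e2 : [~ ytrans 1, shear] = ztrans 1.
  apply: commg_eq; apply: symgrpP => -[[x y] z]; rewrite !symgrpM /=.
  by rewrite /ztrans_fun /shear_fun /ytrans_fun /=; congr (_, _, _); ring.
split; rewrite e1 ?e2; apply/eqP/commgP; apply: symgrpP => -[[x y] z];
  rewrite !symgrpM /= /shift_fun /shear_fun /ytrans_fun /ztrans_fun /=;
  by congr (_, _, _); ring.
Qed.

Lemma shiftX n v : ((shift 1 ^+ n)%g : symgrp V) v = shift_fun n%:R v.
Proof.
elim: n v => [|n IH] [[x y] z]; first by rewrite expg0 symgrp1 /shift_fun /= addr0.
rewrite expgSr symgrpM IH /= /shift_fun /= mulrSr; congr (_, _, _); ring.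
Qed.

Lemma shearX n v : ((shear ^+ n)%g : symgrp V) v =
  (v.1.1, v.1.2 + n%:R * v.1.1, v.2 + n%:R * v.1.2 + 'C(n, 2)%:R * v.1.1).
Proof.
elim: n v => [|n IH] [[x y] z].
  by rewrite expg0 symgrp1 /= !mul0r !addr0.
rewrite expgSr symgrpM IH /= /shear_fun /= binS bin1 !natrD mulrSr.
by congr (_, _, _); ring.
Qed.

Lemma bin2R n : 'C(n, 2)%:R * 2%:R = n%:R * (n%:R - 1) :> F.
Proof.
elim: n => [|n IH]; first by rewrite bin0n !mul0r.
by rewrite binS bin1 natrD mulrDl IH mulrSr; ring.
Qed.

(** [hX], [hY], [hZ] say that a word of length six fixes the origin, [hS] that its shear exponents
    sum to zero. The [c]'s are binomial coefficients; doubling [hZ] eliminates them without division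
    by 2, and the displayed combination is the resulting certificate. *)
Lemma unipotent_girth_aux (a1 a2 a3 b1 b2 b3 c1 c2 c3 : F) :
  c1 * 2%:R = b1 * (b1 - 1) -> c2 * 2%:R = b2 * (b2 - 1) ->
  c3 * 2%:R = b3 * (b3 - 1) -> a1 + a2 + a3 = 0 -> b1 + b2 + b3 = 0 ->
  b1 * a1 + b2 * (a1 + a2) + b3 * (a1 + a2 + a3) = 0 ->
  c1 * a1 + b2 * (b1 * a1) + c2 * (a1 + a2) + b3 * (b1 * a1 + b2 * (a1 + a2)) +
    c3 * (a1 + a2 + a3) = 0 ->
  a3 * b3 * b2 = 0.
Proof.
move=> e1 e2 e3 hX hS hY hZ.
have {e1}e1 : c1 * 2%:R - b1 * (b1 - 1) = 0 by rewrite e1 subrr.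
have {e2}e2 : c2 * 2%:R - b2 * (b2 - 1) = 0 by rewrite e2 subrr.
have {e3}e3 : c3 * 2%:R - b3 * (b3 - 1) = 0 by rewrite e3 subrr.
rewrite (_ : a3 * b3 * b2 = (b1 + b2 + b3) * (a3 * b2)
  - 2%:R * (c1 * a1 + b2 * (b1 * a1) + c2 * (a1 + a2) +
     b3 * (b1 * a1 + b2 * (a1 + a2)) + c3 * (a1 + a2 + a3))
  + (b1 * a1 + b2 * (a1 + a2) + b3 * (a1 + a2 + a3)) *
     (b1 - 1 + 2%:R * b2 + 2%:R * b3)
  + (a1 + a2 + a3) * (- (b1 - 1 + 2%:R * b2) * (b2 + b3) + b2 * (b2 - 1)
     - 2%:R * b3 * b3 + b3 * (b3 - 1))
  + (c1 * 2%:R - b1 * (b1 - 1)) * a1 + (c2 * 2%:R - b2 * (b2 - 1)) * (a1 + a2)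
  + (c3 * 2%:R - b3 * (b3 - 1)) * (a1 + a2 + a3)); last by ring.
by rewrite e1 e2 e3 hZ hY hX hS !mul0r !mulr0 subr0 !addr0.
Qed.

Lemma unipotent_girth (a1 a2 a3 b1 b2 b3 : nat) :
  (shift 1 ^+ a1 * shear ^+ b1 * shift 1 ^+ a2 * shear ^+ b2 *
   shift 1 ^+ a3 * shear ^+ b3 = 1 :> symgrp V)%g ->
  a3%:R * b3%:R * b2%:R = 0 :> F.
Proof.
move=> e.
have := congr1 (fun f : symgrp V => f (0, 0, 0)) e.
have := congr1 (fun f : symgrp V => f (1, 0, 0)) e.
rewrite !symgrpM !symgrp1 !shiftX /shift_fun /= !(shearX, symgrpM, shiftX) /shift_fun /=.
move=> [x1 y1 z1] [x0 y0 z0].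
(* The images of (1, 0, 0) and of the origin differ in the second coordinate by the sum of the shear
   exponents. *)
have s : b1%:R + b2%:R + b3%:R = 0 :> F.
  have := congr2 (fun u v : F => u - v) y1 y0; rewrite subrr => <-.
  ring.
apply: (@unipotent_girth_aux a1%:R a2%:R _ _ _ _ _ _ _ (bin2R b1) (bin2R b2) (bin2R b3) _ s).
- by move: x0; rewrite add0r.
- by move: y0; rewrite !add0r.
- by move: z0; rewrite !add0r mulr0 add0r.
Qed.

End UnipotentAction.

(** * Triangle groups *)

(* [j i] and [k i] are the two types other than [i], listed in the order in which
   they enter the relation [B2], which is not symmetric. *)
Record triangle_group (p : nat) (j k : ty -> ty) (b : ty -> bool)
    (G : groupType) (g : ty -> G) : Prop := TriangleGroup {
  tg_others : forall i, [&& j i != i, k i != i & j i != k i];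
  tg_order : forall i, g i ^+ p = 1;
  tg_rel : forall i, vertex_rel (b i) (g (j i)) (g (k i));
  tg_hom : forall (H : groupType) (f : ty -> H), (forall i, f i ^+ p = 1) ->
    (forall i, vertex_rel (b i) (f (j i)) (f (k i))) ->
    exists phi : UMagmaMorphism.type G H, forall i, phi (g i) = f i;
  tg_ind : forall D : G -> Prop, D 1 -> (forall x i, D x -> D (x * g i)) ->
    forall x, D x }.

Section TriangleGroup.
Variables (p : nat) (j k : ty -> ty) (b : ty -> bool).
Variables (G : groupType) (g : ty -> G).
Hypotheses (p_pr : prime p) (p_odd : odd p).
Hypothesis tg : triangle_group p j k b g.

Let gp := tg_order tg.
Let p0 : (0 < p)%N := prime_gt0 p_pr.

Definition edge_group i : set G := [set x | exists n, x = g i ^+ n].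

(** Positive words suffice, since an inverse is a power ([genV]). *)
Inductive vertex_group (i : ty) : set G :=
  | vertex_group1 : vertex_group i 1
  | vertex_groupMg l x : l != i -> vertex_group i x -> vertex_group i (x * g l).

Lemma others_cases i l : l != i -> l = j i \/ l = k i.
Proof.
have := tg_others tg i.
by case: i => /and3P[]; case: (j _) => //; case: (k _) => //; case: l; auto.
Qed.

Lemma genV i : (g i)^-1 = g i ^+ p.-1.
Proof. by apply: (mulgI (g i)); rewrite mulgV -expgS prednK // gp. Qed.

Lemma edge_group1 i : edge_group i 1.
Proof. by exists 0%N. Qed.

Lemma edge_groupM i x y : edge_group i x -> edge_group i y -> edge_group i (x * y).
Proof. by move=> [m ->] [n ->]; exists (m + n)%N; rewrite expgnDr. Qed.

Lemma edge_groupV i x : edge_group i x -> edge_group i x^-1.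
Proof. by move=> [m ->]; exists (p.-1 * m)%N; rewrite -expVgn genV expgnA. Qed.

Lemma vertex_groupM i x y : vertex_group i x -> vertex_group i y ->
  vertex_group i (x * y).
Proof.
move=> Xx; elim=> [|l z li _ IH]; first by rewrite mulg1.
by rewrite mulgA; apply: vertex_groupMg.
Qed.

Lemma vertex_group_gen i l : l != i -> vertex_group i (g l).
Proof.
by move=> li; rewrite -[g l]mul1g; apply: vertex_groupMg => //; exact: vertex_group1.
Qed.

Lemma vertex_groupX i x n : vertex_group i x -> vertex_group i (x ^+ n).
Proof.
move=> Xx; elim: n => [|n IH]; first exact: vertex_group1.
by rewrite expgS; exact: vertex_groupM.
Qed.

Lemma vertex_groupV i x : vertex_group i x -> vertex_group i x^-1.
Proof.
elim=> [|l z li _ IH]; first by rewrite invg1; exact: vertex_group1.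
rewrite invgM; apply: vertex_groupM => //; rewrite genV.
exact/vertex_groupX/vertex_group_gen.
Qed.

Lemma edge_vertex i l x : l != i -> edge_group l x -> vertex_group i x.
Proof. by move=> li [n ->]; exact/vertex_groupX/vertex_group_gen. Qed.

Lemma vertex_group_finite i : finite_set (vertex_group i).
Proof.
have Bi := vertex_rel_B2 (tg_rel tg i).
apply: (B2_finite (gp (j i)) (gp (k i)) Bi p0) => x.
elim=> [|l z li _ [a [c [m [n ->]]]]].
  by exists 0%N, 0%N, 0%N, 0%N; rewrite /B2_elt !mulg1.
case: (others_cases li) => ->; first by rewrite (B2_elt_x Bi); eauto.
by rewrite (B2_elt_y Bi); eauto 6.
Qed.

(** A relation A2 or B2 becomes trivial when one of its two arguments is 1, so sending a single
    generator to 1 is a retraction. *)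
Lemma gen_kill i : exists r : UMagmaMorphism.type G G,
  forall l, r (g l) = if l == i then 1 else g l.
Proof.
apply: (tg_hom tg (f := fun l => if l == i then 1 else g l)) => l.
  by case: eqP => // _; rewrite ?expg1n ?gp.
case: eqP => _; first by apply: A2_vertex_rel; exact: A2_1l.
case: eqP => _; first by apply: A2_vertex_rel; exact: A2_1r.
exact: tg_rel tg l.
Qed.

Lemma edge_groupI i l x : i != l -> edge_group i x -> edge_group l x -> x = 1.
Proof.
move=> il [m em] [n en]; have [r rE] := gen_kill i.
have : r x = 1 by rewrite em gmulfXn rE eqxx expg1n.
by rewrite {1}en gmulfXn rE eq_sym (negbTE il) -en.
Qed.

(** The retraction killing [g i] fixes the vertex group of type [i], and sends that of type [l] into
    the powers of the remaining generator. *)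
Lemma vertex_groupI i l x : i != l -> vertex_group i x -> vertex_group l x ->
  edge_group (third i l) x.
Proof.
move=> il Xi Xl; have [r rE] := gen_kill i.
have <- : r x = x.
  elim: Xi => [|m y mi _ IH]; first exact: gmulf1.
  by rewrite gmulfM IH rE (negbTE mi).
elim: Xl => [|m y ml _ IH]; first by rewrite gmulf1; exact: edge_group1.
rewrite gmulfM; apply: edge_groupM => //; rewrite rE.
case: eqP => [_|/eqP mi]; first exact: edge_group1.
suff -> : m = third i l by exists 1%N.
by move: il ml mi; clear; case: i; case: l; case: m.
Qed.

Lemma elementary_hom : exists phi : UMagmaMorphism.type G (symgrp (ty -> {poly 'F_p})),
  forall i, phi (g i) = transv i (ty_next i) 'X%R.
Proof.
apply: (tg_hom tg) => i.
  rewrite transvX; apply: symgrpP => v; apply: funext => l /=.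
  have pP : p \in [pchar {poly 'F_p}]%R by rewrite pchar_poly; exact: pchar_Fp.
  by rewrite /transv_fun (mulrn_pchar pP) mul0r if_same addr0.
by apply: A2_vertex_rel; apply: transv_A2; have /and3P[] := tg_others tg i.
Qed.

Lemma natr_Fp_eq0 n : (n%:R == 0 :> 'F_p)%R = (p %| n).
Proof. by rewrite -(dvdn_pcharf (pchar_Fp p_pr)). Qed.

Lemma expg_dvd i n : p %| n -> g i ^+ n = 1.
Proof. by move=> /dvdnP[m ->]; rewrite mulnC expgnA gp expg1n. Qed.

Lemma edge_group_commute i l a c : i != l -> edge_group i a -> edge_group l c ->
  commute a c -> a = 1 \/ c = 1.
Proof.
move=> il [m ->] [n ->] com; have [phi phiE] := elementary_hom.
have := gmulf_commute phi com; rewrite !gmulfXn !phiE !transvX.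
move=> /(transv_commute il)/eqP; rewrite mulf_eq0 => /orP[] /eqP.
  move=> /(congr1 (fun q : {poly 'F_p} => q`_1))%R.
  by rewrite coefMn coefX coef0 /= => /eqP; rewrite natr_Fp_eq0 => /expg_dvd; left.
move=> /(congr1 (fun q : {poly 'F_p} => q`_1))%R.
by rewrite coefMn coefX coef0 /= => /eqP; rewrite natr_Fp_eq0 => /expg_dvd; right.
Qed.

(** Killing [g l] gives [a = a'], and killing [g i] gives [c = c']. A 4-cycle is thus a commutation,
    which the elementary matrices exclude. *)
Lemma girth4 i l a a' c c' : i != l -> edge_group i a -> edge_group i a' ->
  edge_group l c -> edge_group l c' -> a * c = c' * a' -> a = 1 \/ c = 1.
Proof.
move=> il Aa Aa' Ac Ac' e; apply: (edge_group_commute il) => //.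
have [r rE] := gen_kill l; have [r' rE'] := gen_kill i.
have fix_ (s : UMagmaMorphism.type G G) m y : s (g m) = g m -> edge_group m y -> s y = y.
  by move=> sm [n ->]; rewrite gmulfXn sm.
have one_ (s : UMagmaMorphism.type G G) m y : s (g m) = 1 -> edge_group m y -> s y = 1.
  by move=> sm [n ->]; rewrite gmulfXn sm expg1n.
have ri : r (g i) = g i by rewrite rE (negbTE il).
have rl : r (g l) = 1 by rewrite rE eqxx.
have ri' : r' (g i) = 1 by rewrite rE' eqxx.
have rl' : r' (g l) = g l by rewrite rE' eq_sym (negbTE il).
have ea : a = a'.
  have := congr1 r e.
  by rewrite !gmulfM (fix_ r i a) // (fix_ r i a') // (one_ r l c) // (one_ r l c') // mulg1 mul1g.
have ec : c = c'.
  have := congr1 r' e.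
  by rewrite !gmulfM (fix_ r' l c) // (fix_ r' l c') // (one_ r' i a) // (one_ r' i a') // mulg1 mul1g.
by rewrite /commute {1}ea {1}ec -?ea -?ec e ea ec.
Qed.

Lemma infinite_triangle : infinite_group G.
Proof.
have [phi phiE] := elementary_hom.
pose h := g T0 * g T1 * g T2.
pose v n : ty -> {poly 'F_p} := phi (h ^+ n) (fun l => (l == T0)%:R)%R.
have vS n : v n.+1 = phi h (v n) by rewrite /v expgSr gmulfM.
have hE w : phi h w =
    transv_fun T2 T0 'X%R (transv_fun T1 T2 'X%R (transv_fun T0 T1 'X%R w)).
  by rewrite /h !gmulfM !phiE.
(* Each of the three factors adds ['X] times the coordinate of largest degree to the next one, so
   after [n] rounds the coordinate [T0] dominates with degree 3n. *)
have inv n : [/\ size (v n T0) = (3 * n).+1, (size (v n T1) < (3 * n).+1)%N &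
    (size (v n T2) < (3 * n).+1)%N].
  elim: n => [|n [s0 s1 s2]].
    by rewrite /v expg0 gmulf1 symgrp1 /= size_poly1 size_poly0.
  have v1 : v n.+1 T1 = (v n T1 + 'X * v n T0)%R.
    by rewrite vS hE /transv_fun /= !addr0.
  have v2 : v n.+1 T2 = (v n T2 + 'X * v n.+1 T1)%R.
    by rewrite v1 vS hE /transv_fun /= !addr0.
  have v3 : v n.+1 T0 = (v n T0 + 'X * v n.+1 T2)%R.
    by rewrite v2 v1 vS hE /transv_fun /= !addr0.
  have sX (q q' : {poly 'F_p}) : (0 < size q')%N -> (size q <= size q')%N ->
      size (q + 'X * q')%R = (size q').+1.
    move=> q0 qq; rewrite addrC mulrC size_polyDl size_mulX //;
      by rewrite -size_poly_gt0.
  have e1 : size (v n.+1 T1) = (3 * n).+2 by rewrite v1 sX s0 //; lia.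
  have e2 : size (v n.+1 T2) = (3 * n).+3 by rewrite v2 sX e1 //; lia.
  have e3 : size (v n.+1 T0) = (3 * n).+4 by rewrite v3 sX e2 ?s0 //; lia.
  by rewrite e1 e2 e3; split; lia.
move=> finG; apply: infinite_nat.
apply: (@finite_preimage nat G setT (fun n => h ^+ n)) => // m n _ _ e.
have [em _ _] := inv m; have [en _ _] := inv n.
by move: em; rewrite /v e -/(v n) en; lia.
Qed.

Variable s : ty.
Hypothesis bs : b s = true.

(** The generator [g s] goes to 1, so only the relation at [s] has to be checked in the affine
    group. *)
Lemma unipotent_hom :
  exists phi : UMagmaMorphism.type G (symgrp ('F_p * 'F_p * 'F_p)%type),
    phi (g (j s)) = shift 1%R /\ phi (g (k s)) = shear _.
Proof.
pose f l : symgrp ('F_p * 'F_p * 'F_p)%type :=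
  if l == j s then shift 1%R else if l == k s then shear _ else 1.
have [js ks jks] := and3P (tg_others tg s).
have p0F : p%:R%R = 0%R :> 'F_p := pchar_Fp_0 p_pr.
have [||phi phiE] := tg_hom tg (f := f).
- move=> l; rewrite /f; case: eqP => _.
    apply: symgrpP => -[[x y] z]; rewrite shiftX /shift_fun p0F /=.
    by rewrite addr0.
  case: eqP => _; last by rewrite expg1n.
  apply: symgrpP => -[[x y] z]; rewrite shearX /= p0F !mul0r !addr0.
  (* Oddness of [p] enters here: it makes the second binomial coefficient divisible by [p], so that
     [shear] has order dividing [p]. *)
  suff -> : 'C(p, 2)%:R%R = 0%R :> 'F_p by rewrite mul0r addr0.
  apply/eqP; rewrite natr_Fp_eq0; apply: prime_dvd_bin => //=.
  by case: (p) p_pr p_odd => [|[|[|]]].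
- move=> l; have [ls|ls] := eqVneq l s.
    by rewrite ls bs /f eqxx eqxx eq_sym (negbTE jks); exact: shift_shear_B2.
  apply: A2_vertex_rel; have [jl kl jkl] := and3P (tg_others tg l).
  have : f s = 1 by rewrite /f (eq_sym s) (negbTE js) eq_sym (negbTE ks).
  have [->|->] : s = j l \/ s = k l by apply: others_cases; rewrite eq_sym.
    by move=> ->; exact: A2_1l.
  by move=> ->; exact: A2_1r.
exists phi; rewrite !phiE /f eqxx; split=> //.
by rewrite eq_sym (negbTE jks) eqxx.
Qed.

Lemma girth6_js a1 a2 a3 c1 c2 c3 :
  [/\ edge_group (j s) a1, edge_group (j s) a2 & edge_group (j s) a3] ->
  [/\ edge_group (k s) c1, edge_group (k s) c2 & edge_group (k s) c3] ->
  [/\ a1 <> 1, a2 <> 1 & a3 <> 1] -> [/\ c1 <> 1, c2 <> 1 & c3 <> 1] ->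
  a1 * c1 * a2 * c2 * a3 * c3 <> 1.
Proof.
move=> [[m1 ->] [m2 ->] [m3 ->]] [[n1 ->] [n2 ->] [n3 ->]] [_ _ nm3] [_ nn2 nn3] e.
have [phi [pj pk]] := unipotent_hom.
have := congr1 phi e; rewrite !gmulfM !gmulfXn pj pk gmulf1 => /unipotent_girth/eqP.
rewrite !mulf_eq0 !natr_Fp_eq0.
by case/orP=> [/orP[]|] /expg_dvd.
Qed.

Lemma girth6 i l a1 a2 a3 c1 c2 c3 : i != s -> l != s -> i != l ->
  [/\ edge_group i a1, edge_group i a2 & edge_group i a3] ->
  [/\ edge_group l c1, edge_group l c2 & edge_group l c3] ->
  [/\ a1 <> 1, a2 <> 1 & a3 <> 1] -> [/\ c1 <> 1, c2 <> 1 & c3 <> 1] ->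
  a1 * c1 * a2 * c2 * a3 * c3 <> 1.
Proof.
move=> is_ ls il Aa Ac na nc.
case: (others_cases is_) (others_cases ls) => ei [] el; subst i l.
- by rewrite eqxx in il.
- exact: girth6_js.
(* With the two edge groups in the other order, conjugation by [a1] rotates the relation. *)
- move=> e; case: Aa Ac na nc => ? ? ? [? ? ?] [? ? ?] [? ? ?].
  apply: (@girth6_js c1 c2 c3 a2 a3 a1) => //.
  apply: (mulgI a1); rewrite mulg1 !mulgA e mul1g //.
- by rewrite eqxx in il.
Qed.

Local Notation V3 := (valid3 edge_group vertex_group).
Local Notation act' := (act edge_group).

Let AX i l x : l != i -> edge_group l x -> vertex_group i x := @edge_vertex i l x.

Lemma actP' i w x : V3 w -> vertex_group i x ->
  V3 (act' i w x) /\ loc edge_group (act' i w x) i =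
    ((loc edge_group w i).1, (loc edge_group w i).2 * x).
Proof.
exact: (actP edge_group1 edge_groupM edge_groupV vertex_group1 vertex_groupM AX
  edge_groupI girth4).
Qed.

Lemma act1' i w : V3 w -> act' i w 1 = w.
Proof.
exact: (act1 edge_group1 edge_groupM edge_groupV vertex_group1 vertex_groupM AX
  edge_groupI girth4).
Qed.

Lemma actM' i w x y : V3 w -> vertex_group i x -> vertex_group i y ->
  act' i (act' i w x) y = act' i w (x * y).
Proof.
exact: (actM edge_group1 edge_groupM edge_groupV vertex_group1 vertex_groupM AX
  edge_groupI girth4).
Qed.

Lemma act_compat' i l w a : V3 w -> i != l -> edge_group (third i l) a ->
  act' i w a = act' l w a.
Proof.
exact: (act_compat edge_group1 edge_groupM edge_groupV vertex_groupM AX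
  edge_groupI girth4).
Qed.

Definition chambers := {w | V3 w}.

Lemma chambers_inj (u v : chambers) : sval u = sval v -> u = v.
Proof. by case: u v => [u hu] [v hv] /= e; subst v; congr exist; exact: Prop_irrelevance. Qed.

Definition chact i x (Xx : vertex_group i x) (w : chambers) : chambers :=
  exist _ (act' i (sval w) x) (proj1 (actP' (svalP w) Xx)).

Lemma chactK i x (Xx : vertex_group i x) : cancel (chact Xx) (chact (vertex_groupV Xx)).
Proof.
move=> w; apply: chambers_inj; rewrite /= actM' ?mulgV ?act1' //.
- exact: svalP.
- exact: svalP.
- exact: vertex_groupV.
Qed.

Lemma chactVK i x (Xx : vertex_group i x) : cancel (chact (vertex_groupV Xx)) (chact Xx).
Proof.
move=> w; apply: chambers_inj; rewrite /= actM' ?mulVg ?act1' //.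
- exact: svalP.
- exact: svalP.
- exact: vertex_groupV.
Qed.

Lemma gen_j l : vertex_group (j l) (g l).
Proof. by apply: vertex_group_gen; rewrite eq_sym; case/and3P: (tg_others tg l). Qed.

(** The vertex [j l] is one of the two at which [g l] acts; by compatibility the other one gives the
    same map ([gen_acts_as]). *)
Definition gen_act l : symgrp chambers := Symgrp (chactK (gen_j l)) (chactVK (gen_j l)).

Definition acts_as i (h : symgrp chambers) x :=
  vertex_group i x /\ forall w, sval (h w) = act' i (sval w) x.

Lemma gen_acts_as i l : l != i -> acts_as i (gen_act l) (g l).
Proof.
move=> li; split=> [|w /=]; first exact: vertex_group_gen.
have [->//|ji] := eqVneq (j l) i.
apply: act_compat' => //; first exact: svalP.
suff -> : third (j l) i = l by exists 1%N.
have /and3P[jl _ _] := tg_others tg l.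
by move: jl li ji; clear; case: (j l); case: l; case: i.
Qed.

Lemma acts_as1 i : acts_as i 1 1.
Proof.
split; first exact: vertex_group1.
by move=> w; rewrite symgrp1 act1' //; exact: svalP.
Qed.

Lemma acts_asM i h h' x x' : acts_as i h x -> acts_as i h' x' -> acts_as i (h * h') (x * x').
Proof.
move=> [Xx hx] [Xx' hx']; split=> [|w]; first exact: vertex_groupM.
by rewrite symgrpM hx' hx actM' //; exact: svalP.
Qed.

Lemma acts_asV i h x : acts_as i h x -> acts_as i h^-1 x^-1.
Proof.
move=> [Xx hx]; have Xx' := vertex_groupV Xx; split=> // w.
have e : w = h (h^-1 w) by rewrite -symgrpM mulVg.
rewrite {2}e hx actM' ?mulgV ?act1' //; exact: svalP.
Qed.

Lemma acts_as_eq1 i h : acts_as i h 1 -> h = 1.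
Proof.
move=> [_ h1]; apply: symgrpP => w; apply: chambers_inj.
by rewrite h1 act1' //; exact: svalP.
Qed.

Lemma acts_asR i h h' x x' : acts_as i h x -> acts_as i h' x' ->
  acts_as i [~ h, h'] [~ x, x'].
Proof.
move=> hx hx'; rewrite !commgEl !conjgE.
by do ?[apply: acts_asM => //|apply: acts_asV => //].
Qed.

Lemma acts_asX i h x n : acts_as i h x -> acts_as i (h ^+ n) (x ^+ n).
Proof.
move=> hx; elim: n => [|n IH]; first exact: acts_as1.
by rewrite !expgS; exact: acts_asM.
Qed.

(** [acts_as] respects commutators, and only the identity acts as 1. Relations therefore pass from
    the group itself to permutations of chambers, without knowing that they present the vertex
    group. *)
Lemma acts_as_rel i h h' x x' c : acts_as i h x -> acts_as i h' x' ->
  vertex_rel c x x' -> vertex_rel c h h'.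
Proof.
move=> hx hx'; have R1 := acts_asR hx hx'.
have R2 := acts_asR R1 hx; have R3 := acts_asR R1 hx'.
have R4 := acts_asR R3 hx; have R5 := acts_asR R3 hx'.
case: c => [] /=.
  move=> [e2 e4 e5]; rewrite e2 in R2; rewrite e4 in R4; rewrite e5 in R5.
  by split; apply: acts_as_eq1; eassumption.
move=> [e2 e3]; rewrite e2 in R2; rewrite e3 in R3.
by split; apply: acts_as_eq1; eassumption.
Qed.

Lemma chamber_hom : exists phi : UMagmaMorphism.type G (symgrp chambers),
  forall i x, vertex_group i x -> acts_as i (phi x) x.
Proof.
have [||phi phiE] := tg_hom tg (f := gen_act).
- move=> i; have /and3P[ji _ _] := tg_others tg i; rewrite eq_sym in ji.
  by have := acts_asX p (gen_acts_as ji); rewrite gp => /acts_as_eq1.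
- move=> i; have /and3P[ji ki _] := tg_others tg i.
  exact: acts_as_rel (gen_acts_as ji) (gen_acts_as ki) (tg_rel tg i).
exists phi => i x; elim=> [|l y li _ IH]; first by rewrite gmulf1; exact: acts_as1.
by rewrite gmulfM phiE; apply: acts_asM => //; exact: gen_acts_as.
Qed.

Lemma base_valid : V3 (vroot G, 1, 1).
Proof.
split=> //=; [exact: vertex_group1| |exact: edge_group1].
by move=> [? [? [? []]]].
Qed.

Theorem triangle_group_hyperbolic : exists S (genS : generates S),
  (forall x, x \in S <-> exists i, vertex_group i x) /\
  exists C, forall (m : nat) x y z,
    m + word_norm genS (x^-1 * z) <= word_norm genS x + word_norm genS z ->
    m + word_norm genS (z^-1 * y) <= word_norm genS z + word_norm genS y ->
    m + word_norm genS (x^-1 * y) <= word_norm genS x + word_norm genS y + C.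
Proof.
have fX : finite_set (vertex_group T0 `|` vertex_group T1 `|` vertex_group T2).
  by rewrite !finite_setU; do !split; exact: vertex_group_finite.
have [S eS] := (finite_seqP _).1 fX.
have SX x : x \in S <-> exists i, vertex_group i x.
  have -> : (x \in S) <-> [set` S] x by [].
  rewrite -eS; split=> [[[]|]|[[]]] Xx; by [exists T0|exists T1|exists T2|left; left|left; right|right].
have genS : generates S.
  apply: (tg_ind tg) => [|x i [n /asboolP[w [sw Sw pw]]]].
    by exists 0%N; apply/asboolP; exists [::]; rewrite big_nil.
  exists n.+1; apply/asboolP; exists (rcons w (g i)); split.
  - by rewrite size_rcons sw.
  - move=> y; rewrite mem_rcons inE => /orP[/eqP ->|/Sw//].
    by rewrite mem_cat; apply/orP; left; apply/SX; exists (j i); exact: gen_j.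
  - by rewrite -cats1 big_cat big_seq1 pw.
exists S, genS; split=> //.
have [phi phiE] := chamber_hom.
pose o : chambers := exist _ _ base_valid.
pose kappa x := sval (phi x o).
have kM i x y : vertex_group i y -> kappa (x * y) = act' i (kappa x) y.
  by move=> Xy; rewrite /kappa gmulfM symgrpM; case: (phiE i y Xy).
have kV x : V3 (kappa x) by exact: svalP.
apply: (triangle_hyperbolic edge_group1 edge_groupM edge_groupV vertex_group1
  vertex_groupM vertex_groupV AX edge_groupI girth4 vertex_groupI girth6
  (kappa := kappa) _ kV _ kM) => //.
- by rewrite /kappa gmulf1.
- apply: (tg_ind tg); first by rewrite /kappa gmulf1 /ev /= !mulg1.
  move=> x i ex; rewrite (kM (j i)); last exact: gen_j.
  rewrite (ev_act edge_group1 edge_groupM edge_groupV vertex_group1 vertex_groupM AX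
    edge_groupI girth4 (kV x)) ?ex //; exact: gen_j.
Qed.

Corollary triangle_hyperbolic_group (R : realType) : hyperbolic_group R G.
Proof.
have [S [genS [_ H]]] := triangle_group_hyperbolic.
by exists S, genS; exact: gromov_hyperbolic_norm.
Qed.

End TriangleGroup.

(** * The presentations as triangle groups *)

Definition letter (i : ty) : 'I_3 :=
  match i with T0 => inord 0 | T1 => inord 1 | T2 => inord 2 end.

Lemma letter_surj (x : 'I_3) : exists i, letter i = x.
Proof.
case: x => -[|[|[|//]]] h; [exists T0|exists T1|exists T2];
  by apply: val_inj; rewrite /= inordK.
Qed.

Lemma letter_inj : injective letter.
Proof. by move=> [] [] // /(congr1 val); rewrite /= !inordK. Qed.

(** The [foldr] computes to an explicit conjunction with one equation per relator. *)
Lemma all_relsE (K : groupType) (F : free_group 'I_3 -> K) (rels : seq (free_group 'I_3)) :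
  (forall r, r \in rels -> F r = 1) <-> foldr (fun r P => F r = 1 /\ P) True rels.
Proof.
elim: rels => [|r rels IH] /=; first by split.
split=> [H|[Fr /IH H] x]; last by rewrite inE => /orP[/eqP ->|/H].
split; first by apply: H; rewrite mem_head.
by apply/IH => x xr; apply: H; rewrite inE xr orbT.
Qed.

Lemma triangle_presentation (p : nat) j k b (rels : seq (free_group 'I_3)) :
  (0 < p)%N -> (forall i, [&& j i != i, k i != i & j i != k i]) ->
  (forall (K : groupType) (F : UMagmaMorphism.type (free_group 'I_3) K),
    (forall r, r \in rels -> F r = 1) <->
    (forall i, F (free_gen (letter i)) ^+ p = 1) /\
    (forall i, vertex_rel (b i) (F (free_gen (letter (j i))))
                              (F (free_gen (letter (k i)))))) ->
  triangle_group p j k b (fun i => pgen rels (letter i)).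
Proof.
move=> p0 jk rel; have [ordp relp] := (rel _ (@pclass _ rels)).1 (@pclass_rel _ rels).
split=> //.
- move=> K f fp frel; pose f' x := f (xget T0 [set i | letter i = x]).
  have f'E i : f' (letter i) = f i.
    by rewrite /f' (@xget_unique _ _ _ i) // => i' /letter_inj.
  have [F Ff|phi phiE] := @presented_hom _ rels K f'.
    apply: (rel K F).2; split=> i; rewrite !Ff !f'E; [exact: fp|exact: frel].
  by exists phi => i; rewrite phiE f'E.
- move=> D D1 DM; apply: presented_ind => // x y Dx.
    by have [i <-] := letter_surj y; exact: DM.
  have [i <-] := letter_surj y.
  have -> : (pgen rels (letter i))^-1 = pgen rels (letter i) ^+ p.-1.
    by apply: (mulgI (pgen rels (letter i))); rewrite mulgV -expgS prednK // ordp.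
  elim: p.-1 => [|n IH]; first by rewrite mulg1.
  by rewrite expgSr mulgA; exact: DM.
Qed.

Definition HC2_first i := match i with T0 => T1 | _ => T0 end.
Definition HC2_second i := match i with T2 => T1 | _ => T2 end.
Definition HC2_type i := match i with T1 => true | _ => false end.
Definition HC2_gen p (i : ty) : HC2_group p := pgen _ (letter i).

Lemma HC2_triangle p : prime p ->
  triangle_group p HC2_first HC2_second HC2_type (HC2_gen p).
Proof.
move=> p_pr; apply: triangle_presentation => [|[]//|K F]; first exact: prime_gt0.
rewrite all_relsE /= !gmulfXn !gmulfR; split.
  by move=> [? [? [? [? [? [? [? [? [? [? _]]]]]]]]]]; split=> -[] //=; split.
move=> [ord rel]; have := (ord T0, ord T1, ord T2).
by have [? ?] := rel T0; have [? ? ?] := rel T1; have [? ?] := rel T2 => -[[]]; do !split.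
Qed.

Definition HB2_first i := match i with T2 => T0 | _ => T2 end.
Definition HB2_second i := match i with T1 => T0 | _ => T1 end.
Definition HB2_type i := match i with T2 => false | _ => true end.
Definition HB2_gen p (i : ty) : HB2_group p := pgen _ (letter i).

Lemma HB2_triangle p : prime p ->
  triangle_group p HB2_first HB2_second HB2_type (HB2_gen p).
Proof.
move=> p_pr; apply: triangle_presentation => [|[]//|K F]; first exact: prime_gt0.
rewrite all_relsE /= !gmulfXn !gmulfR; split.
  by move=> [? [? [? [? [? [? [? [? [? [? [? _]]]]]]]]]]]; split=> -[] //=; split.
move=> [ord rel]; have := (ord T0, ord T1, ord T2).
by have [? ? ?] := rel T0; have [? ? ?] := rel T1; have [? ?] := rel T2 => -[[]]; do !split.
Qed.

(** The triangle group with cyclic symmetry: three relations B2 permuted by the rotation [t] of the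
    extension. *)
Definition HBC2_group (p : nat) : groupType :=
  let a := free_gen (inord 0 : 'I_3) in
  let b := free_gen (inord 1 : 'I_3) in
  let c := free_gen (inord 2 : 'I_3) in
  presented_group [:: a ^+ p; b ^+ p; c ^+ p;
    [~ a, b, a]; [~ a, b, b, a]; [~ a, b, b, b];
    [~ b, c, b]; [~ b, c, c, b]; [~ b, c, c, c];
    [~ c, a, c]; [~ c, a, a, c]; [~ c, a, a, a]].

Definition HBC2_gen p (i : ty) : HBC2_group p := pgen _ (letter i).

Lemma HBC2_triangle p : prime p -> triangle_group p ty_next
  (fun i => ty_next (ty_next i)) xpredT (HBC2_gen p).
Proof.
move=> p_pr; apply: triangle_presentation => [|[]//|K F]; first exact: prime_gt0.
rewrite all_relsE /= !gmulfXn !gmulfR; split.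
  by move=> [? [? [? [? [? [? [? [? [? [? [? [? _]]]]]]]]]]]]; split=> -[] //=; split.
move=> [ord rel]; have := (ord T0, ord T1, ord T2).
by have [? ? ?] := rel T0; have [? ? ?] := rel T1; have [? ? ?] := rel T2 => -[[]]; do !split.
Qed.

(** * Transfer of hyperbolicity between word metrics *)

Section WordNormTransfer.
Variables (G K : groupType) (S : seq G) (T : seq K).
Variables (genS : generates S) (genT : generates T) (phi : G -> K) (c : nat).
Hypothesis phi1 : phi 1 = 1.
Hypothesis phi_lower : forall x y,
  word_norm genT ((phi x)^-1 * phi y) <= word_norm genS (x^-1 * y).
Hypothesis phi_upper : forall x y,
  word_norm genS (x^-1 * y) <= word_norm genT ((phi x)^-1 * phi y) + c.

(** [phi] is any map fixing 1. Distances change by at most an additive constant, with no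
    multiplicative factor, so Gromov products are comparable directly. *)
Lemma hyperbolic_transfer :
  (exists C, forall (m : nat) x y z,
    m + word_norm genT (x^-1 * z) <= word_norm genT x + word_norm genT z ->
    m + word_norm genT (z^-1 * y) <= word_norm genT z + word_norm genT y ->
    m + word_norm genT (x^-1 * y) <= word_norm genT x + word_norm genT y + C) ->
  exists C, forall (m : nat) x y z,
    m + word_norm genS (x^-1 * z) <= word_norm genS x + word_norm genS z ->
    m + word_norm genS (z^-1 * y) <= word_norm genS z + word_norm genS y ->
    m + word_norm genS (x^-1 * y) <= word_norm genS x + word_norm genS y + C.
Proof.
move=> [C HC]; exists (C + 4 * c) => m x y z.
have n1 u : word_norm genT (phi u) <= word_norm genS u.
  by have := phi_lower 1 u; rewrite phi1 !invg1 !mul1g.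
have n2 u : word_norm genS u <= word_norm genT (phi u) + c.
  by have := phi_upper 1 u; rewrite phi1 !invg1 !mul1g.
have t : word_norm genS (x^-1 * y) <= word_norm genS x + word_norm genS y.
  by apply: leq_trans (word_normM _ _ _) _; rewrite word_normV.
have := HC (m - 2 * c) (phi x) (phi y) (phi z).
have := phi_lower x z; have := phi_lower z y; have := phi_upper x y.
have := n1 x; have := n1 y; have := n1 z; have := n2 x; have := n2 y; have := n2 z.
move: t; clear; lia.
Qed.

End WordNormTransfer.

(** * The extension by a rotation *)

(* The group [E] acts on [K * ty] over the rotation of [ty]: [t] rotates the
   fibres and [a] multiplies the fibre over [i] by [g i]. *)
Section Extension.
Variables (p : nat) (p_pr : prime p) (p_odd : odd p).
Variables (K : groupType) (g : ty -> K).
Hypothesis tg : triangle_group p ty_next (fun i => ty_next (ty_next i)) xpredT g.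
Variables (E : groupType) (t a : E).
Hypothesis t3 : t ^+ 3 = 1.
Hypothesis ap : a ^+ p = 1.
Hypothesis Bab : B2 a (a ^ t^-1).
Hypothesis ext_univ : forall (H : groupType) (t' a' : H), t' ^+ 3 = 1 ->
  a' ^+ p = 1 -> B2 a' (a' ^ t'^-1) ->
  exists theta : UMagmaMorphism.type E H, theta t = t' /\ theta a = a'.
Hypothesis ext_ind : forall D : E -> Prop, D 1 -> (forall x, D x -> D (x * t)) ->
  (forall x, D x -> D (x * a)) -> forall x, D x.

Definition fibre_mul_fun (u : ty -> K) (x : K * ty) : K * ty := (x.1 * u x.2, x.2).

Lemma fibre_mul_funK u :
  cancel (fibre_mul_fun u) (fibre_mul_fun (fun i => (u i)^-1)).
Proof. by move=> [x i]; rewrite /fibre_mul_fun /= mulgK. Qed.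

Lemma fibre_mul_funVK u :
  cancel (fibre_mul_fun (fun i => (u i)^-1)) (fibre_mul_fun u).
Proof. by move=> [x i]; rewrite /fibre_mul_fun /= mulgVK. Qed.

Definition fibre_mul u : symgrp (K * ty) := Symgrp (fibre_mul_funK u) (fibre_mul_funVK u).

Definition fibre_shift_fun (x : K * ty) : K * ty := (x.1, ty_next x.2).
Definition fibre_unshift_fun (x : K * ty) : K * ty := (x.1, ty_next (ty_next x.2)).

Lemma fibre_shift_funK : cancel fibre_shift_fun fibre_unshift_fun.
Proof. by move=> [x []]. Qed.

Lemma fibre_shift_funVK : cancel fibre_unshift_fun fibre_shift_fun.
Proof. by move=> [x []]. Qed.

Definition fibre_shift : symgrp (K * ty) := Symgrp fibre_shift_funK fibre_shift_funVK.

Lemma fibre_mulM u v : fibre_mul u * fibre_mul v = fibre_mul (fun i => u i * v i).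
Proof. by apply: symgrpP => -[x i]; rewrite symgrpM /= /fibre_mul_fun /= mulgA. Qed.

Lemma fibre_mulV u : (fibre_mul u)^-1 = fibre_mul (fun i => (u i)^-1).
Proof. by apply: symgrpP => -[x i]. Qed.

Lemma fibre_mulR u v : [~ fibre_mul u, fibre_mul v] = fibre_mul (fun i => [~ u i, v i]).
Proof. by rewrite !commgEl !conjgE !fibre_mulV !fibre_mulM. Qed.

Lemma fibre_mul_eq1 u : (forall i, u i = 1) -> fibre_mul u = 1.
Proof. by move=> u1; apply: symgrpP => -[x i]; rewrite /= /fibre_mul_fun u1 mulg1. Qed.

Lemma fibre_mulX u n : fibre_mul u ^+ n = fibre_mul (fun i => u i ^+ n).
Proof.
elim: n => [|n IH]; first by symmetry; exact: fibre_mul_eq1.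
by rewrite expgS IH fibre_mulM; congr fibre_mul; apply: funext => i; rewrite expgS.
Qed.

Lemma fibre_shiftJ u :
  fibre_shift * fibre_mul u * fibre_shift^-1 = fibre_mul (fun i => u (ty_next i)).
Proof. by apply: symgrpP => -[x i]; case: i. Qed.

Lemma ext_action : exists theta : UMagmaMorphism.type E (symgrp (K * ty)),
  theta t = fibre_shift /\ theta a = fibre_mul g.
Proof.
apply: ext_univ.
- by apply: symgrpP => -[x []].
- by rewrite fibre_mulX; apply: fibre_mul_eq1 => i; exact: (tg_order tg).
- rewrite conjgE invgK mulgA fibre_shiftJ.
  have rel i : B2 (g i) (g (ty_next i)).
    by have := tg_rel tg (ty_next (ty_next i)); case: i.
  by split; rewrite !fibre_mulR; apply: fibre_mul_eq1 => i; case: (rel i).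
Qed.

Definition ext_gen (i : ty) : E :=
  match i with T0 => a | T1 => a ^ t^-1 | T2 => (a ^ t^-1) ^ t^-1 end.

Lemma ext_gen_next i : ext_gen (ty_next i) = ext_gen i ^ t^-1.
Proof.
have tV3 : t^-1 * (t^-1 * t^-1) = 1 by rewrite -(expgS t^-1 2) expVgn t3 invg1.
by case: i => //=; rewrite -!conjgM tV3 conjg1.
Qed.

Lemma B2J (G : groupType) (x y z : G) : B2 x y -> B2 (x ^ z) (y ^ z).
Proof. by move=> [e1 e2 e3]; split; rewrite -!conjRg ?e1 ?e2 ?e3 conj1g. Qed.

Lemma ext_gen_order i : ext_gen i ^+ p = 1.
Proof. by case: i => /=; rewrite -?conjXg ap ?conj1g. Qed.

Lemma ext_gen_rel i : B2 (ext_gen (ty_next i)) (ext_gen (ty_next (ty_next i))).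
Proof.
have B0 : B2 (ext_gen T0) (ext_gen T1) by [].
case: i => /=; last exact: B0.
  by have := B2J t^-1 B0; rewrite -!ext_gen_next.
by have := B2J t^-1 (B2J t^-1 B0); rewrite -!ext_gen_next.
Qed.

Lemma ext_hom : exists psi : UMagmaMorphism.type K E, forall i, psi (g i) = ext_gen i.
Proof. by apply: (tg_hom tg) => i; [exact: ext_gen_order | exact: ext_gen_rel]. Qed.

(** Addition in Z/3: [ext_gen i] multiplies the fibre over [l] by [g (rot i l)]. *)
Definition rot i l :=
  match i with T0 => l | T1 => ty_next l | T2 => ty_next (ty_next l) end.

Lemma rot_inj l i i' : i != i' -> rot i l != rot i' l.
Proof. by case: i; case: i'; case: l. Qed.

Lemma rot_surj l i : exists i', rot i' l = i.
Proof.
by case: l; case: i; by [exists T0|exists T1|exists T2].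
Qed.

Local Notation VG := (vertex_group g).
Variables (psi : UMagmaMorphism.type K E) (theta : UMagmaMorphism.type E (symgrp (K * ty))).
Hypothesis psi_gen : forall i, psi (g i) = ext_gen i.
Hypotheses (theta_t : theta t = fibre_shift) (theta_a : theta a = fibre_mul g).

Lemma theta_gen i x l : theta (ext_gen i) (x, l) = (x * g (rot i l), l).
Proof.
suff -> : theta (ext_gen i) = fibre_mul (fun l => g (rot i l)) by [].
have shJ u : fibre_mul u ^ fibre_shift^-1 = fibre_mul (fun i => u (ty_next i)).
  by rewrite -fibre_shiftJ conjgE invgK mulgA.
by case: i => /=; rewrite ?gmulfJ ?gmulfV /= theta_a ?theta_t ?shJ.
Qed.

Lemma theta_psi i x l : VG i x ->
  exists2 x', VG (rot i l) x' & forall z, theta (psi x) (z, l) = (z * x', l).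
Proof.
elim=> [|m y mi _ [x' Xx' e]].
  by exists 1; [exact: vertex_group1|move=> z; rewrite !gmulf1 mulg1].
exists (x' * g (rot m l)); first by apply: vertex_groupMg => //; exact: rot_inj.
by move=> z; rewrite !gmulfM symgrpM e psi_gen theta_gen mulgA.
Qed.

Lemma theta_psi_inv i x' l : VG i x' -> exists i' x, VG i' x /\
  forall z, theta (psi x) (z, l) = (z * x', l).
Proof.
have [i' ei] := rot_surj l i; move=> Xx'; exists i'.
elim: Xx' => [|m y mi _ [x [Xx e]]].
  by exists 1; split; [exact: vertex_group1|move=> z; rewrite !gmulf1 mulg1].
have [m' em] := rot_surj l m.
exists (x * g m'); split.
  by apply: vertex_groupMg => //; apply: contra_neq mi => mi; rewrite -em mi ei.
by move=> z; rewrite !gmulfM symgrpM e psi_gen theta_gen mulgA em.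
Qed.

(** It recovers [x] from [psi x * t ^+ n] ([ext_proj_psi]). Hence [psi] is injective, and the fibres
    are cosets of the powers of [t]. *)
Definition ext_proj (y : E) : K := (theta y (1, T0)).1.

Lemma theta_proj y : exists l, theta y (1, T0) = (ext_proj y, l).
Proof. by exists (theta y (1, T0)).2; rewrite /ext_proj; case: (theta y _). Qed.

Lemma theta_tX n x l : exists l', theta (t ^+ n) (x, l) = (x, l').
Proof.
elim: n l => [|n IH] l; first by exists l; rewrite gmulf1.
by have [l' e] := IH (ty_next l); exists l'; rewrite expgS gmulfM symgrpM theta_t.
Qed.

Lemma ext_proj_psi x n : ext_proj (psi x * t ^+ n) = x.
Proof.
have -> : ext_proj (psi x * t ^+ n) = (theta (psi x) (1, T0)).1.
  rewrite /ext_proj gmulfM symgrpM; case: (theta (psi x) _) => y l.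
  by have [l' ->] := theta_tX n y l.
suff -> : theta (psi x) (1, T0) = (x, T0) by [].
move: x; apply: (tg_ind tg) => [|x i e]; first by rewrite !gmulf1.
by rewrite !gmulfM symgrpM e psi_gen theta_gen; case: (i).
Qed.

Lemma t_psi x : exists x', t * psi x = psi x' * t.
Proof.
move: x; apply: (tg_ind tg) => [|x i [x' e]].
  by exists 1; rewrite !gmulf1 mulg1 mul1g.
exists (x' * g (ty_next i)).
rewrite !gmulfM mulgA e !psi_gen ext_gen_next conjgE invgK -!mulgA mulVg mulg1 //.
Qed.

Lemma tX_psi n x : exists x', t ^+ n * psi x = psi x' * t ^+ n.
Proof.
elim: n x => [|n IH] x; first by exists x; rewrite mulg1 mul1g.
have [x1 e1] := t_psi x; have [x2 e2] := IH x1; exists x2.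
by rewrite !expgSr -!mulgA e1 mulgA e2 -mulgA.
Qed.

Lemma t_inv : t^-1 = t ^+ 2.
Proof.
by apply: (mulgI t); rewrite mulgV -expgS t3.
Qed.

Lemma ext_decomp y : exists x n, y = psi x * t ^+ n.
Proof.
have cl x n x1 n1 : exists x2 n2, psi x * t ^+ n * (psi x1 * t ^+ n1) = psi x2 * t ^+ n2.
  have [x2 e] := tX_psi n x1; exists (x * x2), (n + n1)%N.
  by rewrite gmulfM expgnDr -!mulgA (mulgA (t ^+ n)) e -!mulgA.
move: y; apply: ext_ind.
- by exists 1, 0%N; rewrite gmulf1 mulg1.
- by move=> _ [x [n ->]]; exists x, n.+1; rewrite -mulgA expgSr.
- move=> _ [x [n ->]]; have := cl x n (g T0) 0%N.
  by rewrite psi_gen mulg1.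
Qed.

Lemma ext_proj_eq y y' : ext_proj y = ext_proj y' -> exists n, y^-1 * y' = t ^+ n.
Proof.
have [x [n ->]] := ext_decomp y; have [x' [n' ->]] := ext_decomp y'.
rewrite !ext_proj_psi => ->; exists (2 * n + n')%N.
by rewrite invgM -mulgA mulKg -expVgn t_inv -expgnA -expgnDr.
Qed.

Lemma t_norm (S : seq E) (genS : generates S) n : t \in S -> word_norm genS (t ^+ n) <= 1.
Proof.
move=> tS; rewrite (divn_eq n 3) expgnDr mulnC expgnA t3 expg1n mul1g.
have n1 : word_norm genS t <= 1.
  apply: word_norm_le; exists [:: t]; rewrite big_seq1; split=> // x.
  by rewrite inE => /eqP ->; rewrite mem_cat tS.
have : n %% 3 < 3 by rewrite ltn_mod.
case: (n %% 3) => [|[|[|//]]] _; first by rewrite word_norm1.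
  by rewrite expg1.
by rewrite -t_inv word_normV.
Qed.

Variables (S : seq K) (genS : generates S).
Hypothesis SX : forall x, x \in S <-> exists i, VG i x.

Definition ext_S : seq E := t :: map psi S.

Lemma ext_S_letter u : u \in ext_S ++ [seq s^-1 | s <- ext_S] ->
  (u = t \/ u = t^-1) \/ exists2 x, u = psi x & exists i, VG i x.
Proof.
rewrite mem_cat => /orP[|/mapP[{}u + ->]]; rewrite inE => /orP[/eqP ->|/mapP[x xS ->]];
  [by left; left| |by left; right|]; right.
  by exists x => //; exact/SX.
exists x^-1; first by rewrite gmulfV.
by have [i Xx] := (SX x).1 xS; exists i; exact: (vertex_groupV p_pr tg).
Qed.

Lemma genS_letter i x : VG i x -> x \in S.
Proof. by move=> Xx; apply/SX; exists i. Qed.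

Lemma S_norm i x : VG i x -> word_norm genS x <= 1.
Proof.
move=> /genS_letter xS; apply: word_norm_le; exists [:: x].
by rewrite big_seq1; split=> // y; rewrite inE => /eqP ->; rewrite mem_cat xS.
Qed.

Lemma ext_generates : generates ext_S.
Proof.
have step u : u \in ext_S -> forall x, (exists n, `[< word_of_length ext_S x n >]) ->
    exists n, `[< word_of_length ext_S (x * u) n >].
  move=> uS x [n /asboolP xn]; exists (n + 1)%N; apply/asboolP.
  apply: word_of_length_cat xn _; exists [:: u]; rewrite big_seq1; split=> // y.
  by rewrite inE => /eqP ->; rewrite mem_cat uS.
apply: ext_ind; first by exists 0%N; apply/asboolP; exists [::]; rewrite big_nil.
  by apply: step; rewrite inE eqxx.
apply: step; rewrite inE; apply/orP; right; apply/mapP; exists (g T0).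
  by apply: (@genS_letter T1); apply: vertex_group_gen.
by rewrite psi_gen.
Qed.

Lemma ext_proj_step x u : u \in ext_S ++ [seq s^-1 | s <- ext_S] ->
  word_norm genS ((ext_proj x)^-1 * ext_proj (x * u)) <= 1.
Proof.
have [l el] := theta_proj x.
have projE u' : ext_proj (x * u') = (theta u' (ext_proj x, l)).1.
  by rewrite {1}/ext_proj gmulfM symgrpM el.
move=> /ext_S_letter[[->|->]|[y -> [i Xy]]]; rewrite projE.
- by rewrite theta_t /= mulVg word_norm1.
- have [l' e] := theta_tX 2 (ext_proj x) l.
  by rewrite t_inv e mulVg word_norm1.
- have [y' Xy' ->] := theta_psi l Xy.
  by rewrite mulKg; exact: S_norm Xy'.
Qed.

Lemma ext_proj_lower (genE : generates ext_S) x y :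
  word_norm genS ((ext_proj x)^-1 * ext_proj y) <= word_norm genE (x^-1 * y).
Proof.
have [w [sw Sw pw]] := word_norm_word genE (x^-1 * y).
have -> : y = x * \prod_(s <- w) s by rewrite pw mulVKg.
rewrite mulKg {2}pw -sw; elim: w x Sw {sw pw} => [|u w IH] x Sw.
  by rewrite big_nil mulg1 mulVg word_norm1.
rewrite big_cons mulgA /=.
rewrite (_ : (ext_proj x)^-1 * _ = ((ext_proj x)^-1 * ext_proj (x * u)) *
  ((ext_proj (x * u))^-1 * ext_proj (x * u * \prod_(s <- w) s))); last by rewrite mulgA mulgK.
apply: leq_trans (word_normM _ _ _) _; rewrite -add1n; apply: leq_add.
  by apply: ext_proj_step; apply: Sw; rewrite inE eqxx.
by apply: IH => v vw; apply: Sw; rewrite inE vw orbT.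
Qed.

(** The letter lifting [u] depends on the fibre reached so far: the vertex group has to be rotated
    back, by [theta_psi_inv]. *)
Lemma ext_lift (genE : generates ext_S) w x :
  {subset w <= S ++ [seq s^-1 | s <- S]} ->
  exists2 x', ext_proj (x * x') = ext_proj x * \prod_(s <- w) s &
    word_norm genE x' <= size w.
Proof.
elim: w x => [|u w IH] x Sw.
  by exists 1; rewrite ?big_nil ?mulg1 ?word_norm1.
have [i Xu] : exists i, VG i u.
  have : u \in S ++ [seq s^-1 | s <- S] by apply: Sw; rewrite inE eqxx.
  rewrite mem_cat => /orP[/SX//|/mapP[v /SX[i Xv] ->]].
  by exists i; exact: (vertex_groupV p_pr tg).
have [l el] := theta_proj x.
have [i' [v [Xv ev]]] := theta_psi_inv l Xu.
have [|x' ex' nx'] := IH (x * psi v); first by move=> s sw; apply: Sw; rewrite inE sw orbT.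
have exv : ext_proj (x * psi v) = ext_proj x * u.
  by rewrite {1}/ext_proj gmulfM symgrpM el ev.
exists (psi v * x'); first by rewrite mulgA ex' exv big_cons mulgA.
apply: leq_trans (word_normM _ _ _) _; rewrite /= -add1n; apply: leq_add nx'.
apply: word_norm_le; exists [:: psi v]; rewrite big_seq1; split=> // s.
rewrite inE => /eqP ->; rewrite mem_cat inE; apply/orP; left; apply/orP; right.
by apply: map_f; exact: genS_letter Xv.
Qed.

(** The additional 1 is a final power of [t], a single letter since [t^-1 = t ^+ 2]. *)
Lemma ext_proj_upper (genE : generates ext_S) x y :
  word_norm genE (x^-1 * y) <= word_norm genS ((ext_proj x)^-1 * ext_proj y) + 1.
Proof.
have [w [sw Sw pw]] := word_norm_word genS ((ext_proj x)^-1 * ext_proj y).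
have [x' ex' nx'] := ext_lift genE x Sw.
have [n en] : exists n, (x * x')^-1 * y = t ^+ n.
  by apply: ext_proj_eq; rewrite ex' pw mulVKg.
rewrite (_ : x^-1 * y = x' * ((x * x')^-1 * y)); last first.
  by rewrite invgM -!mulgA mulVKg.
apply: leq_trans (word_normM _ _ _) _; rewrite -sw; apply: leq_add => //.
by rewrite en; apply: t_norm; rewrite inE eqxx.
Qed.

End Extension.

Section ExtensionResults.
Variables (p : nat) (p_pr : prime p) (p_odd : odd p).
Variables (K : groupType) (g : ty -> K).
Hypothesis tg : triangle_group p ty_next (fun i => ty_next (ty_next i)) xpredT g.
Variables (E : groupType) (t a : E).
Hypothesis t3 : t ^+ 3 = 1.
Hypothesis ap : a ^+ p = 1.
Hypothesis Bab : B2 a (a ^ t^-1).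
Hypothesis ext_univ : forall (H : groupType) (t' a' : H), t' ^+ 3 = 1 ->
  a' ^+ p = 1 -> B2 a' (a' ^ t'^-1) ->
  exists theta : UMagmaMorphism.type E H, theta t = t' /\ theta a = a'.
Hypothesis ext_ind : forall D : E -> Prop, D 1 -> (forall x, D x -> D (x * t)) ->
  (forall x, D x -> D (x * a)) -> forall x, D x.

Lemma extension_hyperbolic (R : realType) : hyperbolic_group R E.
Proof.
have [psi psiE] := ext_hom tg t3 ap Bab.
have [theta [tht tha]] := ext_action tg ext_univ.
have [S [genS [SX H]]] := triangle_group_hyperbolic p_pr p_odd tg (s := T0) erefl.
have genE := ext_generates ext_ind psiE SX.
exists (ext_S t psi S), genE; apply: gromov_hyperbolic_norm.
apply: (hyperbolic_transfer (phi := ext_proj theta) _ _ _ H (c := 1%N)).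
- by rewrite /ext_proj gmulf1.
- move=> x y; exact: (ext_proj_lower p_pr tg t3 psiE tht tha genS SX).
- move=> x y; exact: (ext_proj_upper p_pr tg t3 ext_ind psiE tht tha genS SX).
Qed.

Lemma extension_infinite : infinite_group E.
Proof.
have [psi psiE] := ext_hom tg t3 ap Bab.
have [theta [tht tha]] := ext_action tg ext_univ.
have infK := infinite_triangle p_pr p_odd tg => finE; apply: infK.
apply: (@finite_preimage K E setT psi) => // x y _ _ e.
have := ext_proj_psi tg psiE tht tha x 0; rewrite e.
by rewrite (ext_proj_psi tg psiE tht tha y 0).
Qed.

End ExtensionResults.

(** * The presentation of the extension *)

Section ExtensionPresentation.
Variables (p : nat) (p_pr : prime p).
Local Notation E := (HBC2_ext_group p).

Definition ext_t : E := pgen _ (inord 0 : 'I_3).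
Definition ext_a : E := pgen _ (inord 1 : 'I_3).

Lemma ext_rels : [/\ ext_t ^+ 3 = 1, ext_a ^+ p = 1,
  pgen _ (inord 2 : 'I_3) = ext_a ^ ext_t^-1 :> E & B2 ext_a (ext_a ^ ext_t^-1)].
Proof.
have rel r : r \in _ -> (pclass _ r : E) = 1 := @pclass_rel _ _ r.
have eb : pgen _ (inord 2 : 'I_3) = ext_a ^ ext_t^-1 :> E.
  symmetry; rewrite conjgE invgK mulgA; apply/divg1_eq.
  rewrite /ext_t /ext_a /pgen -!gmulfV -!gmulfM.
  by apply: rel; rewrite !inE eqxx ?orbT.
split=> //.
- by rewrite /ext_t /pgen -gmulfXn; apply: rel; rewrite !inE eqxx.
- by rewrite /ext_a /pgen -gmulfXn; apply: rel; rewrite !inE eqxx ?orbT.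
- by split; rewrite -eb /ext_a /pgen -!gmulfR; apply: rel; rewrite !inE eqxx ?orbT.
Qed.

(** The third generator is eliminated through its relator, which makes it the conjugate of [a'] by
    [t'^-1]. *)
Lemma ext_univ (H : groupType) (t' a' : H) : t' ^+ 3 = 1 -> a' ^+ p = 1 ->
  B2 a' (a' ^ t'^-1) ->
  exists theta : UMagmaMorphism.type E H, theta ext_t = t' /\ theta ext_a = a'.
Proof.
move=> t3 ap [e1 e2 e3].
pose f (x : 'I_3) : H := match nat_of_ord x with 0 => t' | 1 => a' | _ => a' ^ t'^-1 end.
have [F Ff|theta thetaE] := @presented_hom _ _ _ f : _ -> exists theta : UMagmaMorphism.type E _, _.
  rewrite all_relsE /= !gmulfXn !gmulfR !gmulfM !gmulfV /= !Ff /f !inordK //.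
  by rewrite e1 e2 e3 t3 ap conjgE invgK !mulgA mulgV.
by exists theta; rewrite !thetaE /f !inordK.
Qed.

Lemma ext_ind (D : E -> Prop) : D 1 -> (forall x, D x -> D (x * ext_t)) ->
  (forall x, D x -> D (x * ext_a)) -> forall x, D x.
Proof.
move=> D1 Dt Da; have [t3 ap eb _] := ext_rels.
have DX u n : (forall x, D x -> D (x * u)) -> forall x, D x -> D (x * u ^+ n).
  move=> Du x Dx; elim: n => [|n IH]; first by rewrite mulg1.
  by rewrite expgSr mulgA; exact: Du.
have DtV x : D x -> D (x * ext_t^-1).
  have -> : ext_t^-1 = ext_t ^+ 2 by apply: (mulgI ext_t); rewrite mulgV -expgS t3.
  exact: DX.
have DaV x : D x -> D (x * ext_a^-1).
  have -> : ext_a^-1 = ext_a ^+ p.-1.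
    by apply: (mulgI ext_a); rewrite mulgV -expgS prednK ?prime_gt0.
  exact: DX.
apply: presented_ind => // x y Dx; have [i <-] := letter_surj y; case: i => //=.
- exact: Dt.
- exact: Da.
- by rewrite eb conjgE invgK !mulgA; apply: DtV; apply: Da; exact: Dt.
- exact: DtV.
- exact: DaV.
- rewrite eb -conjVg conjgE invgK !mulgA; apply: DtV; apply: DaV; exact: Dt.
Qed.

End ExtensionPresentation.

Lemma infinite_hyperbolic (R : realType) (p : nat) : prime p -> odd p ->
  [/\ infinite_group (HC2_group p) /\ hyperbolic_group R (HC2_group p),
      infinite_group (HB2_group p) /\ hyperbolic_group R (HB2_group p) &
      infinite_group (HBC2_ext_group p) /\ hyperbolic_group R (HBC2_ext_group p)].
Proof.
move=> p_pr p_odd; split.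
- have tg := HC2_triangle p_pr; split; first exact: infinite_triangle tg.
  exact: (triangle_hyperbolic_group p_pr p_odd tg (s := T1)).
- have tg := HB2_triangle p_pr; split; first exact: infinite_triangle tg.
  exact: (triangle_hyperbolic_group p_pr p_odd tg (s := T0)).
- have tg := HBC2_triangle p_pr; have [t3 ap _ Bab] := ext_rels p.
  split; first exact: (extension_infinite p_pr p_odd tg t3 ap Bab (@ext_univ p)).
  exact: (extension_hyperbolic p_pr p_odd tg t3 ap Bab (@ext_univ p) (ext_ind p_pr)).
Qed.

Local Close Scope group_scope.
Local Close Scope classical_set_scope.
Local Open Scope ring_scope.

(** * Angles between fixed spaces *)

Lemma power_lt (R : realType) (r e : R) : 0 <= r -> r < 1 -> 0 < e ->
  exists N, forall n, (N <= n)%N -> r ^+ n < e.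
Proof.
move=> r0 r1 e0; have := @cvg_expr R r; rewrite ger0_norm // => /(_ r1).
move=> /cvgrPdist_lt /(_ _ e0) [N _ NP]; exists N => n Nn.
by have := NP n Nn; rewrite /= sub0r normrN ger0_norm // exprn_ge0.
Qed.

Section InnerProduct.
Variables (R : realType) (V : lmodType R) (ip : V -> V -> R).
Hypothesis ipC : forall x y, ip x y = ip y x.
Hypothesis ipDl : forall x y z, ip (x + y) z = ip x z + ip y z.
Hypothesis ipZl : forall a x y, ip (a *: x) y = a * ip x y.
Hypothesis ip_ge0 : forall x, 0 <= ip x x.
Hypothesis ip_eq0 : forall x, ip x x = 0 -> x = 0.

Lemma ipDr x y z : ip x (y + z) = ip x y + ip x z.
Proof. by rewrite ipC ipDl !(ipC _ x). Qed.

Lemma ipZr a x y : ip x (a *: y) = a * ip x y.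
Proof. by rewrite ipC ipZl ipC. Qed.

Lemma ip0l y : ip 0 y = 0.
Proof. by rewrite -(scale0r 0) ipZl mul0r. Qed.

Lemma ip0r y : ip y 0 = 0.
Proof. by rewrite ipC ip0l. Qed.

Lemma ipNl x y : ip (- x) y = - ip x y.
Proof. by rewrite -scaleN1r ipZl mulN1r. Qed.

Lemma ipNr x y : ip x (- y) = - ip x y.
Proof. by rewrite ipC ipNl ipC. Qed.

Lemma ipBl x y z : ip (x - y) z = ip x z - ip y z.
Proof. by rewrite ipDl ipNl. Qed.

Lemma ipBr x y z : ip x (y - z) = ip x y - ip x z.
Proof. by rewrite ipDr ipNr. Qed.

Lemma ip_suml I (r : seq I) (P : pred I) (F : I -> V) y :
  ip (\sum_(i <- r | P i) F i) y = \sum_(i <- r | P i) ip (F i) y.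
Proof. by elim/big_rec2: _ => [|i a b _ <-]; rewrite ?ip0l ?ipDl. Qed.

Lemma ip_sumr I (r : seq I) (P : pred I) (F : I -> V) y :
  ip y (\sum_(i <- r | P i) F i) = \sum_(i <- r | P i) ip y (F i).
Proof. by rewrite ipC ip_suml; apply: eq_bigr => i _; rewrite ipC. Qed.

Definition sqn x := ip x x.

Lemma sqnB x y : sqn (x - y) = sqn x - 2 * ip x y + sqn y.
Proof. by rewrite /sqn ipBl !ipBr (ipC y x); ring. Qed.

Lemma sqnD x y : sqn (x + y) = sqn x + 2 * ip x y + sqn y.
Proof. by rewrite /sqn ipDl !ipDr (ipC y x); ring. Qed.

Lemma sqnZ a x : sqn (a *: x) = a ^+ 2 * sqn x.
Proof. by rewrite /sqn ipZl ipZr mulrA expr2. Qed.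

Lemma cauchy_schwarz x y : ip x y ^+ 2 <= sqn x * sqn y.
Proof.
have [x0|x0] := eqVneq (sqn x) 0.
  suff -> : ip x y = 0 by rewrite expr0n mulr_ge0 // ip_ge0.
  apply/eqP/negPn/negP => xy0.
  (* With this coefficient the square norm would be -1. *)
  have := ip_ge0 ((sqn y + 1) / (- 2 * ip x y) *: x + y).
  rewrite -/(sqn _) sqnD sqnZ x0 mulr0 add0r ipZl leNgt => /negP; apply.
  have -> : 2 * ((sqn y + 1) / (- 2 * ip x y) * ip x y) = - (sqn y + 1).
    by field.
  by lra.
have x1 : 0 < sqn x by rewrite lt_def x0 ip_ge0.
have := ip_ge0 (sqn x *: y - ip x y *: x); rewrite -/(sqn _) sqnB !sqnZ ipZl ipZr.
rewrite (ipC y) => h.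
have : 0 <= sqn x * (sqn x * sqn y - ip x y ^+ 2).
  by move: h; congr (_ <= _); ring.
by rewrite pmulr_rge0 // subr_ge0.
Qed.

Definition nrm x := Num.sqrt (sqn x).

Lemma nrm_ge0 x : 0 <= nrm x. Proof. exact: sqrtr_ge0. Qed.

Lemma sqr_nrm x : nrm x ^+ 2 = sqn x.
Proof. by rewrite sqr_sqrtr // ip_ge0. Qed.

Lemma nrm_eq0 x : nrm x = 0 -> x = 0.
Proof. by move=> x0; apply: ip_eq0; rewrite -/(sqn x) -sqr_nrm x0 expr0n. Qed.

Lemma ip_le_nrm x y : `|ip x y| <= nrm x * nrm y.
Proof.
rewrite -(ler_pXn2r (n := 2)) ?nnegrE ?mulr_ge0 ?nrm_ge0 //.
by rewrite real_normK ?num_real // exprMn !sqr_nrm cauchy_schwarz.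
Qed.

Lemma nrmD x y : nrm (x + y) <= nrm x + nrm y.
Proof.
rewrite -(ler_pXn2r (n := 2)) ?nnegrE ?addr_ge0 ?nrm_ge0 //.
rewrite sqr_nrm sqnD sqrrD !sqr_nrm.
have := le_trans (ler_norm _) (ip_le_nrm x y); lra.
Qed.

Lemma nrmN x : nrm (- x) = nrm x.
Proof. by rewrite /nrm /sqn ipNl ipNr opprK. Qed.

Lemma nrmZ a x : nrm (a *: x) = `|a| * nrm x.
Proof. by rewrite /nrm sqnZ sqrtrM ?sqr_ge0 // sqrtr_sqr. Qed.

Definition ip_complete := forall u : nat -> V,
  (forall e, 0 < e -> exists N, forall m n, (N <= m)%N -> (N <= n)%N ->
    nrm (u m - u n) < e) ->
  exists y, forall e, 0 < e -> exists N, forall n, (N <= n)%N -> nrm (u n - y) < e.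

(** With [C = c / (1 - r)] the bound on a step is [C * r ^+ n - C * r ^+ n.+1], so the tails
    telescope. *)
Lemma geometric_limit (u : nat -> V) c r : ip_complete -> 0 <= c -> 0 <= r < 1 ->
  (forall n, nrm (u n - u n.+1) <= c * r ^+ n) ->
  exists y, forall n, nrm (u n - y) <= c / (1 - r) * r ^+ n.
Proof.
move=> compl c0 /andP[r0 r1] ustep; have r1' : 0 < 1 - r by rewrite subr_gt0.
set C := c / (1 - r); have C0 : 0 <= C by rewrite divr_ge0 // ltW.
have cE : c = C * (1 - r) by rewrite /C divfK // gt_eqF.
have tail n d : nrm (u n - u (n + d)%N) <= C * r ^+ n - C * r ^+ (n + d).
  elim: d => [|d IH]; first by rewrite addn0 !subrr /nrm /sqn ip0l sqrtr0.
  rewrite addnS -(subrK (u (n + d)%N) (u n)) -addrA; apply: le_trans (nrmD _ _) _.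
  have := ustep (n + d)%N; rewrite cE exprS; move: IH.
  set X := r ^+ (n + d); lra.
have dist n m : (n <= m)%N -> nrm (u n - u m) <= C * r ^+ n.
  move=> nm; have := tail n (m - n)%N; rewrite subnKC //.
  have : 0 <= C * r ^+ m by rewrite mulr_ge0 // exprn_ge0.
  lra.
have [y yP] : exists y, forall e, 0 < e -> exists N, forall n, (N <= n)%N -> nrm (u n - y) < e.
  apply: compl => e e0; have [N NP] := power_lt r0 r1 (divr_gt0 e0 (ltr_pwDr ltr01 C0)).
  have small n : (N <= n)%N -> C * r ^+ n < e.
    move=> Nn; have := NP n Nn; rewrite ltr_pdivlMr ?(ltr_pwDr ltr01 C0) //.
    have := exprn_ge0 n r0; nra.
  exists N => m n Nm Nn; have [mn|/ltnW nm] := leqP m n.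
    by apply: le_lt_trans (dist _ _ mn) (small _ Nm).
  by rewrite -nrmN opprB; apply: le_lt_trans (dist _ _ nm) (small _ Nn).
exists y => n; apply/ler_addgt0Pr => e e0; have [N NP] := yP e e0.
rewrite -(subrK (u (maxn N n)) (u n)) -addrA; apply: le_trans (nrmD _ _) _.
by apply: lerD; [apply: dist; exact: leq_maxr | apply/ltW/NP; exact: leq_maxl].
Qed.

(* Two orthogonal projections at angle at least [arccos eps] have complements
   with the same property: only the three vectors [x], [alpha], [beta] matter. *)
Lemma complement_angle eps x alpha beta : 0 <= eps -> eps < 1 ->
  ip alpha x = sqn alpha -> ip beta x = sqn beta ->
  ip alpha beta ^+ 2 <= eps ^+ 2 * sqn alpha * sqn beta ->
  - eps * nrm (x - alpha) * nrm (x - beta) <= ip (x - alpha) (x - beta).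
Proof.
move=> e0 e1 ea eb eab.
have nn : 0 <= nrm (x - alpha) * nrm (x - beta) by rewrite mulr_ge0 ?nrm_ge0.
have [a0|a0] := eqVneq (sqn alpha) 0.
  have xa : ip alpha beta = 0.
    by apply/eqP; rewrite -sqrf_eq0 eq_le sqr_ge0 andbT; move: eab; rewrite a0; lra.
  have -> : ip (x - alpha) (x - beta) = sqn (x - beta).
    by rewrite ipBl sqnB !ipBr ea a0 xa -/(sqn x) (ipC x) eb; ring.
  by apply: le_trans (ip_ge0 _); move: (mulr_ge0 e0 nn); lra.
have [b0|b0] := eqVneq (sqn beta) 0.
  have xb : ip alpha beta = 0.
    by apply/eqP; rewrite -sqrf_eq0 eq_le sqr_ge0 andbT; move: eab; rewrite b0; lra.
  have -> : ip (x - alpha) (x - beta) = sqn (x - alpha).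
    by rewrite ipBl sqnB !ipBr (ipC x beta) eb b0 ea xb -/(sqn x) (ipC x alpha) ea; ring.
  by apply: le_trans (ip_ge0 _); move: (mulr_ge0 e0 nn); lra.
have ap : 0 < sqn alpha by rewrite lt_def a0 ip_ge0.
have bp : 0 < sqn beta by rewrite lt_def b0 ip_ge0.
set r := nrm alpha; set s := nrm beta.
have rp : 0 < r by rewrite sqrtr_gt0.
have sp : 0 < s by rewrite sqrtr_gt0.
have er : sqn alpha = r ^+ 2 by rewrite sqr_nrm.
have es : sqn beta = s ^+ 2 by rewrite sqr_nrm.
pose c := ip alpha beta / (r * s).
have ec : ip alpha beta = c * r * s by rewrite /c; field; rewrite !gt_eqF.
have c2 : c ^+ 2 <= eps ^+ 2.
  have rs2 : 0 < (r * s) ^+ 2 by rewrite exprn_gt0 // mulr_gt0.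
  rewrite -(ler_pM2r rs2); move: eab; rewrite ec er es.
  by congr (_ <= _); ring.
have c1 : `|c| <= eps.
  by rewrite -(ler_pXn2r (n := 2)) ?nnegrE // real_normK ?num_real.
have d0 : 0 < 1 - c ^+ 2.
  have : eps ^+ 2 < 1 by rewrite expr_lt1.
  by lra.
(* [c] is the cosine between [alpha] and [beta], and [q] the square norm of the part of [x]
   orthogonal to both. The coefficients [l], [m] below give the projection of [x] onto their
   plane. *)
set X := sqn x; pose q := X - (r ^+ 2 + s ^+ 2 - 2 * c * r * s) / (1 - c ^+ 2).
have qE : X = q + (r ^+ 2 + s ^+ 2 - 2 * c * r * s) / (1 - c ^+ 2) by rewrite /q addrNK.
have q0 : 0 <= q.
  pose l := (1 - c * s / r) / (1 - c ^+ 2); pose m := (1 - c * r / s) / (1 - c ^+ 2).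
  have := ip_ge0 (x - (l *: alpha + m *: beta)).
  rewrite -/(sqn _) sqnB sqnD ipDr !ipZr !sqnZ ipZl (ipC x alpha) (ipC x beta).
  rewrite ea eb ec er es -/X; congr (_ <= _); rewrite /q /l /m; field.
  by rewrite !gt_eqF.
have eu : sqn (x - alpha) = q + (s - c * r) ^+ 2 / (1 - c ^+ 2).
  rewrite sqnB (ipC x alpha) ea er -/X qE; field; by rewrite gt_eqF.
have ev : sqn (x - beta) = q + (r - c * s) ^+ 2 / (1 - c ^+ 2).
  rewrite sqnB (ipC x beta) eb es -/X qE; field; by rewrite gt_eqF.
have euv : ip (x - alpha) (x - beta) = q - c * ((s - c * r) * (r - c * s) / (1 - c ^+ 2)).
  rewrite ipBl !ipBr (ipC x beta) ea eb ec er es -/(sqn x) -/X qE; field.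
  by rewrite gt_eqF.
(* [W] is, up to sign, the product of the lengths of the components of [x - alpha] and [x - beta] in
   that plane; they contribute [- c * W] to the inner product. *)
set W := (s - c * r) * (r - c * s) / (1 - c ^+ 2) in euv.
have Wle : `|W| <= nrm (x - alpha) * nrm (x - beta).
  rewrite -(ler_pXn2r (n := 2)) ?nnegrE // real_normK ?num_real //.
  rewrite [leRHS]exprMn !sqr_nrm eu ev.
  have -> : W ^+ 2 = ((s - c * r) ^+ 2 / (1 - c ^+ 2)) * ((r - c * s) ^+ 2 / (1 - c ^+ 2)).
    by rewrite /W; field; rewrite gt_eqF.
  by apply: ler_pM; rewrite ?divr_ge0 ?sqr_ge0 ?(ltW d0) // lerDr.
rewrite euv; have cW : `|c * W| <= eps * (nrm (x - alpha) * nrm (x - beta)).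
  by rewrite normrM ler_pM.
have := le_trans (ler_norm _) cW; lra.
Qed.

(** * Averages over cyclic groups *)

Section Representation.
Variables (G : groupType) (pi : G -> V -> V).
Hypothesis piD : forall g x y, pi g (x + y) = pi g x + pi g y.
Hypothesis piZ : forall g a x, pi g (a *: x) = a *: pi g x.
Hypothesis pi1 : forall x, pi 1%g x = x.
Hypothesis piM : forall g h x, pi (g * h)%g x = pi g (pi h x).
Hypothesis piU : forall g x y, ip (pi g x) (pi g y) = ip x y.

Lemma pi0 g : pi g 0 = 0.
Proof. by rewrite -(scale0r 0) piZ !scale0r. Qed.

Lemma piB g x y : pi g (x - y) = pi g x - pi g y.
Proof. by rewrite -scaleN1r piD piZ scaleN1r. Qed.

Lemma pi_sum g I (r : seq I) (P : pred I) (F : I -> V) :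
  pi g (\sum_(i <- r | P i) F i) = \sum_(i <- r | P i) pi g (F i).
Proof. by elim/big_rec2: _ => [|i a b _ <-]; rewrite ?pi0 ?piD. Qed.

Lemma piVK g x : pi g^-1%g (pi g x) = x.
Proof. by rewrite -piM mulVg pi1. Qed.

Lemma fixX g n y : pi g y = y -> pi (g ^+ n)%g y = y.
Proof. by move=> gy; elim: n => [|n IH]; rewrite ?expg0 ?pi1 // expgS piM IH. Qed.

Lemma fixM g h y : pi g y = y -> pi h y = y -> pi (g * h)%g y = y.
Proof. by move=> gy hy; rewrite piM hy gy. Qed.

Lemma fixV g y : pi g y = y -> pi g^-1%g y = y.
Proof. by move=> gy; rewrite -{1}gy piVK. Qed.

Lemma fix_comm g h y : commute g h -> pi g y = y -> pi g (pi h y) = pi h y.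
Proof. by move=> gh gy; rewrite -piM gh piM gy. Qed.

Variable p : nat.
Hypothesis p_gt0 : (0 < p)%N.

(** When [g ^+ p = 1] this is the orthogonal projection onto the vectors fixed by [g] ([avg_fix],
    [ip_avg]). *)
Definition avg g x : V := p%:R^-1 *: \sum_(i < p) pi (g ^+ i)%g x.

Lemma pR_neq0 : p%:R != 0 :> R.
Proof. by rewrite pnatr_eq0 -lt0n. Qed.

Lemma avg_eq g x y : (forall i, pi (g ^+ i)%g x = y) -> avg g x = y.
Proof.
move=> e; rewrite /avg (eq_bigr (fun=> y)) // sumr_const card_ord.
by rewrite -[y *+ p]scaler_nat scalerA mulVf ?scale1r // pR_neq0.
Qed.

Lemma avg_id g y : pi g y = y -> avg g y = y.
Proof. by move=> gy; apply: avg_eq => i; exact: fixX. Qed.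

Lemma avgD g x y : avg g (x + y) = avg g x + avg g y.
Proof.
rewrite /avg -scalerDr -big_split; congr (_ *: _); apply: eq_bigr => i _.
by rewrite piD.
Qed.

Lemma avgZ g a x : avg g (a *: x) = a *: avg g x.
Proof.
rewrite /avg scalerA mulrC -scalerA; congr (_ *: _).
by rewrite scaler_sumr; apply: eq_bigr => i _; rewrite piZ.
Qed.

Lemma avgB g x y : avg g (x - y) = avg g x - avg g y.
Proof. by rewrite -scaleN1r avgD avgZ scaleN1r. Qed.

Lemma avg0 g : avg g 0 = 0.
Proof. by rewrite -(scale0r 0) avgZ !scale0r. Qed.

Lemma pi_avg g h x : commute g h -> pi h (avg g x) = avg g (pi h x).
Proof.
move=> gh; rewrite /avg piZ pi_sum; congr (_ *: _); apply: eq_bigr => i _.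
by rewrite -!piM; congr (pi _ x); exact: commuteX.
Qed.

Lemma avg_sum g I (r : seq I) (P : pred I) (F : I -> V) :
  avg g (\sum_(i <- r | P i) F i) = \sum_(i <- r | P i) avg g (F i).
Proof. by elim/big_rec2: _ => [|i a b _ <-]; rewrite ?avg0 ?avgD. Qed.

Lemma avg_comm g h x : commute g h -> avg h (avg g x) = avg g (avg h x).
Proof.
move=> gh; transitivity (p%:R^-1 *: \sum_(i < p) avg g (pi (h ^+ i)%g x)).
  congr (_ *: _); apply: eq_bigr => i _; rewrite pi_avg //; exact: commuteX.
by rewrite -avg_sum -avgZ.
Qed.

Lemma nrm_sum I (r : seq I) (P : pred I) (F : I -> V) :
  nrm (\sum_(i <- r | P i) F i) <= \sum_(i <- r | P i) nrm (F i).
Proof.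
elim/big_rec2: _ => [|i a s _ IH]; first by rewrite /nrm /sqn ip0l sqrtr0.
by apply: le_trans (nrmD _ _) _; exact: lerD.
Qed.

Lemma dist_avg g x delta : (forall i, nrm (pi (g ^+ i)%g x - x) <= delta) ->
  nrm (x - avg g x) <= delta.
Proof.
move=> h; have -> : x - avg g x = p%:R^-1 *: \sum_(i < p) (x - pi (g ^+ i)%g x).
  rewrite sumrB sumr_const card_ord scalerBr -[x *+ p]scaler_nat.
 rewrite scalerA.
  by rewrite mulVf ?scale1r // pR_neq0.
rewrite nrmZ ger0_norm ?invr_ge0 // mulrC ler_pdivrMr; last by rewrite ltr0n.
apply: le_trans (nrm_sum _ _ _) _; apply: (@le_trans _ _ (\sum_(i < p) delta)).
  by apply: ler_sum => i _; rewrite -nrmN opprB.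
by rewrite sumr_const card_ord -[leLHS]mulr_natr.
Qed.

Section Order.
Variable g : G.
Hypothesis gp : (g ^+ p = 1)%g.

Lemma avg_fix x : pi g (avg g x) = avg g x.
Proof.
rewrite /avg piZ pi_sum; congr (_ *: _).
transitivity (\sum_(i < p) pi (g ^+ i.+1)%g x).
  by apply: eq_bigr => i _; rewrite expgS piM.
case: p p_gt0 gp => // n _ gn; rewrite big_ord_recr big_ord_recl /= gn addrC.
by rewrite expg0.
Qed.

Lemma avg_idem x : avg g (avg g x) = avg g x.
Proof. exact/avg_id/avg_fix. Qed.

Lemma ip_avg_fix x y : pi g y = y -> ip (avg g x) y = ip x y.
Proof.
move=> gy; rewrite /avg ipZl ip_suml (eq_bigr (fun=> ip x y)) => [|i _]; last first.
  by rewrite -{1}(fixX i gy) piU.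
rewrite sumr_const card_ord -[ip x y *+ p]mulr_natl mulrA mulVf ?mul1r //; exact: pR_neq0.
Qed.

Lemma ip_avg x y : ip (avg g x) y = ip x (avg g y).
Proof.
by rewrite ipC -(ip_avg_fix y (avg_fix x)) ipC ip_avg_fix //; exact: avg_fix.
Qed.

Lemma ip_avg_self x : ip (avg g x) x = sqn (avg g x).
Proof. by rewrite /sqn (ip_avg_fix x (avg_fix x)) ipC. Qed.

Lemma ip_compl_self x : ip (x - avg g x) x = sqn (x - avg g x).
Proof.
rewrite /sqn [RHS]ipBr (ipBl _ _ (avg g x)) -[ip (avg g x) (avg g x)]/(sqn _).
by rewrite -ip_avg_self (ipC x) subrr subr0.
Qed.

Lemma sqn_compl_le x : sqn (x - avg g x) <= sqn x.
Proof.
have e : sqn (x - avg g x) = sqn x - sqn (avg g x).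
  by rewrite -ip_compl_self ipBl ip_avg_self.
by rewrite e lerBlDr lerDl ip_ge0.
Qed.

Lemma sqn_avg_le x : sqn (avg g x) <= sqn x.
Proof.
have := ip_ge0 (x - avg g x); rewrite -/(sqn _) -ip_compl_self ipBl ip_avg_self.
by rewrite subr_ge0.
Qed.

Lemma sqn_avg x : sqn (avg g x) = p%:R^-1 * \sum_(i < p) ip x (pi (g ^+ i)%g x).
Proof. by rewrite -ip_avg_self ipC /avg ipZr ip_sumr. Qed.

Lemma avg_avg_orth x y : avg g x = 0 -> pi g y = y -> ip x y = 0.
Proof. by move=> gx gy; rewrite -ip_avg_fix // gx ip0l. Qed.

Lemma fix_root n y : coprime n p -> pi (g ^+ n)%g y = y -> pi g y = y.
Proof.
move=> cop gy; have [n0|n0] := posnP n.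
  move: cop; rewrite n0 /coprime gcd0n => /eqP p1.
  by have := gp; rewrite p1 expg1 => ->; rewrite pi1.
have [k l e _] := egcdnP p n0; have := fixX k gy.
rewrite -expgnA mulnC e expgnDr mulnC expgnA gp expg1n mul1g.
by rewrite (eqP cop) expg1.
Qed.

End Order.

Lemma bessel (I : finType) (P : pred I) (y : I -> V) v :
  (forall i, P i -> ip v (y i) = sqn (y i)) ->
  (forall i j, P i -> P j -> i != j -> ip (y i) (y j) = 0) ->
  \sum_(i | P i) sqn (y i) <= sqn v.
Proof.
move=> vy orth; have := ip_ge0 (v - \sum_(i | P i) y i).
rewrite -/(sqn _) sqnB ip_sumr (eq_bigr _ vy).
have -> : sqn (\sum_(i | P i) y i) = \sum_(i | P i) sqn (y i).
  rewrite {1}/sqn ip_suml; apply: eq_bigr => i Pi; rewrite ip_sumr (bigD1 i) //=.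
  rewrite big1 ?addr0 // => j /andP[Pj ji]; apply: orth => //.
  by rewrite eq_sym.
lra.
Qed.

(** * The angle at a vertex *)

Section Angle.
Variables (a c : G).
Hypotheses (p_pr : prime p) (p_odd : odd p).
Hypotheses (ap : (a ^+ p = 1)%g) (cp : (c ^+ p = 1)%g) (Bac : B2 a c).
Let d := [~ a, c]%g.
Let e := [~ a, c, c]%g.
Let dp : (d ^+ p = 1)%g := B2_dp ap Bac.
Let ep : (e ^+ p = 1)%g := B2_ep ap Bac.
Let da : commute d a := B2_dx Bac.
Let ea : commute e a := B2_ex Bac.
Let ec : commute e c := B2_ey Bac.
Let ed : commute e d := B2_ed Bac.

Definition dexp j t : G := (d ^+ j * e ^+ t)%g.

Lemma dexp_order j t : (dexp j t ^+ p = 1)%g.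
Proof.
rewrite expgMn; last exact/commute_sym/commuteX2.
by rewrite expgnAC dp expg1n expgnAC ep expg1n mulg1.
Qed.

Lemma dexp_a j t : commute (dexp j t) a.
Proof.
apply: commute_sym; apply: commuteM; apply: commuteX; exact: commute_sym.
Qed.

Lemma dexp_e j t : commute (dexp j t) e.
Proof. by apply: commute_sym; apply: commuteM; [apply: commuteX|exact/commuteX]. Qed.

Lemma dexp_comm j t j' t' : commute (dexp j t) (dexp j' t').
Proof.
apply: commuteM; apply: commute_sym; apply: commuteM;
  by [exact: commuteX2|exact/commute_sym/commuteX2].
Qed.

Lemma a_cX j : (a * c ^+ j = c ^+ j * a * dexp j 'C(j, 2))%g.
Proof.
have H : (a * c ^+ j = B2_elt a c j 1 j 'C(j, 2))%g.
  elim: j => [|j IH]; first by rewrite /B2_elt !expg0 expg1 !mulg1 mul1g.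
  by rewrite expgSr mulgA IH (B2_elt_y Bac) add1n binS bin1 addnC.
by rewrite H /B2_elt /dexp expg1 !mulgA.
Qed.

(** Applying [a] to both sides and moving it past [c ^+ j] inserts [f = dexp j 'C(j, 2)] before [w];
    iterating and averaging, only the [f]-fixed part of [w] counts. *)
Lemma ip_cX_dexp j v w : pi a v = v -> pi a w = w ->
  ip v (pi (c ^+ j)%g w) = ip v (pi (c ^+ j)%g (avg (dexp j 'C(j, 2)) w)).
Proof.
move=> av aw; set f := dexp _ _.
have fa : commute a f by exact/commute_sym/dexp_a.
have step u : pi a u = u -> ip v (pi (c ^+ j)%g u) = ip v (pi (c ^+ j)%g (pi f u)).
  move=> au; rewrite -(piU a) -piM av a_cX (piM (c ^+ j * a)%g) (piM (c ^+ j)%g).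
  by rewrite (fix_comm fa au).
have stepX m : ip v (pi (c ^+ j)%g w) = ip v (pi (c ^+ j)%g (pi (f ^+ m)%g w)).
  elim: m => [|m ->]; first by rewrite expg0 pi1.
  rewrite step ?expgS ?piM //.
  by apply: fix_comm => //; exact: commuteX.
rewrite /avg piZ pi_sum ipZr ip_sumr (eq_bigr _ (fun i _ => esym (stepX (nat_of_ord i)))).
rewrite sumr_const card_ord -[X in _ * X]mulr_natl mulrA mulVf ?mul1r //.
exact: pR_neq0.
Qed.

(** The exponent pairs are linearly independent over F_p, so a vector fixed by both elements is
    fixed by [e], and [v] has no such part. *)
Lemma dexp_orth v j l (t t' : nat) : avg e v = 0 ->
  (l * t)%:R != (j * t')%:R :> 'F_p ->
  ip (avg (dexp j t) v) (avg (dexp l t') v) = 0.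
Proof.
move=> ev lt; rewrite (ip_avg (dexp_order _ _)).
set u := avg (dexp j t) _.
have fj : pi (dexp j t) u = u by apply: avg_fix; exact: dexp_order.
have fl : pi (dexp l t') u = u.
  by rewrite /u pi_avg ?(avg_fix (dexp_order l t')) //; exact: dexp_comm.
have e1 : pi (e ^+ (l * t))%g u = pi (e ^+ (j * t'))%g u.
  have E1 := fixX l fj; have E2 := fixX j fl.
  rewrite expgMn in E1; last exact/commute_sym/commuteX2.
  rewrite expgMn in E2; last exact/commute_sym/commuteX2.
  rewrite -!expgnA piM in E1; rewrite -!expgnA piM in E2.
  rewrite (mulnC l j) in E2; rewrite (mulnC l) (mulnC j t').
  by rewrite -[LHS](piVK (d ^+ (j * l))%g) E1 -[RHS](piVK (d ^+ (j * l))%g) E2.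
have eu : pi e u = u.
  (* The factor [p.-1] represents -1, so the exponent is the determinant of the two pairs modulo
     [p]. *)
  apply: (fix_root ep (n := l * t + p.-1 * (j * t'))).
    rewrite coprime_sym prime_coprime //; apply: contra lt => dv.
    have pm1 : p.-1%:R = -1 :> 'F_p.
      by apply/eqP; rewrite -addr_eq0 -mulrSr prednK // pchar_Fp_0.
    move: dv; rewrite (dvdn_pcharf (pchar_Fp p_pr)) natrD (natrM _ p.-1) pm1 mulN1r.
    by rewrite subr_eq0.
  rewrite addnC expgnDr piM e1 -piM -expgnDr -mulSnr prednK //.
  by rewrite mulnC expgnA expgnAC ep expg1n pi1.
have -> : u = avg e u by rewrite avg_id.
rewrite /u (avg_comm _ (dexp_e _ _)) (avg_comm _ (dexp_e _ _)).
by rewrite ev !avg0 ip0r.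
Qed.

Lemma dexp_d j t : commute (dexp j t) d.
Proof.
apply: commute_sym; apply: commuteM; first exact/commuteX.
exact/commuteX/commute_sym.
Qed.

Lemma Fp_nat_neq0 j : (0 < j < p)%N -> j%:R != 0 :> 'F_p.
Proof.
by move=> /andP[j0 jp]; rewrite -(dvdn_pcharf (pchar_Fp p_pr)) gtnNdvd.
Qed.

Lemma Fp_nat_eq j l : (j < p)%N -> (l < p)%N -> j%:R = l%:R :> 'F_p -> j = l.
Proof.
move=> jp lp; wlog jl : j l jp lp / (j <= l)%N.
  move=> H e1; case: (leqP j l) => [|/ltnW] jl; first exact: H.
  by symmetry; apply: H.
move=> /eqP; rewrite eq_sym -subr_eq0 -natrB // => e1.
apply/eqP; rewrite eqn_leq jl -subn_eq0; apply: contraTT e1 => lj.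
by apply: Fp_nat_neq0; rewrite lt0n lj (leq_ltn_trans (leq_subr _ _)).
Qed.

Lemma avg_dexp_central j t v : (0 < j < p)%N -> pi e v = v -> avg d v = 0 ->
  avg (dexp j t) v = 0.
Proof.
move=> jp ev dv; set y := avg _ v.
have ey : pi e y = y by rewrite /y pi_avg ?ev //; exact: dexp_e.
have fy : pi (dexp j t) y = y by apply: avg_fix; exact: dexp_order.
have dy : pi d y = y.
  apply: (fix_root dp (n := j)); last by rewrite -{1}(fixX t ey) -piM.
  rewrite coprime_sym prime_coprime // gtnNdvd //; by case/andP: jp.
by rewrite -(avg_id dy) /y (avg_comm _ (dexp_d _ _)) dv avg0.
Qed.

Lemma sqn_avg_central v : pi a v = v -> pi e v = v -> avg d v = 0 ->
  sqn (avg c v) = p%:R^-1 * sqn v.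
Proof.
move=> av ev dv; rewrite (sqn_avg cp); congr (_ * _).
rewrite (bigD1 (Ordinal p_gt0)) //= expg0 pi1 big1 ?addr0 // => j j0.
rewrite ip_cX_dexp // avg_dexp_central ?pi0 ?ip0r //.
by rewrite ltn_ord lt0n j0.
Qed.

Lemma c_dexp m t : (c * dexp m t = dexp m (m * p.-1 + t) * c)%g.
Proof.
rewrite /dexp -[RHS]mulgA -(commuteX _ (commute_sym ec)) mulgA [RHS]mulgA.
rewrite (dXy Bac) expgnDr -!mulgA; congr (_ * _)%g; congr (_ * _)%g.
rewrite mulgA -expgnDr -mulnS prednK // mulnC expgnA ep expg1n mul1g //.
Qed.

Lemma cX_dexp j m t : (c ^+ j * dexp m t = dexp m (j * (m * p.-1) + t) * c ^+ j)%g.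
Proof.
elim: j => [|j IH]; first by rewrite expg0 mul1g mulg1.
by rewrite expgS -mulgA IH mulgA c_dexp -mulgA mulSn addnA.
Qed.

Lemma ip_le_half x y : ip x y <= 2^-1 * (sqn x + sqn y).
Proof. by have := ip_ge0 (x - y); rewrite -/(sqn _) sqnB; lra. Qed.

Lemma sqn_pi g x : sqn (pi g x) = sqn x.
Proof. exact: piU. Qed.

Lemma avg_dexp_bessel (t : nat -> nat) v : avg e v = 0 ->
  (forall j l : nat, (0 < j < p)%N -> (0 < l < p)%N -> j != l ->
     (l * t j)%:R != (j * t l)%:R :> 'F_p) ->
  \sum_(j < p | j != Ordinal p_gt0) sqn (avg (dexp j (t j)) v) <= sqn v.
Proof.
move=> ev ht; apply: bessel => [j j0|j l j0 l0 jl].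
  by rewrite ipC ip_avg_self //; exact: dexp_order.
by apply: dexp_orth => //; apply: ht; rewrite ?ltn_ord ?andbT ?lt0n.
Qed.

Lemma binF j : 'C(j, 2)%:R * 2%:R = j%:R * (j%:R - 1) :> 'F_p.
Proof. exact: bin2R. Qed.

(** The square norm is the mean of [ip v (pi (c ^+ j) v)]. For [j] nonzero, [v] may be replaced on
    the right by its [dexp j 'C(j, 2)]-fixed part and on the left by its [dexp j (s j)]-fixed part,
    the conjugate under [c ^+ j]. Both families of projections are orthogonal, the determinants
    being plus or minus j l (j - l) / 2, so by Bessel these terms add up to at most [sqn v], as much
    as the term [j = 0]. *)
Lemma sqn_avg_e0 v : pi a v = v -> avg e v = 0 ->
  sqn (avg c v) <= 2 / p%:R * sqn v.
Proof.
move=> av ev; rewrite (sqn_avg cp) mulrC -mulrA [leLHS]mulrC.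
suff : \sum_(i < p) ip v (pi (c ^+ i)%g v) <= 2 * sqn v.
  move=> H; have : 0 <= p%:R^-1 :> R by rewrite invr_ge0.
  move=> /(ler_wpM2l) /(_ _ _ H); congr (_ <= _); ring.
rewrite (bigD1 (Ordinal p_gt0)) //= expg0 pi1 mulr_natl mulr2n lerD2l.
pose s j := (j * (j * p.-1) + 'C(j, 2))%N.
have step (j : 'I_p) : j != Ordinal p_gt0 -> ip v (pi (c ^+ j)%g v) <=
    2^-1 * (sqn (avg (dexp j (s j)) v) + sqn (avg (dexp j 'C(j, 2)) v)).
  move=> j0; rewrite ip_cX_dexp //; set y := avg (dexp j _) v.
  have fy : pi (dexp j 'C(j, 2)) y = y by apply: avg_fix; exact: dexp_order.
  rewrite -(@ip_avg_fix (dexp j (s j))); last first.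
    by rewrite -piM -cX_dexp piM fy.
  by rewrite -(sqn_pi (c ^+ j)%g y); exact: ip_le_half.
apply: le_trans (ler_sum _ step) _; rewrite -mulr_sumr big_split /=.
have pm1 : p.-1%:R = -1 :> 'F_p.
  by apply/eqP; rewrite -addr_eq0 -mulrSr prednK // pchar_Fp_0.
have nz (j l : nat) : (0 < j < p)%N -> (0 < l < p)%N -> j != l ->
    j%:R * l%:R * (j%:R - l%:R) != 0 :> 'F_p.
  move=> hj hl jl; rewrite !mulf_neq0 ?Fp_nat_neq0 // subr_eq0.
  apply: contra jl => /eqP /Fp_nat_eq e1; apply/eqP/e1; lia.
have b1 : \sum_(j < p | j != Ordinal p_gt0) sqn (avg (dexp j 'C(j, 2)) v) <= sqn v.
  apply: (avg_dexp_bessel (t := fun j => 'C(j, 2))) => // j l hj hl jl.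
  apply: contra (nz _ _ hj hl jl) => /eqP; rewrite !natrM => E.
  have -> : j%:R * l%:R * (j%:R - l%:R) =
    l%:R * (j%:R * (j%:R - 1)) - j%:R * (l%:R * (l%:R - 1)) :> 'F_p by ring.
  by rewrite -!binF !mulrA E subrr.
have b2 : \sum_(j < p | j != Ordinal p_gt0) sqn (avg (dexp j (s j)) v) <= sqn v.
  apply: avg_dexp_bessel => // j l hj hl jl.
  apply: contra (nz _ _ hj hl jl) => /eqP; rewrite /s !(natrM, natrD) pm1 => E.
  have -> : j%:R * l%:R * (j%:R - l%:R) =
    - 2%:R * (l%:R * (j%:R * (j%:R * -1)) - j%:R * (l%:R * (l%:R * -1)))
    - (l%:R * (j%:R * (j%:R - 1)) - j%:R * (l%:R * (l%:R - 1))) :> 'F_p by ring.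
  rewrite -!binF.
  have -> : - 2%:R * (l%:R * (j%:R * (j%:R * -1)) - j%:R * (l%:R * (l%:R * -1)))
    - (l%:R * ('C(j, 2)%:R * 2%:R) - j%:R * ('C(l, 2)%:R * 2%:R)) =
    - 2%:R * (l%:R * (j%:R * (j%:R * -1) + 'C(j, 2)%:R) -
              j%:R * (l%:R * (l%:R * -1) + 'C(l, 2)%:R)) :> 'F_p by ring.
  by rewrite E subrr mulr0.
lra.
Qed.

(** Every element of the group generated by [a] and [c] has the form [B2_elt], so the four averages,
    in this order, project onto the vectors fixed by the whole group. *)
Definition avg_vertex x := avg c (avg a (avg d (avg e x))).

Lemma avg_vertex_c x : pi c (avg_vertex x) = avg_vertex x.
Proof. exact: avg_fix. Qed.

Lemma avg_vertex_a x : pi a (avg_vertex x) = avg_vertex x.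
Proof.
rewrite /avg_vertex; set w := avg a _.
have aw : pi a w = w by exact: avg_fix.
have dw : pi d w = w.
  by rewrite /w pi_avg ?(avg_fix dp) //; exact: commute_sym.
have ew : pi e w = w.
  rewrite /w pi_avg; last exact: commute_sym.
  by rewrite pi_avg ?(avg_fix ep) //; exact: commute_sym.
rewrite {1}/avg piZ pi_sum; congr (_ *: _); apply: eq_bigr => j _.
rewrite -piM a_cX -mulgA piM fixM // fixM //; exact: fixX.
Qed.

Lemma avg_vertex_id x : pi a x = x -> pi c x = x -> avg_vertex x = x.
Proof.
move=> ax cx.
have comm g h : pi g x = x -> pi h x = x -> pi [~ g, h]%g x = x.
  by move=> gx hx; rewrite commgEl conjgE; do ?apply: fixM => //; exact: fixV.
have dx : pi d x = x by exact: comm.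
have ex : pi e x = x by exact: comm.
by rewrite /avg_vertex !avg_id // ?avg_id // ?avg_id // ?avg_id.
Qed.

(** Split [v] by the averages over [e] and [d]. The part fixed by both is killed by [avg c], the
    part [v2] with trivial [e] contributes 1/p, the part [v3] without [e]-fixed component at most
    2/p. If [e = 1] then [v3] vanishes. Since [e] commutes with [c], the pieces stay orthogonal
    under [avg c]. *)
Lemma angle_bound v : pi a v = v -> avg_vertex v = 0 ->
  sqn (avg c v) <= 2 / p%:R * sqn v /\
  (e = 1%g -> sqn (avg c v) <= 1 / p%:R * sqn v).
Proof.
move=> av Ev.
set w := avg e v; set v1 := avg d w; set v2 := w - v1; set v3 := v - w.
have aw : pi a w = w by rewrite /w pi_avg ?av.
have av1 : pi a v1 = v1 by rewrite /v1 pi_avg ?aw.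
have ew : pi e w = w by exact: avg_fix.
have ev1 : pi e v1 = v1 by rewrite /v1 pi_avg ?ew //; exact: commute_sym.
have cv1 : avg c v1 = 0 by rewrite -[RHS]Ev /avg_vertex -/w -/v1 (avg_id av1).
have av2 : pi a v2 = v2 by rewrite /v2 piB aw av1.
have av3 : pi a v3 = v3 by rewrite /v3 piB aw av.
have ev2 : pi e v2 = v2 by rewrite /v2 piB ew ev1.
have dv2 : avg d v2 = 0 by rewrite /v2 avgB /v1 avg_idem // subrr.
have ev3 : avg e v3 = 0 by rewrite /v3 avgB /w avg_idem // subrr.
have vE : v = v1 + (v2 + v3) by rewrite /v2 /v3 addrA [v1 + _]addrC subrK addrC subrK.
have cvE : avg c v = avg c v2 + avg c v3 by rewrite {1}vE avgD cv1 add0r avgD.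
have o23 : ip v2 v3 = 0 by rewrite ipC (avg_avg_orth ev3).
have o13 : ip v1 v3 = 0 by rewrite ipC (avg_avg_orth ev3).
have o12 : ip v1 v2 = 0.
  by rewrite ipC (avg_avg_orth dv2) //; exact: avg_fix.
have oc : ip (avg c v2) (avg c v3) = 0.
  rewrite ipC (@avg_avg_orth e) //; first by rewrite (avg_comm _ (commute_sym ec)) ev3 avg0.
  by rewrite pi_avg ?ev2 //; exact: commute_sym.
have sv : sqn v = sqn v1 + (sqn v2 + sqn v3).
  by rewrite {1}vE sqnD (sqnD v2) o23 ipDr o12 o13; ring.
have scv : sqn (avg c v) = sqn (avg c v2) + sqn (avg c v3).
  by rewrite cvE sqnD oc; ring.
have B2v := sqn_avg_central av2 ev2 dv2.
have B3v := sqn_avg_e0 av3 ev3.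
have P0 : 0 <= p%:R^-1 :> R by rewrite invr_ge0.
have n1 := ip_ge0 v1; have n2 := ip_ge0 v2; rewrite -/(sqn _) in n1; rewrite -/(sqn _) in n2.
have m1 := mulr_ge0 P0 n1; have m2 := mulr_ge0 P0 n2.
split; first by rewrite scv sv B2v; move: B3v m1 m2; lra.
move=> e1; have v30 : v3 = 0.
  by rewrite /v3 /w avg_id ?subrr //; rewrite e1 pi1.
rewrite scv sv v30 avg0 B2v /sqn !ip0l; move: m1; rewrite /sqn; lra.
Qed.

Lemma avg_vertexB x y : avg_vertex (x - y) = avg_vertex x - avg_vertex y.
Proof. by rewrite /avg_vertex !avgB. Qed.

(** Removing the vectors fixed by the vertex group changes neither complement. [angle_bound] bounds
    the cosine for the fixed spaces, and [complement_angle] passes to the complements. *)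
Lemma pair_angle eps x : 0 <= eps -> eps < 1 ->
  (2 / p%:R <= eps ^+ 2 \/ e = 1%g /\ 1 / p%:R <= eps ^+ 2) ->
  - eps * nrm (x - avg a x) * nrm (x - avg c x) <=
    ip (x - avg a x) (x - avg c x).
Proof.
move=> e0 e1 he; set y := x - avg_vertex x.
have ya : x - avg a x = y - avg a y.
  by rewrite /y avgB (avg_id (avg_vertex_a x)) opprB addrA subrK.
have yc : x - avg c x = y - avg c y.
  by rewrite /y avgB (avg_id (avg_vertex_c x)) opprB addrA subrK.
have vy : avg_vertex y = 0.
  rewrite /y avg_vertexB (avg_vertex_id (avg_vertex_a x) (avg_vertex_c x)).
  by rewrite subrr.
rewrite ya yc; apply: complement_angle => //; try exact: ip_avg_self.
have fa : pi a (avg a y) = avg a y by exact: avg_fix.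
have va : avg_vertex (avg a y) = 0.
  rewrite -vy /avg_vertex; congr (avg c _).
  rewrite (avg_comm _ (commute_sym ea)) (avg_comm _ (commute_sym da)).
  by rewrite avg_idem.
have [h2 h1] := angle_bound fa va.
have hb : sqn (avg c (avg a y)) <= eps ^+ 2 * sqn (avg a y).
  have s0 := ip_ge0 (avg a y); rewrite -/(sqn _) in s0.
  case: he => [he|[ee he]].
    by apply: le_trans h2 _; rewrite ler_wpM2r.
  by apply: le_trans (h1 ee) _; rewrite ler_wpM2r.
rewrite -(@ip_avg_fix c); last exact: avg_fix.
apply: le_trans (cauchy_schwarz _ _) _.
by rewrite ler_wpM2r // ip_ge0.
Qed.

End Angle.

(** * Spectral gap and relaxation *)

Section Relaxation.
Variables (g : ty -> G) (j k : ty -> ty) (b : ty -> bool).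
Hypotheses (p_pr : prime p) (p_odd : odd p).
Hypothesis jk : forall i, [&& j i != i, k i != i & j i != k i].
Hypothesis gp : forall i, (g i ^+ p = 1)%g.
Hypothesis grel : forall i, vertex_rel (b i) (g (j i)) (g (k i)).
Variables (eps : ty -> R) (lam : R).
Hypothesis eps_range : forall i, 0 <= eps i < 1.
Hypothesis eps_p : forall i, (if b i then 2 else 1) / p%:R <= eps i ^+ 2.
Hypothesis lam_gt0 : 0 < lam.
Hypothesis gap : forall n0 n1 n2 : R, 0 <= n0 -> 0 <= n1 -> 0 <= n2 ->
  lam * (n0 ^+ 2 + n1 ^+ 2 + n2 ^+ 2) <= n0 ^+ 2 + n1 ^+ 2 + n2 ^+ 2
    - 2 * eps T2 * n0 * n1 - 2 * eps T0 * n1 * n2 - 2 * eps T1 * n0 * n2.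

Definition coavg i x := x - avg (g i) x.
Definition laplacian x := coavg T0 x + coavg T1 x + coavg T2 x.
Definition energy x := sqn (coavg T0 x) + sqn (coavg T1 x) + sqn (coavg T2 x).

Lemma coavg_angle i l x : i != l ->
  - eps (third i l) * nrm (coavg i x) * nrm (coavg l x) <= ip (coavg i x) (coavg l x).
Proof.
move=> il; set m := third i l.
have [e0 e1] := andP (eps_range m).
have H : - eps m * nrm (coavg (j m) x) * nrm (coavg (k m) x) <=
    ip (coavg (j m) x) (coavg (k m) x).
  apply: (pair_angle p_pr p_odd (gp (j m)) (gp (k m)) (vertex_rel_B2 (grel m))) => //.
  have := eps_p m; have := grel m; case: (b m) => /= [_|[_ ee]]; auto.
have [[-> ->]|[-> ->]] : i = j m /\ l = k m \/ i = k m /\ l = j m.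
- have := jk m; rewrite /m; move: il; clear; case: i; case: l => //= _;
    by case: (j _) => //; case: (k _) => //; auto.
- exact: H.
- by rewrite ipC mulrAC.
Qed.

Lemma spectral_gap x : lam * energy x <= sqn (laplacian x).
Proof.
have := gap (nrm_ge0 (coavg T0 x)) (nrm_ge0 (coavg T1 x)) (nrm_ge0 (coavg T2 x)).
rewrite !sqr_nrm -/(energy x) => h; apply: le_trans h _.
have h2 := @coavg_angle T0 T1 x isT; have h0 := @coavg_angle T1 T2 x isT.
have h1 := @coavg_angle T0 T2 x isT.
rewrite /laplacian sqnD sqnD ipDl /energy.
move: h0 h1 h2; rewrite /=; lra.
Qed.

Lemma energyE x : energy x = ip (laplacian x) x.
Proof.
rewrite /laplacian ipDl (ipDl (coavg T0 x)) /energy.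
by congr (_ + _ + _); symmetry; exact: ip_compl_self.
Qed.

Lemma coavgD i x y : coavg i (x + y) = coavg i x + coavg i y.
Proof. by rewrite /coavg avgD opprD addrACA. Qed.

Lemma coavgZ i a x : coavg i (a *: x) = a *: coavg i x.
Proof. by rewrite /coavg avgZ scalerBr. Qed.

Lemma laplacianD x y : laplacian (x + y) = laplacian x + laplacian y.
Proof. by rewrite /laplacian !coavgD [RHS]addrACA (addrACA (coavg T0 x)). Qed.

Lemma laplacianZ a x : laplacian (a *: x) = a *: laplacian x.
Proof. by rewrite /laplacian !coavgZ !scalerDr. Qed.

Lemma ip_coavg i x y : ip (coavg i x) y = ip x (coavg i y).
Proof. by rewrite /coavg ipBl ipBr (ip_avg (gp i)). Qed.

Lemma ip_laplacian x y : ip (laplacian x) y = ip x (laplacian y).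
Proof.
rewrite /laplacian ipDl (ipDl (coavg T0 x)) ipDr (ipDr x (coavg T0 y)).
by rewrite !ip_coavg.
Qed.

Lemma energy_le x : energy x <= 3 * sqn x.
Proof.
have h i := sqn_compl_le (gp i) x.
have := h T0; have := h T1; have := h T2; rewrite /energy /coavg; lra.
Qed.

Lemma sqn_laplacian_le x : sqn (laplacian x) <= 3 * energy x.
Proof.
rewrite /laplacian /energy sqnD sqnD ipDl.
have h u v := ip_ge0 (u - v).
have := h (coavg T0 x) (coavg T1 x); have := h (coavg T1 x) (coavg T2 x).
have := h (coavg T0 x) (coavg T2 x); rewrite -!/(sqn _) !sqnB; lra.
Qed.

Definition relax x := x - 3^-1 *: laplacian x.

Lemma energy_ge0 x : 0 <= energy x.
Proof. by rewrite !addr_ge0 // ip_ge0. Qed.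

(** [laplacian] is a sum of three projections, so its norm is at most 3. With step 1/3 the quadratic
    term is thus at most half of the linear gain, and the spectral gap bounds what remains. *)
Lemma energy_relax x : energy (relax x) <= (1 - lam / 3) * energy x.
Proof.
have -> : energy (relax x) = energy x - 2 / 3 * sqn (laplacian x)
    + 9^-1 * energy (laplacian x).
  have L : laplacian (relax x) = laplacian x - 3^-1 *: laplacian (laplacian x).
    by rewrite /relax -scaleNr laplacianD laplacianZ scaleNr.
  rewrite !energyE L ipBl ipZl /relax !(ipBr _ x) !ipZr.
  rewrite (ip_laplacian (laplacian x) x) -/(sqn (laplacian x)); lra.
have := spectral_gap x; have := energy_le (laplacian x); lra.
Qed.

Lemma relax_dist x : sqn (x - relax x) <= energy x / 3.
Proof.
rewrite /relax opprB addrC subrK sqnZ; have := sqn_laplacian_le x; lra.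
Qed.

Lemma iter_relax_energy n x : energy (iter n relax x) <= (1 - lam / 3) ^+ n * energy x.
Proof.
have l1 : 0 <= 1 - lam / 3.
  have := gap (lexx 0) (lexx 0) (@ler01 R); lra.
elim: n => [|n IH]; first by rewrite expr0 mul1r.
apply: le_trans (energy_relax _) _; rewrite exprS -mulrA.
exact: ler_wpM2l.
Qed.

Lemma fixed_near x delta : ip_complete -> 0 <= delta ->
  (forall i, nrm (coavg i x) <= delta) ->
  exists y, (forall i, pi (g i) y = y) /\ nrm (x - y) <= 6 / lam * delta.
Proof.
(* Norms decay like square roots of energies, and [(1 - lam / 6) ^+ 2] is at least [1 - lam / 3]. *)
move=> compl d0 xd; pose u n := iter n relax x; pose r := 1 - lam / 6.
have lam1 : lam <= 1.
  have := gap (lexx 0) (lexx 0) (@ler01 R); lra.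
have r0 : 0 <= r by rewrite /r; lra.
have r1 : r < 1 by rewrite /r; move: lam_gt0; lra.
have sx i : sqn (coavg i x) <= delta ^+ 2.
  by rewrite -sqr_nrm ler_pXn2r ?nnegrE ?nrm_ge0.
have E n : energy (u n) <= 3 * (delta * r ^+ n) ^+ 2.
  apply: le_trans (iter_relax_energy n x) _.
  have rl : 0 <= 1 - lam / 3 by lra.
  have e1 : (1 - lam / 3) ^+ n <= (r ^+ n) ^+ 2.
    rewrite -exprM mulnC exprM; apply: lerXn2r; rewrite ?nnegrE ?exprn_ge0 //.
    by rewrite /r; have := sqr_ge0 lam; lra.
  have e2 : energy x <= 3 * delta ^+ 2.
    by rewrite /energy; have := sx T0; have := sx T1; have := sx T2; lra.
  have := ler_pM (exprn_ge0 n rl) (energy_ge0 x) e1 e2.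
  by move/le_trans; apply; rewrite exprMn le_eqVlt; apply/orP; left; apply/eqP; ring.
have [y yP] : exists y, forall n, nrm (u n - y) <= delta / (1 - r) * r ^+ n.
  apply: geometric_limit => //; first by rewrite r0.
  move=> n; rewrite -(ler_pXn2r (n := 2)) ?nnegrE ?nrm_ge0 ?mulr_ge0 ?exprn_ge0 //.
  by rewrite sqr_nrm; apply: le_trans (relax_dist (u n)) _; have := E n; lra.
have dE : delta / (1 - r) = 6 / lam * delta.
  rewrite /r; field; rewrite ?gt_eqF //=; apply/andP; split; rewrite ?gt_eqF //.
exists y; split; last by have := yP 0%N; rewrite expr0 mulr1 dE.
move=> i; suff ci : coavg i y = 0.
  by move/eqP: ci; rewrite subr_eq0 => /eqP ->; exact: avg_fix.
have cle z : nrm (coavg i z) <= nrm z.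
  by rewrite -(ler_pXn2r (n := 2)) ?nnegrE ?nrm_ge0 // !sqr_nrm; exact: sqn_compl_le.
have cu n : nrm (coavg i (u n)) <= 2 * (delta * r ^+ n).
  have X0 : 0 <= delta * r ^+ n by rewrite mulr_ge0 ?exprn_ge0.
  rewrite -(ler_pXn2r (n := 2)) ?nnegrE ?nrm_ge0 ?mulr_ge0 ?exprn_ge0 // sqr_nrm.
  have : sqn (coavg i (u n)) <= energy (u n).
    have := ip_ge0 (coavg T0 (u n)); have := ip_ge0 (coavg T1 (u n)).
    have := ip_ge0 (coavg T2 (u n)); rewrite /energy /sqn; by move: i {cle}; case; lra.
  have := E n; have := sqr_ge0 (delta * r ^+ n); lra.
have small n : nrm (coavg i y) <= (2 * delta + delta / (1 - r)) * r ^+ n.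
  have -> : coavg i y = coavg i (u n) + coavg i (- (u n - y)).
    by rewrite -coavgD opprB addrC subrK.
  apply: le_trans (nrmD _ _) _.
  have := cu n; have := yP n; have := cle (- (u n - y)); rewrite nrmN; lra.
apply: nrm_eq0; apply/eqP; rewrite eq_le nrm_ge0 andbT; apply/ler_addgt0Pr => e e0.
rewrite add0r; set C := _ + _ in small.
have C0 : 0 <= C by rewrite addr_ge0 ?mulr_ge0 ?invr_ge0 // subr_ge0 ltW.
have [N NP] := power_lt r0 r1 (divr_gt0 e0 (ltr_pwDr ltr01 C0)).
have := NP N (leqnn N); rewrite ltr_pdivlMr ?(ltr_pwDr ltr01 C0) //.
have := small N; have := exprn_ge0 N r0; nra.
Qed.

End Relaxation.
End Representation.
End InnerProduct.

Local Open Scope classical_set_scope.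

(** * Property (T) *)

Record orthogonal_rep (R : realType) (V : lmodType R) (ip : V -> V -> R)
    (G : groupType) (pi : G -> V -> V) : Prop := OrthogonalRep {
  or_C : forall x y, ip x y = ip y x;
  or_Dl : forall x y z, ip (x + y) z = ip x z + ip y z;
  or_Zl : forall a x y, ip (a *: x) y = a * ip x y;
  or_ge0 : forall x, 0 <= ip x x;
  or_eq0 : forall x, ip x x = 0 -> x = 0;
  or_complete : ip_complete ip;
  or_piD : forall g x y, pi g (x + y) = pi g x + pi g y;
  or_piZ : forall g a x, pi g (a *: x) = a *: pi g x;
  or_pi1 : forall x, pi 1%g x = x;
  or_piM : forall g h x, pi (g * h)%g x = pi g (pi h x);
  or_piU : forall g x y, ip (pi g x) (pi g y) = ip x y }.

Lemma conj_conjc (R : rcfType) (z : R[i]) : Num.conj z = conjc z.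
Proof.
have [->|z0] := eqVneq z 0; first by rewrite rmorph0 conjc0.
by apply: (mulfI z0); rewrite -normCK sqr_normc.
Qed.

Section RealForm.
Variables (R : realType) (H : completeNormedModType R[i]).
Variables (form : {dot H for @Num.conj R[i]}) (hf : hilbert_product form).

(** An alias of [H], so that the real scalar action does not collide with the complex one. *)
Definition realify : Type := H.
HB.instance Definition _ := GRing.Zmodule.on realify.

Fact realify_scalerA (a b : R) (x : realify) :
  a%:C%C *: (b%:C%C *: (x : H)) = (a * b)%:C%C *: (x : H).
Proof. by rewrite scalerA rmorphM. Qed.

Fact realify_scale1r (x : realify) : (1 : R)%:C%C *: (x : H) = x.
Proof. by rewrite rmorph1 scale1r. Qed.

Fact realify_scalerDr (a : R) (x y : realify) :
  a%:C%C *: (x + y : H) = a%:C%C *: (x : H) + a%:C%C *: (y : H).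
Proof. by rewrite scalerDr. Qed.

Fact realify_scalerDl (x : realify) (a b : R) :
  (a + b)%:C%C *: (x : H) = a%:C%C *: (x : H) + b%:C%C *: (x : H).
Proof. by rewrite rmorphD scalerDl. Qed.

HB.instance Definition _ := @GRing.Zmodule_isLmodule.Build R realify
  (fun a x => a%:C%C *: (x : H))
  realify_scalerA realify_scale1r realify_scalerDr realify_scalerDl.

Definition real_form (x y : realify) : R := complex.Re (form x y).

Lemma real_formC x y : real_form x y = real_form y x.
Proof. by rewrite /real_form hermC expr0 mul1r /= conj_conjc; case: (form y x). Qed.

Lemma real_formDl x y z : real_form (x + y) z = real_form x z + real_form y z.
Proof. by rewrite /real_form linearDl raddfD. Qed.

Lemma real_formZl a x y : real_form (a *: x) y = a * real_form x y.
Proof.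
rewrite /real_form [a *: x]/(a%:C%C *: (x : H)) linearZl /=.
by case: (form x y) => u v /=; rewrite mul0r subr0.
Qed.

Lemma form_real x : form x x = (real_form x x)%:C%C.
Proof. by rewrite /real_form RRe_real // ger0_real // dnorm_ge0. Qed.

Lemma real_form_ge0 x : 0 <= real_form x x.
Proof. by rewrite -lecR -form_real dnorm_ge0. Qed.

Lemma real_form_eq0 x : real_form x x = 0 -> x = 0.
Proof. by move=> x0; apply/eqP; rewrite -(dnorm_eq0 form) form_real x0. Qed.

Lemma normE (x : H) : `|x| = (nrm real_form x)%:C%C.
Proof.
apply/eqP; rewrite -(@eqrXn2 _ 2) ?ler0c ?nrm_ge0 // hf form_real.
by rewrite -rmorphXn /= (sqr_nrm real_form_ge0).
Qed.

Lemma real_form_complete : ip_complete real_form.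
Proof.
move=> u uc; have /cauchy_cvg : cauchy (u @ \oo : set_system H).
  apply/cauchy_ballP => e e0.
  have er : e = (complex.Re e)%:C%C by rewrite RRe_real // gtr0_real.
  move: e0; rewrite er ltcR => e0; have [N NP] := uc _ e0.
  exists (u @` [set n | (N <= n)%N], u @` [set n | (N <= n)%N]).
    by split; exists N => // n Nn; exists n.
  move=> [_ _] [/= [m Nm <-] [n Nn <-]]; rewrite -ball_normE /= normE ltcR.
  exact: NP.
move=> /cvg_ex[/= y uy]; exists y => e e0.
have := (@cvgrPdist_lt _ _ _ _ _ (u : nat -> H) y).1 uy e%:C%C.
rewrite ltcR => /(_ _ e0) [N _ NP]; exists N => n Nn.
have := NP n Nn; rewrite /= normE ltcR.
by rewrite -(nrmN real_formC real_formZl) opprB.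
Qed.

Lemma unitary_orthogonal (G : groupType) (pi : G -> {linear H -> H}) :
  unitary_representation form pi -> orthogonal_rep real_form (fun g x => pi g x).
Proof.
move=> [pi1 piM piU]; split => //.
- exact: real_formC.
- exact: real_formDl.
- exact: real_formZl.
- exact: real_form_ge0.
- exact: real_form_eq0.
- exact: real_form_complete.
- by move=> g x y; exact: (linearD (pi g)).
- by move=> g a x; exact: (linearZZ (pi g) a%:C%C x).
- by move=> g x y; rewrite /real_form piU.
Qed.

End RealForm.

Lemma property_T_of_orthogonal (R : realType) (G : groupType) (S : seq G) (eps : R) :
  0 < eps ->
  (forall (V : lmodType R) (ip : V -> V -> R) (pi : G -> V -> V),
    orthogonal_rep ip pi -> forall x, x != 0 ->
    (forall g, g \in S -> nrm ip (pi g x - x) <= eps * nrm ip x) ->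
    exists2 y, y != 0 & forall g, pi g y = y) ->
  property_T R G.
Proof.
move=> eps0 K; exists [set` S], eps; split=> //.
move=> H form pi hf /(unitary_orthogonal hf) rep [x x0 xS].
apply: (K _ _ _ rep x) => // g gS; have := xS g gS.
by rewrite !(normE hf) -rmorphM ltcR => /ltW.
Qed.

Record gap_constants (R : realType) (p : nat) (b : ty -> bool) (eps : ty -> R)
    (lam : R) : Prop := GapConstants {
  gap_range : forall i, 0 <= eps i < 1;
  gap_p : forall i, (if b i then 2 else 1) / p%:R <= eps i ^+ 2;
  gap_gt0 : 0 < lam;
  gap_le : forall n0 n1 n2 : R, 0 <= n0 -> 0 <= n1 -> 0 <= n2 ->
    lam * (n0 ^+ 2 + n1 ^+ 2 + n2 ^+ 2) <= n0 ^+ 2 + n1 ^+ 2 + n2 ^+ 2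
      - 2 * eps T2 * n0 * n1 - 2 * eps T0 * n1 * n2 - 2 * eps T1 * n0 * n2 }.

Section TriangleRep.
Variables (R : realType) (p : nat) (b : ty -> bool) (eps : ty -> R) (lam : R).
Hypotheses (p_pr : prime p) (p_odd : odd p) (gc : gap_constants p b eps lam).
Variables (G : groupType) (g : ty -> G) (j k : ty -> ty).
Hypothesis jk : forall i, [&& j i != i, k i != i & j i != k i].
Hypothesis gp : forall i, (g i ^+ p = 1)%g.
Hypothesis grel : forall i, vertex_rel (b i) (g (j i)) (g (k i)).

(** With all powers in the Kazhdan set, [dist_avg] bounds the distance to each fixed space without a
    factor [p]. *)
Definition generator_powers : seq G :=
  [seq (g i ^+ n)%g | i <- [:: T0; T1; T2], n <- iota 0 p].

Lemma generator_powersP i n : (g i ^+ n)%g \in generator_powers.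
Proof.
rewrite (divn_eq n p) expgnDr mulnC expgnA gp expg1n mul1g; apply: allpairs_f; first by case: i.
by rewrite mem_iota ltn_mod prime_gt0.
Qed.

Section Vector.
Variables (V : lmodType R) (ip : V -> V -> R) (pi : G -> V -> V).
Hypothesis rep : orthogonal_rep ip pi.
Let n_ge0 := nrm_ge0 ip.

(** The tolerance [lam / 24] cancels the factor [6 / lam] of [fixed_near] down to 1/4, which leaves
    room for the averaging over [t] in the extension. *)
Lemma near_fixed x :
  (forall h, h \in generator_powers -> nrm ip (pi h x - x) <= lam / 24 * nrm ip x) ->
  exists2 y, (forall i, pi (g i) y = y) & nrm ip (x - y) <= 4^-1 * nrm ip x.
Proof.
move=> small; have p0 := prime_gt0 p_pr;
have lam0 := gap_gt0 gc.
have [|i|y [fixy dist]] := @fixed_near _ _ ip (or_C rep) (or_Dl rep) (or_Zl rep)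
  (or_ge0 rep) (or_eq0 rep) _ pi (or_piD rep) (or_piZ rep) (or_pi1 rep) (or_piM rep)
  (or_piU rep) p p0 g j k b p_pr p_odd jk gp grel eps lam (gap_range gc) (gap_p gc)
  lam0 (gap_le gc) x (lam / 24 * nrm ip x) (or_complete rep).
- by rewrite mulr_ge0 ?divr_ge0 // ltW.
- apply: (dist_avg (or_C rep) (or_Dl rep) (or_Zl rep) (or_ge0 rep)) => // n.
  exact/small/generator_powersP.
exists y => //; apply: le_trans dist _.
by rewrite mulrA le_eqVlt; apply/orP; left; apply/eqP; field; rewrite gt_eqF.
Qed.

Lemma near_neq0 x y c : x != 0 -> c < 1 -> nrm ip (x - y) <= c * nrm ip x -> y != 0.
Proof.
move=> x0 c1; apply: contraL => /eqP ->; rewrite subr0 -ltNge gtr_pMl //.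
rewrite lt_def n_ge0 andbT; apply: contra x0 => /eqP x0.
by apply/eqP/(nrm_eq0 (or_ge0 rep) (or_eq0 rep)).
Qed.

End Vector.
End TriangleRep.

Lemma triangle_property_T (R : realType) p j k b (G : groupType) (g : ty -> G)
    (eps : ty -> R) lam : prime p -> odd p -> triangle_group p j k b g ->
  gap_constants p b eps lam -> property_T R G.
Proof.
move=> p_pr p_odd tg gc.
apply: (@property_T_of_orthogonal R G (generator_powers p g) (lam / 24)).
  by rewrite divr_gt0 // (gap_gt0 gc).
move=> V ip pi rep x x0 small.
have [y fixy dist] := near_fixed p_pr p_odd gc (tg_others tg) (tg_order tg)
  (tg_rel tg) rep small.
exists y; first by apply: (near_neq0 rep x0 _ dist); rewrite invf_lt1 ?ltr1n.
apply: (tg_ind tg) => [|h i hy]; first exact: or_pi1 rep y.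
by rewrite (or_piM rep) fixy.
Qed.

Section Extension.
Variables (R : realType) (p : nat) (eps : ty -> R) (lam : R).
Hypotheses (p_pr : prime p) (p_odd : odd p) (gc : gap_constants p xpredT eps lam).
Variables (G : groupType) (t a : G).
Hypothesis t3 : (t ^+ 3 = 1)%g.
Hypothesis ap : (a ^+ p = 1)%g.
Hypothesis Bab : B2 a (a ^ t^-1)%g.
Hypothesis ext_ind : forall D : G -> Prop, D 1%g -> (forall x, D x -> D (x * t)%g) ->
  (forall x, D x -> D (x * a)%g) -> forall x, D x.

Lemma ext_genJ n : exists i, (a ^ (t ^+ n) = ext_gen t a i)%g.
Proof.
elim: n => [|n [i e]]; first by exists T0; rewrite expg0 conjg1.
exists (ty_next (ty_next i)); rewrite expgSr conjgM e.
have -> : i = ty_next (ty_next (ty_next i)) by case: i {e}.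
by rewrite (ext_gen_next a t3) -conjgM mulVg conjg1; case: i {e}.
Qed.

(** A nearby vector fixed by the three conjugates of [a] is averaged over the powers of [t]. Since
    [t] permutes these conjugates, the average is still fixed by [a], and it stays within
    [lam / 24 + 1 / 4] of the given vector, relative to its norm. *)
Lemma extension_property_T : property_T R G.
Proof.
pose S := [seq (t ^+ n)%g | n <- iota 0 3] ++ generator_powers p (ext_gen t a).
have tS n : (t ^+ n)%g \in S.
  rewrite mem_cat (divn_eq n 3) expgnDr mulnC expgnA t3 expg1n mul1g map_f //.
  by rewrite mem_iota ltn_mod.
have lam0 := gap_gt0 gc.
have lam1 : lam <= 1.
  have [r0 _] := andP (gap_range gc T0).
  have := gap_le gc (lexx 0) (lexx 0) (@ler01 R); lra.
apply: (@property_T_of_orthogonal R G S (lam / 24)); first by rewrite divr_gt0.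
move=> V ip pi rep x x0 small.
have jk i : [&& ty_next i != i, ty_next (ty_next i) != i & ty_next i != ty_next (ty_next i)].
  by case: i.
have gen h : h \in generator_powers p (ext_gen t a) ->
    nrm ip (pi h x - x) <= lam / 24 * nrm ip x.
  by move=> hS; apply: small; rewrite mem_cat hS orbT.
have [y fixy dist] := near_fixed p_pr p_odd gc jk (ext_gen_order t ap)
  (fun i => ext_gen_rel t3 Bab i) rep gen.
have [C Dl Zl ge0 eq0 _ D Z pi1 M U] := rep.
pose z := avg pi 3 t y.
have tz : pi t z = z by exact: (avg_fix D Z M).
have az : pi a z = z.
  rewrite /z /avg Z (pi_sum D Z); congr (_ *: _); apply: eq_bigr => n _.
  rewrite -M conjgC M; have [i ->] := ext_genJ n.
  by rewrite fixy.
have dz : nrm ip (x - z) <= (lam / 24 + 4^-1) * nrm ip x.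
  rewrite -(subrKA (avg pi 3 t x)); apply: le_trans (nrmD C Dl Zl ge0 _ _) _.
  rewrite mulrDl; apply: lerD.
    apply: (dist_avg C Dl Zl ge0) => // n; exact: small.
  rewrite -(avgB D Z); apply: le_trans dist.
  rewrite -(ler_pXn2r (n := 2)) ?nnegrE ?nrm_ge0 // !(sqr_nrm ge0).
  exact: (sqn_avg_le C Dl Zl ge0).
exists z; first by apply: (near_neq0 rep x0 _ dz); lra.
by apply: ext_ind => [//|h hz|h hz]; rewrite M ?tz ?az.
Qed.

End Extension.

(** * Numerical constants *)

Section Constants.
Variables (R : realType) (p : nat).

(* [1 / 7 <= (38 / 100) ^+ 2] and [2 / 7 <= (535 / 1000) ^+ 2]; the vertex of
   type [T2] carries the relation [A2] in both groups. *)
Definition HC2_eps (i : ty) : R := if i is T2 then 38 / 100 else 535 / 1000.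

Lemma inv_nat_le m : (0 < m)%N -> (m <= p)%N -> p%:R^-1 <= m%:R^-1 :> R.
Proof.
move=> m0 mp; rewrite lef_pV2 ?posrE ?ltr0n ?(leq_trans m0 mp) //.
by rewrite ler_nat.
Qed.

Lemma HC2_gap (b : ty -> bool) : (7 <= p)%N -> b T2 = false ->
  gap_constants p b HC2_eps (1 / 50).
Proof.
move=> p7 b2; have := @inv_nat_le 7 isT p7 => ip; split.
- by case=> /=; lra.
- by case=> /=; [case: (b T0)|case: (b T1)|rewrite b2]; lra.
- lra.
move=> n0 n1 n2 h0 h1 h2 /=.
(* Completing the square in [n2], whose coefficient is 1 - 1/50 = 980/1000. *)
have := sqr_ge0 (n2 - 535 / 980 * (n0 + n1)); have := sqr_ge0 (n0 - n1).
have := sqr_ge0 n0; have := sqr_ge0 n1; lra.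
Qed.

(** With three equal cosines the worst case is [n0 = n1 = n2], so a gap requires a cosine below 1/2.
    The value 4265/10000 is just above the square root of 2/11, whereas 2/7 already exceeds 1/4. *)
Lemma HBC2_gap : (11 <= p)%N ->
  gap_constants p xpredT (fun=> 4265 / 10000 : R) (1 / 10).
Proof.
move=> p11; have := @inv_nat_le 11 isT p11 => ip; split.
- by move=> _; lra.
- by move=> _; lra.
- lra.
move=> n0 n1 n2 h0 h1 h2 /=.
have := sqr_ge0 (n0 - n1); have := sqr_ge0 (n1 - n2); have := sqr_ge0 (n0 - n2).
have := sqr_ge0 n0; have := sqr_ge0 n1; have := sqr_ge0 n2; lra.
Qed.

End Constants.

Lemma prime_odd p : prime p -> (2 < p)%N -> odd p.
Proof. by move=> /even_prime[->|]. Qed.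

Lemma property_T_HC2_HB2 (R : realType) p : prime p -> (7 <= p)%N ->
  property_T R (HC2_group p) /\ property_T R (HB2_group p).
Proof.
move=> p_pr p7; have p_odd : odd p := prime_odd p_pr (@leq_trans 7 3 p isT p7).
split; first exact: (triangle_property_T p_pr p_odd (HC2_triangle p_pr) (HC2_gap R p7 erefl)).
exact: (triangle_property_T p_pr p_odd (HB2_triangle p_pr) (HC2_gap R p7 erefl)).
Qed.

Lemma property_T_HBC2_ext (R : realType) p : prime p -> (11 <= p)%N ->
  property_T R (HBC2_ext_group p).
Proof.
move=> p_pr p11; have p_odd : odd p := prime_odd p_pr (@leq_trans 11 3 p isT p11).
have [t3 ap _ Bab] := ext_rels p.
exact: (extension_property_T p_pr p_odd (HBC2_gap R p11) t3 ap Bab (ext_ind p_pr)).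
Qed.

Local Close Scope classical_set_scope.
Local Close Scope ring_scope.

Theorem theorem1p3 (R : realType) :
  (forall p : nat, prime p -> odd p ->
    [/\ infinite_group (HC2_group p) /\ hyperbolic_group R (HC2_group p),
        infinite_group (HB2_group p) /\ hyperbolic_group R (HB2_group p) &
        infinite_group (HBC2_ext_group p) /\ hyperbolic_group R (HBC2_ext_group p)]) /\
  (forall p : nat, prime p -> 7 <= p ->
    property_T R (HC2_group p) /\ property_T R (HB2_group p)) /\
  (forall p : nat, prime p -> 11 <= p -> property_T R (HBC2_ext_group p)).
Proof.
split; first exact: infinite_hyperbolic.
by split; [exact: property_T_HC2_HB2 | exact: property_T_HBC2_ext].
Qed.
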